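(* Let $m,d\ge1$ be integers, $A,B:\mathbb R^m\to\mathbb R^{d\times d}$ measurable, $(Y_t)_{t\in\mathbb Z}$ a strictly stationary $\mathbb R^m$-valued process, and $(\varepsilon_t)_{t\ge1}$ an i.i.d. sequence of $\mathbb R^d$-valued random variables independent of $(Y_t)_{t\in\mathbb Z}$. Let $$X_{t+1}=A(Y_t)X_t+B(Y_t)\varepsilon_{t+1},\quad t\in\mathbb N,\qquad X_0=x_0,$$ with $x_0\in\mathbb R^d$ deterministic. Assume: (i) $A$ and $B$ are bounded; $A(y)$ and $B(y)$ are invertible for all $y\in\mathbb R^m$ and $\sup_{y\in\mathbb R^m}\left(|||A(y)^{-1}|||+|||B(y)^{-1}|||\right)<\infty$; the common law of the $\varepsilon_t$ has a density $f:\mathbb R^d\to[0,\infty)$ with respect to Lebesgue measure which is (Lebesgue-almost everywhere) bounded away from $0$ on each compact set; and $\mathbb E|\varepsilon_1|<\infty$; (ii) there is an integer $p\ge1$ such that $\mathbb E\left[\ln|||A(Y_p)A(Y_{p-1})\cdots A(Y_1)|||\right]<0$, and there are $\eta>0$ and a differentiable function $\Gamma:(-\eta,\eta)\to\mathbb R$ such that for all $a\in(-\eta,\eta)$ $$\lim_{n\to\infty}\frac1n\ln\mathbb E\prod_{i=1}^n|||A(Y_{ip})A(Y_{ip-1})\cdots A(Y_{(i-1)p+1})|||^{a}=\Gamma(a).$$ Then there is a probability measure $\mu_*$ on $\mathcal B(\mathbb R^d)$, independent of $x_0$, and constants $c,C>0$ such that $d_{TV}(\mathrm{Law}(X_N),\mu_*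 )\le Ce^{-cN^{1/3}}$ for all $N\in\mathbb N$. Furthermore, if $Y$ is ergodic, then for every bounded measurable $\Phi:\mathbb R^d\to\mathbb R$, $$\frac{\Phi(X_1)+\ldots+\Phi(X_N)}{N}\to\int_{\mathbb R^d}\Phi(z)\,\mu_*(dz),\qquad N\to\infty,$$ in $L^q$ for all $1\le q<\infty$.
   Context: $|||M|||$ denotes the operator norm of a matrix $M\in\mathbb R^{d\times d}$. $d_{TV}(\mu_1,\mu_2)=|\mu_1-\mu_2|(\mathbb R^d)$ is the total mass of the total variation of $\mu_1-\mu_2$. A stationary process $(Y_t)_{t\in\mathbb Z}$ is ergodic if its law on the path space gives probability $0$ or $1$ to every measurable set $E$ of paths with $S^{-1}(E)=E$, where $S$ is the left shift $(S\mathbf y)_j=\mathbf y_{j+1}$. *)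

(* Defs.v *)
From HB Require Import structures.
From mathcomp Require Import all_boot all_order all_algebra.
From mathcomp Require Import all_classical all_reals all_analysis.
From mathcomp Require Import measurable_realfun.

Set Implicit Arguments.
Unset Strict Implicit.
Unset Printing Implicit Defensive.

Import Order.TTheory GRing.Theory Num.Theory.
Import numFieldNormedType.Exports.

Local Open Scope classical_set_scope.
Local Open Scope ring_scope.

Definition mx_borel_display : measure_display. 
Proof. exact: default_measure_display. Qed.

Section mx_borel.
Context (R : realType) (m n : nat).

Let mx_borel : set (set 'M[R]_(m, n)) := <<s [set U | open U] >>.

Let mx_borel0 : mx_borel set0.
Proof. exact: sigma_algebra0. Qed.

Let mx_borelC A : mx_borel A -> mx_borel (~` A).
Proof. exact: sigma_algebraC. Qed.

Let mx_borel_bigcup (F : (set 'M[R]_(m, n))^nat) :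
  (forall i, mx_borel (F i)) -> mx_borel (\bigcup_i F i).
Proof. exact: sigma_algebra_bigcup. Qed.

HB.instance Definition _ := @isMeasurable.Build mx_borel_display
  'M[R]_(m, n) mx_borel mx_borel0 mx_borelC mx_borel_bigcup.

End mx_borel.

Lemma open_measurable_mx (R : realType) m n (U : set 'M[R]_(m, n)) :
  open U -> measurable U.
Proof. by move=> oU; exact: sub_sigma_algebra. Qed.

Lemma measurable_mx_coord (R : realType) m n i j :
  measurable_fun setT (fun M : 'M[R]_(m, n) => M i j).
Proof.
apply: (measurability _ (RGenOInfty.measurableE R)) => _ [_ [a ->] <-].
rewrite setTI; apply: open_measurable_mx.
apply: open_comp; last by rewrite set_itvE; exact: open_gt.
by move=> x _; exact: coord_continuous.
Qed.

Lemma measurable_fun_mxP (R : realType) d (T : measurableType d) m n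
    (f : T -> 'M[R]_(m, n)) :
  measurable_fun setT f <->
  forall i j, measurable_fun setT (fun x => f x i j).
Proof.
split=> [mf i j|mf].
  exact: (measurableT_comp (@measurable_mx_coord R m n i j) mf).
apply: (measurability [set U : set 'M[R]_(m, n) | open U]) => //.
move=> _ [U oU <-]; rewrite setTI.
pose c (qk : 'M[rat]_(m, n) * nat) : 'M[R]_(m, n) := map_mx ratr qk.1.
pose r (qk : 'M[rat]_(m, n) * nat) : R := qk.2.+1%:R^-1.
pose F qk := [set x : T | ball (c qk) (r qk) `<=` U /\
                          ball (c qk) (r qk) (f x)].
have -> : f @^-1` U = \bigcup_qk F qk.
  apply/seteqP; split=> x /=; last by move=> [qk _ [+]]; exact.
  move=> Ufx; have : nbhs (f x) U by exact: open_nbhs_nbhs.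
  move=> /nbhs_ballP[e/= e0 xeU].
  have [k ke] : exists k : nat, k.+1%:R^-1 < e / 2.
    have := near_infty_natSinv_lt (PosNum (divr_gt0 e0 (ltr0n R 2))).
    by move=> [k _ /(_ k (leqnn k))]; exists k.
  have k0 : 0 < k.+1%:R^-1 :> R by rewrite invr_gt0.
  have qP i j : exists q : rat, `|ratr q - f x i j| < k.+1%:R^-1.
    have /rat_in_itvoo[q] :
        f x i j - k.+1%:R^-1 < f x i j + k.+1%:R^-1 :> R.
      by rewrite ltrD2l gtrN.
    by rewrite in_itv/= -ltr_distl; exists q.
  pose q := \matrix_(i, j) projT1 (cid (qP i j)).
  have qxk : ball (c (q, k)) (r (q, k)) (f x).
    split => // i j; rewrite !mxE; exact: (projT2 (cid (qP i j))).
  exists (q, k) => //; split => // y qy; apply: xeU.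
  rewrite (splitr e); apply: (@le_ball _ _ _ (k.+1%:R^-1 + k.+1%:R^-1)).
    by rewrite lerD ?ltW.
  exact: ball_triangle (ball_sym qxk) qy.
apply: countable_bigcupT_measurable; first exact: countableP.
move=> qk; have [qkU|qkU] := pselect (ball (c qk) (r qk) `<=` U); last first.
  by rewrite (_ : F qk = set0)//; apply/seteqP; split=> x // -[].
have -> : F qk = \bigcap_(ij in [set: 'I_m * 'I_n])
    (fun x => f x ij.1 ij.2) @^-1` ball (c qk ij.1 ij.2) (r qk).
  apply/seteqP; split=> x /=.
    by move=> [_ [_ qf]] [i j] _; exact: qf.
  move=> qf; split=> //; split=> [|i j]; first by rewrite invr_gt0.
  exact: (qf (i, j)).
apply: fin_bigcap_measurable => //.
move=> [i j] _ /=; rewrite -[X in measurable X]setTI.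
by apply: mf => //; exact: measurable_ball.
Qed.

Definition cv_cons (R : realType) n (x : R) (v : 'cV[R]_n) : 'cV[R]_n.+1 :=
  col_mx (const_mx x : 'cV_1) v.

Lemma cv_cons0 (R : realType) n (x : R) (v : 'cV[R]_n) :
  cv_cons x v ord0 ord0 = x.
Proof.
have -> : ord0 = lshift n (ord0 : 'I_1) by exact/val_inj.
by rewrite [LHS]col_mxEu mxE.
Qed.

Lemma cv_consS (R : realType) n (x : R) (v : 'cV[R]_n) i :
  cv_cons x v (lift ord0 i) ord0 = v i ord0.
Proof.
have -> : lift ord0 i = rshift 1 i by exact/val_inj.
by rewrite [LHS]col_mxEd.
Qed.

Lemma measurable_cv_cons (R : realType) n : measurable_fun setT
  (fun xv : R * 'cV[R]_n => cv_cons xv.1 xv.2).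
Proof.
apply/measurable_fun_mxP => i j; rewrite (ord1 j).
case: (unliftP ord0 i) => [k|] ->.
  under eq_fun do rewrite cv_consS.
  exact: (measurableT_comp (@measurable_mx_coord R n 1 k ord0) measurable_snd).
by under eq_fun do rewrite cv_cons0; exact: measurable_fst.
Qed.

(* n-dimensional Lebesgue measure on column vectors: the measures of the slices
   with fixed first coordinate are integrated along that coordinate *)
Fixpoint cv_lebesgue (R : realType) (n : nat) : set 'cV[R]_n -> \bar R :=
  match n with
  | 0 => fun A => \d_(0 : 'cV[R]_0) A
  | n'.+1 => fun A =>
    (\int[@lebesgue_measure R]_x
       cv_lebesgue [set v : 'cV[R]_n' | A (cv_cons x v)])%E
  end.

Lemma cv_lebesgue_set0 (R : realType) n :
  cv_lebesgue (set0 : set 'cV[R]_n) = 0%E.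
Proof.
elim: n => [|n IH]; first exact: measure0.
by rewrite /= integral0_eq.
Qed.

Lemma cv_lebesgue_box (R : realType) n (a b : 'cV[R]_n) :
  (forall i, a i ord0 <= b i ord0) ->
  cv_lebesgue [set v : 'cV[R]_n |
    forall i, v i ord0 \in `[a i ord0, b i ord0]] =
  (\prod_i (b i ord0 - a i ord0))%:E.
Proof.
elim: n a b => [|n IH] a b ab.
  rewrite big_ord0 /= diracE mem_set//.
  by move=> -[].
pose A : set R := [set` `[a ord0 ord0, b ord0 ord0]].
pose c := \prod_(i < n) (b (lift ord0 i) ord0 - a (lift ord0 i) ord0).
have E x : cv_lebesgue [set v : 'cV[R]_n | forall i : 'I_n.+1,
     cv_cons x v i ord0 \in `[a i ord0, b i ord0]] = (c * \1_A x)%:E.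
  have [xA|xA] := boolP (x \in `[a ord0 ord0, b ord0 ord0]).
    rewrite indicE mem_set// mulr1 /c.
    pose a' : 'cV[R]_n := \col_i a (lift ord0 i) ord0.
    pose b' : 'cV[R]_n := \col_i b (lift ord0 i) ord0.
    rewrite (eq_bigr (fun i => b' i ord0 - a' i ord0)); last first.
      by move=> i _; rewrite !mxE.
    rewrite -IH; last by move=> i; rewrite !mxE.
    congr cv_lebesgue; apply/seteqP; split=> v /= H i.
      by have := H (lift ord0 i); rewrite cv_consS !mxE.
    case: (unliftP ord0 i) => [j|] ->; last by rewrite cv_cons0.
    by have := H j; rewrite cv_consS !mxE.
  rewrite indicE memNset; last by move=> /=; exact/negP.
  rewrite mulr0 -[RHS](cv_lebesgue_set0 R n); congr cv_lebesgue.
  apply/seteqP; split=> v //= /(_ ord0); rewrite cv_cons0.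
  by move: xA => /negP.
rewrite /=; under eq_integral do rewrite E EFinM.
rewrite ge0_integralZl//; last 2 first.
- by apply/measurable_EFinP; apply: measurable_indic; exact: measurable_itv.
- by rewrite lee_fin prodr_ge0// => i _; rewrite subr_ge0.
rewrite integral_indic; [|exact: measurableT|exact: measurable_itv].
rewrite setIT big_ord_recl EFinM muleC; congr (_ * _)%E.
apply: etrans (lebesgue_measure_itv _) _; rewrite /= lte_fin.
case: ltP => // ba; have -> : b ord0 ord0 = a ord0 ord0.
  by apply/le_anti; rewrite ba ab.
by rewrite subrr.
Qed.

Lemma cv_lebesgueS (R : realType) n
    (mu : {sigma_finite_measure set 'cV[R]_n -> \bar R}) :
  @cv_lebesgue R n = mu ->
  @cv_lebesgue R n.+1 = pushforward (@lebesgue_measure R \x mu)%E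
    (fun xv => cv_cons xv.1 xv.2).
Proof.
move=> nmu; apply/funext => A /=.
rewrite /pushforward /product_measure1; apply: eq_integral => x _.
rewrite nmu /=; congr (mu _); apply/seteqP.
by split=> v; rewrite /xsection/= inE.
Qed.

Lemma cv_lebesgue_sigma_finite (R : realType) n :
  sigma_finite setT (@cv_lebesgue R n).
Proof.
pose B k : set 'cV[R]_n := [set v | forall i,
  v i ord0 \in `[(\col__ - k%:R : 'cV[R]_n) i ord0,
                 (\col__ k%:R : 'cV[R]_n) i ord0]].
exists B; last move=> k; last split.
- apply/seteqP; split=> // v _.
  have [k vk] : exists k, forall i, `|v i ord0| <= k%:R.
    exists (\max_i (Num.truncn `|v i ord0|).+1) => i.
    apply: (@le_trans _ _ (Num.truncn `|v i ord0|).+1%:R).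
      exact/ltW/truncnS_gt.
    by rewrite ler_nat (leq_bigmax i).
  by exists k => // i; rewrite !mxE in_itv/= -ler_norml.
- have -> : B k = \bigcap_(i in [set: 'I_n])
      (fun v : 'cV[R]_n => v i ord0) @^-1` [set` `[- k%:R, k%:R]].
    apply/seteqP; split=> v /= H i; have := H i; rewrite !mxE//.
    by apply.
  apply: fin_bigcap_measurable => // i _.
  rewrite -[X in measurable X]setTI.
  by apply: measurable_mx_coord => //; exact: measurable_itv.
- rewrite cv_lebesgue_box ?ltry// => i; rewrite !mxE.
  by rewrite lerNl (le_trans _ (ler0n _ _))// oppr_le0.
Qed.

Lemma cv_lebesgue_measure (R : realType) n :
  exists mu : {sigma_finite_measure set 'cV[R]_n -> \bar R},
    @cv_lebesgue R n = mu.
Proof.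
elim: n => [|n [mu nmu]].
  pose m : {measure set 'cV[R]_0 -> \bar R} := \d_(0 : 'cV[R]_0).
  have sf := @cv_lebesgue_sigma_finite R 0.
  pose M : {sigma_finite_measure set 'cV[R]_0 -> \bar R} :=
    HB.pack (Measure.sort m) (Measure_isSigmaFinite.Build _ _ _ m sf).
  by exists M.
pose m : {measure set 'cV[R]_n.+1 -> \bar R} :=
  measure_function_pushforward__canonical__measure_function_Measure
    (@lebesgue_measure R \x mu)%E (@measurable_cv_cons R n).
have mE : @cv_lebesgue R n.+1 = m := cv_lebesgueS nmu.
have sf := @cv_lebesgue_sigma_finite R n.+1; rewrite mE in sf.
pose M : {sigma_finite_measure set 'cV[R]_n.+1 -> \bar R} :=
  HB.pack (Measure.sort m) (Measure_isSigmaFinite.Build _ _ _ m sf).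
by exists M.
Qed.

Section cv_lebesgue_instance.
Context (R : realType) (n : nat).

Let cv_lebesgue_ge0 A : (0 <= @cv_lebesgue R n A)%E.
Proof. by have [mu ->] := cv_lebesgue_measure R n. Qed.

Let cv_lebesgue_semi_sigma_additive : semi_sigma_additive (@cv_lebesgue R n).
Proof.
by have [mu ->] := cv_lebesgue_measure R n; exact: measure_semi_sigma_additive.
Qed.

HB.instance Definition _ := isMeasure.Build _ _ _ (@cv_lebesgue R n)
  (cv_lebesgue_set0 R n) cv_lebesgue_ge0 cv_lebesgue_semi_sigma_additive.

HB.instance Definition _ := Measure_isSigmaFinite.Build _ _ _
  (@cv_lebesgue R n) (@cv_lebesgue_sigma_finite R n).

End cv_lebesgue_instance.

Section norms.
Context (R : realType).

Definition eucl_norm n (v : 'cV[R]_n) : R := Num.sqrt (\sum_i v i ord0 ^+ 2).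

Definition op_norm n (M : 'M[R]_n) : R :=
  sup [set eucl_norm (M *m v) | v in [set v | eucl_norm v <= 1]].

End norms.

Section total_variation.
Context d (T : measurableType d) (R : realType).

Definition diff_charge (mu nu : probability T R) : {charge set T -> \bar R} :=
  cadd (charge_of_finite_measure mu) (copp (charge_of_finite_measure nu)).

(* total mass of |mu - nu|, with no factor 1/2; by uniqueness of the Hahn
   decomposition, the value does not depend on the chosen one *)
Definition tv_dist (mu nu : probability T R) : \bar R :=
  charge_variation
    (svalP (cid (svalP (cid (Hahn_decomposition (diff_charge mu nu)))))) setT.

End total_variation.

Section processes.

Definition process_sigma (I : Type) (D : set I) (T : Type) d
    (T' : measurableType d) (Z : I -> T -> T') : set (set T) :=
  <<s [set Z i @^-1` B | i in D & B in measurable] >>.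

Context d (T : measurableType d) (R : realType) (P : probability T R).
Local Open Scope ereal_scope.

Definition mutually_independent (I : eqType) (D : set I) d'
    (T' : measurableType d') (Z : I -> {RV P >-> T'}) : Prop :=
  forall (J : seq I) (B : I -> set T'),
    uniq J -> (forall i, i \in J -> D i) -> (forall i, measurable (B i)) ->
    P (\bigcap_(i in [set` J]) (Z i @^-1` B i)) =
    \prod_(i <- J) P (Z i @^-1` B i).

Definition identically_distributed (I : Type) (D : set I) d'
    (T' : measurableType d') (Z : I -> {RV P >-> T'}) : Prop :=
  forall i j, D i -> D j -> forall B : set T', measurable B ->
    distribution P (Z i) B = distribution P (Z j) B.

Definition iid (I : eqType) (D : set I) d' (T' : measurableType d')
    (Z : I -> {RV P >-> T'}) : Prop :=
  mutually_independent D Z /\ identically_distributed D Z.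

Definition independent_processes (I1 I2 : Type) (D1 : set I1) (D2 : set I2)
    d1 d2 (T1 : measurableType d1) (T2 : measurableType d2)
    (Z1 : I1 -> {RV P >-> T1}) (Z2 : I2 -> {RV P >-> T2}) : Prop :=
  forall E F, process_sigma D1 (fun i => Z1 i : T -> T1) E ->
    process_sigma D2 (fun i => Z2 i : T -> T2) F ->
    P (E `&` F) = P E * P F.

Definition strictly_stationary d' (T' : measurableType d')
    (Y : int -> {RV P >-> T'}) : Prop :=
  forall (n : nat) (t : 'I_n -> int) (s : int) (B : set (n.-tuple T')),
    measurable B ->
    P [set w | B [tuple Y (t i + s)%R w | i < n]] =
    P [set w | B [tuple Y (t i) w | i < n]].

Definition left_shift (T' : Type) (y : int -> T') : int -> T' :=
  fun j => y (j + 1)%R.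

Definition path_measurable d' (T' : measurableType d')
    : set (set (int -> T')) :=
  process_sigma setT (fun (j : int) (y : int -> T') => y j).

Definition ergodic_process d' (T' : measurableType d')
    (Y : int -> {RV P >-> T'}) : Prop :=
  forall E : set (int -> T'), path_measurable E ->
    @left_shift T' @^-1` E = E ->
    P [set w | E (fun j => Y j w)] = 0 \/
    P [set w | E (fun j => Y j w)] = 1.

End processes.

(* M(y_{ip}) M(y_{ip-1}) ... M(y_{(i-1)p+1}), for i >= 1 *)
Definition block_prod (R : realType) (m d : nat) (M : 'cV[R]_m -> 'M[R]_d)
    (y : int -> 'cV[R]_m) (p i : nat) : 'M[R]_d :=
  \big[mulmx/1%:M]_(0 <= j < p) M (y (i * p - j)%N%:Z).

(* Main.v *)
(* Jensen's inequality gives Gamma(a) >= a E for all a, with E < 0 the mean of the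
   log norm of a block, and Gamma(0) = 0; hence Gamma'(0) = E, and Gamma(a) < 0 for
   some small a > 0: the a-th moment of the norm of a product of n blocks decays
   like rho^n.

   Fix the environment y. Two copies of the chain driven by the same noise differ
   by a product of the A(y_j) applied to the initial difference, so after
   L = n p steps they are at distance at most 1 outside an event of small cost.
   From distance at most 1 one further step couples them exactly with probability
   at least alpha, because translates by a bounded vector of the noise law share a
   common component; after a failed attempt the two copies have to be brought
   together again during L steps. With n attempts of n p steps each, the dependence
   on the initial state after N ~ n^3 steps is at most
   (1 - alpha)^n + (polynomial) rho^n in the mean over the environment, whence the
   exponent N^(1/3).

   By stationarity E phi(X_(N+1)) - E phi(X_N) compares two starting points in the
   same environment, so it is summable at this rate and the laws converge uniformly
   on measurable sets. For the averages, phi(X_(i+k)) is compared with its quenched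
   expectation k steps after a restart from x0 at time i: the differences are nearly
   uncorrelated, and the quenched expectations are a stationary ergodic sequence to
   which the mean ergodic theorem applies. *)

Require Import Defs.
From HB Require Import structures.
From mathcomp Require Import all_boot all_order all_algebra.
From mathcomp Require Import all_classical all_reals all_analysis.
From mathcomp Require Import measurable_realfun ring lra zify.

Set Implicit Arguments.
Unset Strict Implicit.
Unset Printing Implicit Defensive.

Import Order.TTheory GRing.Theory Num.Theory.
Import numFieldNormedType.Exports.

Local Open Scope classical_set_scope.
Local Open Scope ring_scope.

(** * Integration and coupling *)

(** No coupled process is ever built. The coupling takes place inside the recursively defined
    expectations [quenched]: the noise law is split into a minorizing part and a remainder, the
    minorizing parts are matched by a translation, and the remainders are integrated independently.
    The environment stays fixed, and each failure is paid for by a quantity that depends on it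
    alone: if a matrix product M does not bring z and z' within distance 1, then 1 < d |||M||| |z -
    z'|, and the a-th power of the right side dominates the trivial bound 1. As a <= 1, that power
    is at most affine in |z - z'|, so the first moment of the noise suffices to integrate it after a
    failed attempt. These costs enter additively, so their mean is controlled by stationarity and
    the decay of the a-th moment, whatever the dependence between blocks. The resulting bound does
    not involve the test function, hence is uniform over measurable sets. Conditioning is expressed
    by measurability for a sigma-algebra that contains the whole environment, future included, and
    the noise so far. *)

Definition pack_mfun d d' (T : measurableType d) (T' : measurableType d')
    (g : T -> T') (mg : measurable_fun setT g) : {mfun T >-> T'} :=
  HB.pack g (isMeasurableFun.Build _ _ _ _ g mg).

Definition law d d' (T : measurableType d) (T' : measurableType d')
    (R : realType) (P : probability T R) (g : T -> T')
    (mg : measurable_fun setT g) : probability T' R :=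
  distribution P (pack_mfun mg).

Section integration.
Context (R : realType).

Lemma bounded_integrable d (T : measurableType d)
    (mu : {finite_measure set T -> \bar R}) (g : T -> R) (K : R) :
  measurable_fun setT g -> (forall x, `|g x| <= K) ->
  mu.-integrable setT (EFin \o g).
Proof.
move=> mg gK; apply: (@le_integrable _ _ _ mu setT _ _ (cst K%:E)) => //.
- exact/measurable_EFinP.
- move=> x _ /=; rewrite lee_fin.
  by apply: le_trans (gK x) _; exact: ler_norm.
- exact: finite_measure_integrable_cst.
Qed.

Lemma integrable_addR d (T : measurableType d)
    (mu : {measure set T -> \bar R}) (g h : T -> R) :
  mu.-integrable setT (EFin \o g) -> mu.-integrable setT (EFin \o h) ->
  mu.-integrable setT (EFin \o (fun x => g x + h x)).
Proof. by move=> ig ih; exact: (integrableD measurableT ig ih). Qed.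

Lemma integrable_subR d (T : measurableType d)
    (mu : {measure set T -> \bar R}) (g h : T -> R) :
  mu.-integrable setT (EFin \o g) -> mu.-integrable setT (EFin \o h) ->
  mu.-integrable setT (EFin \o (fun x => g x - h x)).
Proof. by move=> ig ih; exact: (integrableB measurableT ig ih). Qed.

Lemma integrable_scaleR d (T : measurableType d)
    (mu : {measure set T -> \bar R}) (g : T -> R) (r : R) :
  mu.-integrable setT (EFin \o g) ->
  mu.-integrable setT (EFin \o (fun x => r * g x)).
Proof. by move=> ig; exact: (integrableZl measurableT r ig). Qed.

Lemma Rintegral_law d d' (T : measurableType d) (T' : measurableType d')
    (P : probability T R) (g : T -> T') (mg : measurable_fun setT g)
    (h : T' -> R) :
  measurable_fun setT h -> P.-integrable setT (EFin \o (h \o g)) ->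
  \int[law P mg]_x h x = \int[P]_w h (g w).
Proof.
move=> mh ih; rewrite /Rintegral; congr fine.
rewrite (@integral_pushforward _ _ _ _ R g mg P setT (EFin \o h))//.
exact/measurable_EFinP.
Qed.

Lemma probability_Rintegral_cst d (T : measurableType d)
  (P : probability T R) (r : R) : \int[P]_w r = r.
Proof. by rewrite Rintegral_cst//= probability_setT mulr1. Qed.

Lemma probability_Rintegral_bound d (T : measurableType d)
    (P : probability T R) (g : T -> R) (K : R) :
  measurable_fun setT g -> (forall x, `|g x| <= K) ->
  `|\int[P]_w g w| <= K.
Proof.
move=> mg gK; have ig := bounded_integrable P mg gK.
apply: (le_trans (le_normr_Rintegral measurableT ig)).
rewrite -[leRHS](probability_Rintegral_cst P); apply: le_Rintegral => //.
- apply: (@bounded_integrable _ _ _ _ K); first exact: measurableT_comp.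
  by move=> x; rewrite normr_id.
- exact: finite_measure_integrable_cst.
Qed.

(** Nonnegativity makes this Tonelli, with no integrability to check; it is one reason to work with
    test functions valued in [0, 1]. *)
Lemma measurable_Rintegral_snd d1 d2 (T1 : measurableType d1)
    (T2 : measurableType d2) (nu : probability T2 R) (H : T1 * T2 -> R) :
  measurable_fun setT H -> (forall z, 0 <= H z) ->
  measurable_fun setT (fun u => \int[nu]_e H (u, e)).
Proof.
move=> mH H0; apply: measurableT_comp; first exact: fine_measurable.
apply: (@measurable_fun_fubini_tonelli_F _ _ _ _ _ nu (EFin \o H)).
- exact/measurable_EFinP.
- by move=> z; rewrite lee_fin.
Qed.

(** The joint law of [(U, V)] agrees with the product of the law of [U] and [nu] on rectangles,
    hence everywhere, and Fubini applies. [T1] is arbitrary so that [U] may be the identity into a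
    coarser sigma-algebra. *)
Lemma indep_Rintegral d d1 d2 (T : measurableType d) (T1 : measurableType d1)
    (T2 : measurableType d2) (P : probability T R) (nu : probability T2 R)
    (U : T -> T1) (V : T -> T2) (H : T1 * T2 -> R) (K : R) :
  measurable_fun setT U -> measurable_fun setT V ->
  (forall C D, measurable C -> measurable D ->
    P (U @^-1` C `&` V @^-1` D) = (P (U @^-1` C) * nu D)%E) ->
  measurable_fun setT H -> (forall z, `|H z| <= K) ->
  \int[P]_w H (U w, V w) = \int[P]_w (\int[nu]_e H (U w, e)).
Proof.
move=> mU mV UV mH HK.
have mUV : measurable_fun setT (fun w => (U w, V w)).
  exact: measurable_fun_pair.
rewrite -(@Rintegral_law _ _ _ _ P _ mUV H)//; last first.
  apply: (@bounded_integrable _ _ _ _ K) => [|w]; last exact: HK.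
  exact: measurableT_comp.
have -> : \int[law P mUV]_z H z = \int[(law P mU \x nu)%E]_z H z.
  rewrite /Rintegral; congr fine; apply: eq_measure_integral => A mA _.
  apply/esym/product_measure_unique => // C D mC mD.
have iH' : (law P mU \x nu)%E.-integrable setT (EFin \o H).
  apply: (@le_integrable _ _ _ _ _ _ _ (cst K%:E)) => //.
  - exact/measurable_EFinP.
  - move=> x _ /=; rewrite lee_fin.
    by apply: le_trans (HK x) _; exact: ler_norm.
  - apply/integrableP; split => //=.
    rewrite integral_cst//.
    rewrite [X in (_ * X)%E](_ : _ = 1%E); first by rewrite mule1 ltry.
    rewrite -setXTT.
    apply: (etrans (product_measure1E (law P mU) nu measurableT measurableT)).
    apply: (etrans (congr2 *%E (probability_setT (law P mU)) (probability_setT nu))).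
    by rewrite mule1.
have bH u : `|\int[nu]_e H (u, e)| <= K.
  apply: probability_Rintegral_bound => //.
  by apply: measurableT_comp => //; exact: measurable_pair1.
have FE : fubini_F nu (EFin \o H) = EFin \o (fun u => \int[nu]_e H (u, e)).
  apply/funext => u; rewrite /fubini_F /= /Rintegral fineK//.
  apply: integrable_fin_num => //.
  apply: (@bounded_integrable _ _ _ _ K) => [|e]; last exact: HK.
  by apply: measurableT_comp => //; exact: measurable_pair1.
have mF : measurable_fun setT (fun u => \int[nu]_e H (u, e)).
  have := @measurable_fubini_F _ _ _ _ _ (law P mU) nu (EFin \o H) iH'.
  by rewrite FE => /measurable_EFinP.
rewrite {1}/Rintegral -(@integral12_prod_meas1 _ _ _ _ _ (law P mU) nu)// FE.
rewrite -[LHS]/(\int[law P mU]_u (\int[nu]_e H (u, e))) Rintegral_law//.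
apply: (@bounded_integrable _ _ _ _ K) => [|w]; last exact: bH.
exact: measurableT_comp.
Qed.

Lemma measure_diff d (T : measurableType d)
    (nu ka : {finite_measure set T -> \bar R}) :
  (forall E, measurable E -> (ka E <= nu E)%E) ->
  exists re : {finite_measure set T -> \bar R},
    forall E, measurable E -> nu E = (ka E + re E)%E.
Proof.
move=> kn.
(* The difference is formed as a charge. The restriction [crestr0] sends nonmeasurable sets to 0, so
   that [ch] is nonnegative on every set, as [measure_of_charge] requires. *)
pose ch : {charge set T -> \bar R} := crestr0 (cadd (charge_of_finite_measure nu)
   (copp (charge_of_finite_measure ka))) measurableT.
have che E : measurable E -> ch E = (nu E - ka E)%E.
  by move=> mE; rewrite /ch /= /crestr0 mem_set// /crestr/= setIT.
have ch0 E : (0 <= ch E)%E.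
  have [mE|nE] := pselect (measurable E).
    by rewrite che// sube_ge0 ?kn// fin_num_measure.
  by rewrite /ch/= /crestr0 memNset.
pose m : {measure set T -> \bar R} := measure_of_charge ch ch0.
have fm : fin_num_fun m.
  by move=> U mU; rewrite [m U]che// fin_numB !fin_num_measure.
pose M : {finite_measure set T -> \bar R} := HB.pack (Measure.sort m)
  (@Measure_isFinite.Build _ _ _ m fm).
exists M => E mE; rewrite [M E]che// addeC subeK//.
by rewrite fin_num_measure.
Qed.

Lemma Rintegral_measure_split d (T : measurableType d)
    (nu ka re : {finite_measure set T -> \bar R}) (g : T -> R) :
  (forall E, measurable E -> nu E = (ka E + re E)%E) ->
  nu.-integrable setT (EFin \o g) ->
  [/\ ka.-integrable setT (EFin \o g), re.-integrable setT (EFin \o g) &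
   \int[nu]_x g x = \int[ka]_x g x + \int[re]_x g x].
Proof.
move=> ndec ig; have mg := measurable_int _ ig.
have nE (h : T -> \bar R) : (\int[nu]_x h x = \int[measure_add ka re]_x h x)%E.
  apply: (@eq_measure_integral _ _ _ _ (measure_add ka re)) => A mA _.
  exact: (etrans (ndec A mA) (esym (measure_addE _ _ _))).
move/integrableP : (ig) => [_].
rewrite nE ge0_integral_measure_add//; last exact: measurableT_comp.
move=> lty; have i1 : ka.-integrable setT (EFin \o g).
  apply/integrableP; split => //; apply: le_lt_trans lty.
  by rewrite leeDl// integral_ge0.
have i2 : re.-integrable setT (EFin \o g).
  apply/integrableP; split => //; apply: le_lt_trans lty.
  by rewrite leeDr// integral_ge0.
split => //; rewrite {1}/Rintegral nE integral_measure_add// fineD//.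
- exact: (integrable_fin_num _ i1).
- exact: (integrable_fin_num _ i2).
Qed.

End integration.

Section coupling.
Context (R : realType) d (T : measurableType d).

(* Couple the parts [ka1], [ka2] exactly and the remainders independently; the
   double integral over the remainders is evaluated one variable at a time. *)
Lemma coupling_step (nu : probability T R)
    (ka1 ka2 : {finite_measure set T -> \bar R}) (alpha beta : R)
    (h1 h2 w : T -> R) :
  (forall E, measurable E -> (ka1 E <= nu E)%E) ->
  (forall E, measurable E -> (ka2 E <= nu E)%E) ->
  ka1 setT = alpha%:E -> ka2 setT = alpha%:E -> alpha < 1 ->
  measurable_fun setT h1 -> measurable_fun setT h2 ->
  (forall e, `|h1 e| <= 1) -> (forall e, `|h2 e| <= 1) ->
  nu.-integrable setT (EFin \o w) -> (forall e, 0 <= w e) ->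
  \int[ka1]_e h1 e = \int[ka2]_e h2 e ->
  (forall e e', h1 e - h2 e' <= beta + w e + w e') ->
  \int[nu]_e h1 e - \int[nu]_e h2 e
    <= (1 - alpha) * beta + 2 * \int[nu]_e w e.
Proof.
move=> k1 k2 a1 a2 alpha1 mh1 mh2 h1b h2b iw w0 kk hw.
have [re1 re1E] := measure_diff k1; have [re2 re2E] := measure_diff k2.
have ih1 := bounded_integrable nu mh1 h1b.
have ih2 := bounded_integrable nu mh2 h2b.
have [ik1 ir1 ->] := Rintegral_measure_split re1E ih1.
have [ik2 ir2 ->] := Rintegral_measure_split re2E ih2.
have [ikw1 irw1 w1E] := Rintegral_measure_split re1E iw.
have [ikw2 irw2 w2E] := Rintegral_measure_split re2E iw.
have r1 : re1 setT = (1 - alpha)%:E.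
  have : (1 = ka1 setT + re1 setT)%E.
    by rewrite -(probability_setT nu); exact: re1E.
  rewrite a1.
  rewrite -(@fineK _ (re1 setT)) ?fin_num_measure// -EFinD.
  by move=> [->]; congr EFin; ring.
have r2 : re2 setT = (1 - alpha)%:E.
  have : (1 = ka2 setT + re2 setT)%E.
    by rewrite -(probability_setT nu); exact: re2E.
  rewrite a2.
  rewrite -(@fineK _ (re2 setT)) ?fin_num_measure// -EFinD.
  by move=> [->]; congr EFin; ring.
have icst (mu : {finite_measure set T -> \bar R}) (r : R) :
    mu.-integrable setT (EFin \o (fun=> r)).
  exact: finite_measure_integrable_cst.
have cst1 r : \int[re1]__ r = r * (1 - alpha).
  by rewrite Rintegral_cst//; exact: (congr1 (fun z => r * fine z) r1).
have cst2 r : \int[re2]__ r = r * (1 - alpha).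
  by rewrite Rintegral_cst//; exact: (congr1 (fun z => r * fine z) r2).
have W1 : \int[re1]_e w e <= \int[nu]_e w e.
  by rewrite w1E lerDr Rintegral_ge0.
have W2 : \int[re2]_e w e <= \int[nu]_e w e.
  by rewrite w2E lerDr Rintegral_ge0.
(* The pointwise bound is integrated over [e] against [re1] with [e'] frozen; [H2] then integrates
   over [e'] against [re2]. *)
have H1 e' : \int[re1]_e h1 e - (1 - alpha) * h2 e' <=
    (1 - alpha) * beta + \int[re1]_e w e + (1 - alpha) * w e'.
  have : \int[re1]_e h1 e <= \int[re1]_e (w e + (beta + w e' + h2 e')).
    apply: le_Rintegral => //.
    - apply: integrable_addR => //; exact: icst.
    - by move=> e _; have := hw e e'; lra.
  rewrite RintegralD//; last exact: icst.
  rewrite cst1; lra.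
have H2 : \int[re2]_e' (\int[re1]_e h1 e) - \int[re2]_e' ((1 - alpha) * h2 e') <=
    \int[re2]_e' ((1 - alpha) * beta + \int[re1]_e w e) +
    \int[re2]_e' ((1 - alpha) * w e').
  have ih := integrable_scaleR (1 - alpha) ir2.
  have ih' := integrable_scaleR (1 - alpha) irw2.
  rewrite -RintegralB; [|by []|exact: icst|exact: ih].
  rewrite -RintegralD; [|by []|exact: icst|exact: ih'].
  apply: le_Rintegral => //.
  - apply: integrable_subR => //; exact: icst.
  - apply: integrable_addR => //; exact: icst.
move: H2; rewrite !cst2 !RintegralZl// => H2.
rewrite kk; set i1 := \int[re1]_e h1 e in H1 H2 *.
set i2 := \int[re2]_e h2 e in H2 *.
set j1 := \int[re1]_e w e in W1 H1 H2.
set j2 := \int[re2]_e w e in W2 H2.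
set j := \int[nu]_e w e in W1 W2 *.
(* Both sides of [H2] carry the factor [1 - alpha], the mass of a remainder; it cancels because
   [alpha < 1]. *)
have a0 : 0 < 1 - alpha by lra.
have : i1 - i2 <= (1 - alpha) * beta + j1 + j2.
  rewrite -(ler_pM2l a0); lra.
lra.
Qed.

End coupling.

(** * Uniform limits of probabilities and total variation *)

Section limit_probability.
Context (R : realType) d (T : measurableType d).

(** Uniformity in [E] gives countable additivity of the setwise limit: a single [M N] with [e N]
    small replaces it both on the finite unions and on the whole union, and [M N] is continuous
    along them. *)
Lemma uniform_limit_probability (M : nat -> probability T R) (e : nat -> R) :
  e @ \oo --> (0 : R) ->
  (forall N N' E, (N <= N')%N -> measurable E ->
     `|fine (M N E) - fine (M N' E)| <= e N) ->
  exists mu : probability T R, forall N E, measurable E ->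
    `|fine (M N E) - fine (mu E)| <= e N.
Proof.
move=> e0 Me.
have small (eps : R) : 0 < eps -> exists N, e N < eps.
  move=> eps0; have [N _ /(_ N (leqnn N))/=] := (cvgrPdist_lt _ _).1 e0 _ eps0.
  by rewrite sub0r normrN => /(le_lt_trans (ler_norm _)); exists N.
pose u E N := fine (M N E).
have uc E : measurable E -> cvgn (u E).
  move=> mE; apply: cauchy_cvg; apply/cauchy_exP => eps eps0.
  have [N eN] := small eps eps0.
  exists (u E N); exists N => // n /= Nn.
  by rewrite /ball/=; exact: le_lt_trans (Me _ _ _ Nn mE) eN.
pose l E := lim (u E @ \oo).
have lE N E : measurable E -> `|u E N - l E| <= e N.
  move=> mE; apply/ler_addgt0Pr => eps eps0.
  have /cvgrPdist_lt /(_ _ eps0) [N' _ N'P] := uc E mE.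
  have := N'P (maxn N N') (leq_maxr _ _) => /= h1.
  have h2 := Me N (maxn N N') E (leq_maxl _ _) mE.
  rewrite distrC in h1.
  apply: le_trans (ler_distD (u E (maxn N N')) _ _) _.
  by rewrite lerD// ltW.
have u0 E N : 0 <= u E N by rewrite fine_ge0.
have l0 E : measurable E -> 0 <= l E.
  by move=> mE; apply: limr_ge; [exact: uc|exact: nearW].
(* The limit [l E] is controlled for measurable [E] only; the maximum with 0 makes [mu] nonnegative
   on all sets. *)
pose mu E := (Num.max 0 (l E))%:E : \bar R.
have muE E : measurable E -> mu E = (l E)%:E.
  by move=> mE; rewrite /mu max_r// l0.
have mu0 : mu set0 = 0%E.
  rewrite muE//; congr EFin; rewrite /l (_ : u set0 = fun=> 0) ?lim_cst//.
  by apply/funext => N; rewrite /u measure0.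
have mu_ge0 E : (0 <= mu E)%E by rewrite lee_fin le_max lexx.
have sadd : semi_sigma_additive mu.
  move=> F mF tF mUF; rewrite muE//.
  pose S n := \big[setU/set0]_(0 <= i < n) F i.
  have mS n : measurable (S n) by apply: bigsetU_measurable.
  have uS n N : u (S n) N = \sum_(0 <= i < n) u (F i) N.
    rewrite /u /S !big_mkord (measure_bigsetU (M N))//.
      rewrite -sum_fine// => i _; exact: fin_num_measure.
  have lS n : l (S n) = \sum_(0 <= i < n) l (F i).
    apply/cvg_lim => //; rewrite (_ : u (S n) = fun N => \sum_(0 <= i < n) u (F i) N).
      elim: n => [|n IHn].
        rewrite big_geq// (_ : (fun N => _) = fun=> 0); first exact: cvg_cst.
        by apply/funext => N; rewrite big_geq.
      rewrite big_nat_recr//= (_ : (fun N => _) =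
        (fun N => \sum_(0 <= i < n) u (F i) N) \+ u (F n)).
        by apply: cvgD => //; exact: uc.
      by apply/funext => N; rewrite big_nat_recr.
    by apply/funext => N; exact: uS.
  rewrite (_ : (fun n => _) = EFin \o (fun n => l (S n))); last first.
    apply/funext => n /=; rewrite lS -sumEFin.
    by apply: eq_bigr => i _; exact: muE.
  apply: cvg_EFin; first by near=> n.
  apply/cvgrPdist_le => eps eps0.
  have [N eN] := small (eps / 4) ltac:(by rewrite divr_gt0).
  have : (fun n => u (S n) N) @ \oo --> u (\bigcup_n F n) N.
    have : (\sum_(0 <= i < n) M N (F i))%E @[n --> \oo] -->
        (u (\bigcup_n F n) N)%:E.
      rewrite /u fineK ?fin_num_measure//.
      exact: measure_semi_sigma_additive.
    move=> /fine_cvgP[_]; apply: cvg_trans; apply: near_eq_cvg; near=> n.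
    rewrite /= uS sum_fine// => i _; exact: fin_num_measure.
  move=> /cvgrPdist_le /(_ (eps / 4) ltac:(by rewrite divr_gt0)).
  apply: filterS => n /=.
  have := lE N _ mUF; have := lE N _ (mS n).
  rewrite !ler_distl; lra.
have mu1 : mu setT = 1%E.
  rewrite muE//; congr EFin; rewrite /l (_ : u setT = fun=> 1) ?lim_cst//.
  by apply/funext => N; rewrite /u probability_setT.
pose m : {measure set T -> \bar R} := HB.pack mu (isMeasure.Build _ _ _ mu mu0 mu_ge0 sadd).
pose p : probability T R := HB.pack (Measure.sort m) (Measure_isProbability.Build _ _ _ m mu1).
exists p => N E mE.
have -> : p E = (l E)%:E by rewrite -muE.
exact: lE.
Unshelve. all: by end_near. Qed.

End limit_probability.

(** For a Hahn decomposition the total mass is the charge of the positive set minus that of the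
    negative set, each at most [e] in absolute value; hence the factor 2. The argument covers every
    decomposition, so the chosen one need not be known. *)
Lemma tv_dist_le (R : realType) d (T : measurableType d)
    (mu nu : probability T R) (e : R) :
  (forall E, measurable E -> `|fine (mu E) - fine (nu E)| <= e) ->
  (tv_dist mu nu <= (2 * e)%:E)%E.
Proof.
move=> me.
suff var P N (h : hahn_decomposition (diff_charge mu nu) P N) :
  (charge_variation h setT <= (2 * e)%:E)%E by exact: var.
have [[mP _] [mN _] _ _] := h.
have dE E : measurable E ->
    diff_charge mu nu E = (fine (mu E) - fine (nu E))%:E.
  move=> mE; rewrite EFinB !fineK ?fin_num_measure//.
rewrite /charge_variation jordan_posE cjordan_posE jordan_negE cjordan_negE.
rewrite /crestr0 !mem_set// /crestr !setTI.
rewrite [X in (X - _)%E](dE P mP) [X in (_ - X)%E](dE N mN).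
have := me P mP; have := me N mN.
rewrite -EFinB lee_fin !ler_norml; lra.
Qed.
(** * Translations and matrix norms *)

Section lebesgue_translation.
Context (R : realType).

Lemma lebesgue_measure_translate (c : R) (A : set (measurableTypeR R)) :
  measurable A ->
  lebesgue_measure [set x : R | A (x + c)] = lebesgue_measure A.
Proof.
move=> mA.
have mc : @measurable_fun _ _ (measurableTypeR R) (measurableTypeR R) setT
    (fun x : R => x + c).
  exact: measurable_funD.
pose m : {measure set (measurableTypeR R) -> \bar R} :=
  measure_function_pushforward__canonical__measure_function_Measure
    (@lebesgue_measure R) mc.
suff : lebesgue_measure A = m A by [].
have := @lebesgue_measure_unique R m; apply => // X /= [[a b]/= _ <-].
rewrite /m/= /pushforward.
have -> : (fun x : R => x + c) @^-1` `]a, b] = `](a - c), (b - c)]%classic.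
  by apply/seteqP; split=> x /=; rewrite !in_itv/= lerBrDr ltrBlDr.
rewrite !lebesgue_measure_itv/= !lte_fin ltrD2r; case: ifP => // _.
by rewrite -!EFinB; congr EFin; ring.
Qed.

Lemma integral_lebesgue_translate (c : R) (g : R -> \bar R) :
  measurable_fun setT g -> (forall x, (0 <= g x)%E) ->
  (\int[@lebesgue_measure R]_x g ((x : R) + c)%R = \int[@lebesgue_measure R]_x g x)%E.
Proof.
move=> mg g0.
have mc : @measurable_fun _ _ (measurableTypeR R) (measurableTypeR R) setT
    (fun x : R => x + c).
  exact: measurable_funD.
rewrite -(@ge0_integral_pushforward _ _ _ _ R _ mc (@lebesgue_measure R) setT g)//.
apply: (@eq_measure_integral _ _ _ _ (@lebesgue_measure R)) => A mA _.
exact: lebesgue_measure_translate.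
Qed.

(** Translates the first coordinate by the one-dimensional invariance and the slices by induction.
    It lets the translate of the minorizing measure be compared with Lebesgue measure on a
    translated ball. *)
Lemma cv_lebesgue_translate n (c : 'cV[R]_n) (A : set 'cV[R]_n) :
  measurable A -> cv_lebesgue [set v | A (v + c)] = cv_lebesgue A.
Proof.
elim: n c A => [|n IHn] c A mA.
  by congr cv_lebesgue; apply/seteqP; split => v /=; rewrite (flatmx0 (v + c)) (flatmx0 v).
have mS x : measurable [set v | A (cv_cons x v)].
  rewrite -[X in measurable X]setTI.
  apply: (measurableT_comp (@measurable_cv_cons R n) (pair1_measurable x)) => //.
pose F x := cv_lebesgue [set v | A (cv_cons x v)].
have mF : measurable_fun setT F.
  have mA' : measurable ((fun xv : R * 'cV[R]_n => cv_cons xv.1 xv.2) @^-1` A).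
    by rewrite -[X in measurable X]setTI; exact: measurable_cv_cons.
  have := @measurable_fun_xsection _ _ _ _ R (@cv_lebesgue R n) _ mA'.
  congr measurable_fun; apply/funext => x /=; rewrite /F; congr cv_lebesgue.
  by apply/seteqP; split => v; rewrite /xsection/= inE.
pose c' : 'cV[R]_n := \col_i c (lift ord0 i) ord0.
transitivity (\int[@lebesgue_measure R]_x F ((x : R) + c ord0 ord0)%R)%E.
  apply: eq_integral => x _; rewrite /F -(IHn c')//; congr cv_lebesgue.
  have E v : cv_cons x v + c = cv_cons (x + c ord0 ord0) (v + c').
    apply/colP => i; rewrite mxE; case: (unliftP ord0 i) => [j|] ->.
      by rewrite !cv_consS !mxE.
    by rewrite !cv_cons0.
  by apply/seteqP; split => v /=; rewrite E.
by rewrite integral_lebesgue_translate.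
Qed.

End lebesgue_translation.

(** * Maximum norm [|v|], Euclidean norm and operator norm *)

Section norms.
Context (R : realType).

Lemma cv_coord_le n (v : 'cV[R]_n) i : `|v i ord0| <= `|v|.
Proof.
rewrite [leRHS]/Num.norm/= mx_normrE.
exact: (le_bigmax _ (fun ij : 'I_n * 'I_1 => `|v ij.1 ij.2|) (i, ord0)).
Qed.

Lemma cv_norm_le n (v : 'cV[R]_n) (r : R) : 0 <= r ->
  (forall i, `|v i ord0| <= r) -> `|v| <= r.
Proof.
move=> r0 vr; rewrite [leLHS]/Num.norm/= mx_normrE.
by apply: bigmax_le => // -[i j] _ /=; rewrite (ord1 j).
Qed.

Lemma eucl_norm_ge0 n (v : 'cV[R]_n) : 0 <= eucl_norm v.
Proof. exact: sqrtr_ge0. Qed.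

Lemma eucl_norm_sqr n (v : 'cV[R]_n) :
  eucl_norm v ^+ 2 = \sum_i v i ord0 ^+ 2.
Proof. by rewrite sqr_sqrtr// sumr_ge0// => i _; exact: sqr_ge0. Qed.

Lemma norm_le_eucl n (v : 'cV[R]_n) : `|v| <= eucl_norm v.
Proof.
apply: cv_norm_le => [|i]; first exact: eucl_norm_ge0.
rewrite -(@ler_pXn2r _ 2)// ?nnegrE ?eucl_norm_ge0//.
rewrite eucl_norm_sqr real_normK ?num_real// (bigD1 i)//= lerDl.
by rewrite sumr_ge0// => j _; exact: sqr_ge0.
Qed.

Lemma eucl_le_norm n (v : 'cV[R]_n) : eucl_norm v <= n%:R * `|v|.
Proof.
rewrite -(@ler_pXn2r _ 2)// ?nnegrE ?eucl_norm_ge0 ?mulr_ge0//.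
rewrite eucl_norm_sqr; apply: (@le_trans _ _ (\sum_(i < n) `|v| ^+ 2)).
  apply: ler_sum => i _; rewrite -real_normK ?num_real//.
  by rewrite ler_pXn2r ?nnegrE// cv_coord_le.
rewrite sumr_const card_ord -[leLHS]mulr_natl exprMn.
apply: ler_wpM2r; first exact: sqr_ge0.
case: n v => [|n] v; first by rewrite expr0n.
by rewrite expr2 ler_peMr// ler1n.
Qed.

Lemma eucl_normZ n (c : R) (v : 'cV[R]_n) :
  eucl_norm (c *: v) = `|c| * eucl_norm v.
Proof.
rewrite /eucl_norm -sqrtr_sqr -sqrtrM ?sqr_ge0// mulr_sumr.
by congr Num.sqrt; apply: eq_bigr => i _; rewrite mxE exprMn.
Qed.

Lemma eucl_norm_eq0 n (v : 'cV[R]_n) : eucl_norm v = 0 -> v = 0.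
Proof.
move=> v0; apply/colP => i; rewrite mxE; apply/normr0_eq0/le_anti.
by rewrite normr_ge0 andbT -v0 (le_trans (cv_coord_le _ _))// norm_le_eucl.
Qed.

Lemma eucl_norm0 n : eucl_norm (0 : 'cV[R]_n) = 0.
Proof. by rewrite -(scale0r (0 : 'cV[R]_n)) eucl_normZ normr0 mul0r. Qed.

Lemma eucl_mulmx_bounded n (M : 'M[R]_n) :
  exists2 K : R, 0 <= K & forall v, eucl_norm (M *m v) <= K * eucl_norm v.
Proof.
exists (n%:R * \sum_i \sum_j `|M i j|).
  by rewrite mulr_ge0// sumr_ge0// => i _; rewrite sumr_ge0.
move=> v; apply: (le_trans (eucl_le_norm _)); rewrite -mulrA ler_wpM2l//.
apply: cv_norm_le => [|i].
  by rewrite mulr_ge0 ?eucl_norm_ge0// sumr_ge0// => i _; rewrite sumr_ge0.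
rewrite mxE; apply: (le_trans (ler_norm_sum _ _ _)).
rewrite [in leRHS](bigD1 i)//= mulrDl -[leLHS]addr0 lerD//; last first.
  rewrite mulr_ge0 ?eucl_norm_ge0// sumr_ge0// => k _.
  by rewrite sumr_ge0.
rewrite mulr_suml; apply: ler_sum => j _; rewrite normrM ler_wpM2l//.
exact: le_trans (cv_coord_le _ _) (norm_le_eucl _).
Qed.

Lemma op_norm_has_sup n (M : 'M[R]_n) :
  has_sup [set eucl_norm (M *m v) | v in [set v : 'cV[R]_n | eucl_norm v <= 1]].
Proof.
have [K K0 MK] := eucl_mulmx_bounded M; split.
  by exists (eucl_norm (M *m 0)), 0 => //=; rewrite eucl_norm0.
exists K => _ [v v1 <-]; apply: (le_trans (MK v)).
by rewrite -[leRHS]mulr1 ler_wpM2l.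
Qed.

Lemma op_norm_ge0 n (M : 'M[R]_n) : 0 <= op_norm M.
Proof.
apply: le_trans (ub_le_sup (op_norm_has_sup M).2 _); last first.
  by exists 0 => //=; rewrite eucl_norm0.
exact: eucl_norm_ge0.
Qed.

Lemma eucl_mulmx_le n (M : 'M[R]_n) v :
  eucl_norm (M *m v) <= op_norm M * eucl_norm v.
Proof.
have [v0|v0] := eqVneq (eucl_norm v) 0.
  by rewrite v0 mulr0 (eucl_norm_eq0 v0) mulmx0 eucl_norm0.
have vgt0 : 0 < eucl_norm v by rewrite lt_neqAle eq_sym v0 eucl_norm_ge0.
have : eucl_norm (M *m ((eucl_norm v)^-1 *: v)) <= op_norm M.
  apply: ub_le_sup; first exact: (op_norm_has_sup M).2.
  exists ((eucl_norm v)^-1 *: v) => //=.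
  by rewrite eucl_normZ ger0_norm ?invr_ge0 ?eucl_norm_ge0// mulVf.
rewrite -scalemxAr eucl_normZ ger0_norm ?invr_ge0 ?eucl_norm_ge0//.
by rewrite mulrC ler_pdivrMr.
Qed.

Lemma op_norm_le n (M : 'M[R]_n) (K : R) : 0 <= K ->
  (forall v, eucl_norm (M *m v) <= K * eucl_norm v) -> op_norm M <= K.
Proof.
move=> K0 MK; apply: ge_sup; first exact: (op_norm_has_sup M).1.
move=> _ [v v1 <-]; apply: (le_trans (MK v)).
by rewrite -[leRHS]mulr1 ler_wpM2l.
Qed.

Lemma op_norm_mulmx n (M N : 'M[R]_n) :
  op_norm (M *m N) <= op_norm M * op_norm N.
Proof.
apply: op_norm_le => [|v]; first by rewrite mulr_ge0 ?op_norm_ge0.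
rewrite -mulmxA -mulrA (le_trans (eucl_mulmx_le _ _))//.
by rewrite ler_wpM2l ?op_norm_ge0// eucl_mulmx_le.
Qed.

Lemma op_norm1 n : op_norm (1%:M : 'M[R]_n) <= 1.
Proof. by apply: op_norm_le => // v; rewrite mul1mx mul1r. Qed.

(** Distances of states are measured in the maximum norm, matrices in the Euclidean operator norm;
    the factor [n] is the price of the change of norm and the origin of the factor [d] in
    [contraction]. *)
Lemma norm_mulmx_le n (M : 'M[R]_n) (v : 'cV[R]_n) :
  `|M *m v| <= n%:R * op_norm M * `|v|.
Proof.
apply: (le_trans (norm_le_eucl _)); apply: (le_trans (eucl_mulmx_le _ _)).
by rewrite -mulrA mulrCA ler_wpM2l ?op_norm_ge0// eucl_le_norm.
Qed.

Lemma measurable_eucl_norm n : measurable_fun setT (@eucl_norm R n).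
Proof.
rewrite (_ : @eucl_norm R n =
    (fun x => x `^ 2^-1) \o (fun v : 'cV[R]_n => \sum_i v i ord0 ^+ 2)); last first.
  apply/funext => v /=; rewrite powR12_sqrt// sumr_ge0// => i _.
  exact: sqr_ge0.
apply: measurableT_comp; first exact: measurable_powR.
apply: measurable_sum => i; apply: measurable_funX.
exact: measurable_mx_coord.
Qed.

Lemma continuous_sumR (T : topologicalType) (I : Type) (s : seq I)
    (h : I -> T -> R) :
  (forall i, continuous (h i)) -> continuous (fun x => \sum_(i <- s) h i x).
Proof.
move=> ch; elim: s => [|i s IHs].
  rewrite (_ : (fun x => _) = cst 0); first exact: cst_continuous.
  by apply/funext => x; rewrite big_nil.
rewrite (_ : (fun x => _) = (fun x => h i x + \sum_(j <- s) h j x)).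
  by move=> x; apply: continuousD; [exact: ch|exact: IHs].
by apply/funext => x; rewrite big_cons.
Qed.

(** Lower semicontinuity: for [a >= 0] the set where the norm exceeds [a] is a union over unit
    vectors of open sets. Squaring both sides leaves a polynomial in the entries. *)
Lemma measurable_op_norm n : measurable_fun setT (@op_norm R n).
Proof.
apply: (measurability _ (RGenOInfty.measurableE R)) => _ [_ [a ->] <-].
rewrite setTI; have [a0|a0] := ltP a 0.
  rewrite (_ : _ @^-1` _ = setT)//; apply/seteqP; split => // M _ /=.
  by rewrite in_itv/= andbT (lt_le_trans a0)// op_norm_ge0.
apply: open_measurable_mx.
rewrite (_ : _ @^-1` _ = \bigcup_(v in [set v : 'cV[R]_n | eucl_norm v <= 1])
    ((fun M : 'M[R]_n => \sum_i (M *m v) i ord0 ^+ 2) @^-1`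
      [set x : R | a ^+ 2 < x])).
  apply: bigcup_open => v _; apply: open_comp; last exact: open_gt.
  move=> M _; apply: continuous_sumR => i {}M.
  rewrite (_ : (fun M0 : 'M[R]_n => _) =
      (fun M0 : 'M[R]_n => (\sum_j M0 i j * v j ord0) ^+ 2)); last first.
    by apply/funext => M0; rewrite mxE.
  apply: (@continuous_comp _ _ _ _ (fun x : R => x ^+ 2)); last exact: exprn_continuous.
  apply: continuous_sumR => j {}M; apply: continuousM; last exact: cst_continuous.
  exact: coord_continuous.
have sq (v : 'cV[R]_n) (M : 'M[R]_n) :
    (a < eucl_norm (M *m v)) = (a ^+ 2 < \sum_i (M *m v) i ord0 ^+ 2).
  by rewrite -eucl_norm_sqr ltr_pXn2r// nnegrE ?eucl_norm_ge0.
apply/seteqP; split=> M /=; rewrite in_itv/= andbT.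
  move=> /(sup_gt (op_norm_has_sup M).1)[_ [v v1 <-] av].
  by exists v => //=; rewrite -sq.
move=> [v v1 /=]; rewrite -sq => av; apply: (lt_le_trans av).
by apply: ub_le_sup; [exact: (op_norm_has_sup M).2|exists v].
Qed.

Lemma op_norm_inv_ge n (M N : 'M[R]_n) (v : 'cV[R]_n) :
  N *m M = 1%:M -> eucl_norm v <= op_norm N * eucl_norm (M *m v).
Proof.
by move=> NM; rewrite -{1}(mul1mx v) -NM -mulmxA eucl_mulmx_le.
Qed.

End norms.

(** * Moments of the random product *)

Section exponent.
Context (R : realType).

(** The difference quotient at [- t] is at most [- kappa]. For small [t] the quotients at [t] and
    [- t] both lie within [kappa / 2] of the derivative, so the one at [t] is negative. *)
Lemma negative_right_of_zero (eta kappa : R) (Gamma : R -> R) :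
  0 < eta -> 0 < kappa -> derivable Gamma 0 1 -> Gamma 0 = 0 ->
  (forall a, - eta < a < 0 -> - kappa * a <= Gamma a) ->
  exists a, [/\ 0 < a, a < eta, a <= 1 & Gamma a < 0].
Proof.
move=> eta0 kappa0 dG G0 Gneg.
have [l] : exists l : R, (fun h => h^-1 * Gamma h) @ 0^' --> l.
  have /cvg_ex[l hl] := dG; exists l; move: hl.
  rewrite (_ : (fun h => _) = (fun h => h^-1 * Gamma h))//.
  by apply/funext => h; rewrite /= G0 subr0 addr0 /GRing.scale/= mulr1.
move=> /cvgrPdist_lt /(_ _ (divr_gt0 kappa0 (ltr0n R 2))).
rewrite near_withinE => /nbhs_ballP[e/= e0 he].
(* The cap at 1 is for [powR_le1D], where the exponent must not exceed 1. *)
pose t := Num.min (Num.min (e / 2) (eta / 2)) 1.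
have t0 : 0 < t by rewrite !lt_min ltr01 !divr_gt0.
have te : t < e by rewrite !gt_min ltr_pdivrMr// ltr_pMr// ltr1n.
have teta : t < eta.
  rewrite !gt_min; apply/orP; left; apply/orP; right.
  by rewrite ltr_pdivrMr// ltr_pMr// ltr1n.
exists t; split => //; first by rewrite ge_min lexx orbT.
have H1 : `|l - (- t)^-1 * Gamma (- t)| < kappa / 2.
  by apply: he; rewrite /ball/= ?oppr_eq0 ?gt_eqF// sub0r opprK gtr0_norm.
have H2 : `|l - t^-1 * Gamma t| < kappa / 2.
  by apply: he; rewrite /ball/= ?gt_eqF// sub0r normrN gtr0_norm.
have H3 : kappa * t <= Gamma (- t).
  by rewrite -mulrNN Gneg// ltrN2 teta oppr_lt0.
have H4 : (- t)^-1 * Gamma (- t) <= - kappa.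
  rewrite invrN mulNr lerN2 mulrC ler_pdivlMr//.
have : t^-1 * Gamma t < 0 by move: H1 H2; rewrite !ltr_norml; lra.
by rewrite pmulr_rlt0// invr_gt0.
Qed.

(** The bounds [k <= Z i w <= K] keep the logarithms bounded; all moments, also of negative order,
    are then finite and positive, and the extended logarithm in the hypothesis is a real one. *)
Lemma moment_contraction d (T : measurableType d) (P : probability T R)
    (Z : nat -> T -> R) (k K eta : R) (Gamma : R -> R) :
  (forall i, measurable_fun setT (Z i)) ->
  0 < k -> (forall i w, k <= Z i w <= K) ->
  (forall i, (0 < i)%N -> \int[P]_w ln (Z i w) = \int[P]_w ln (Z 1%N w)) ->
  \int[P]_w ln (Z 1%N w) < 0 ->
  0 < eta -> (forall a, - eta < a < eta -> derivable Gamma a 1) ->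
  (forall a, - eta < a < eta ->
       (fun n : nat => ((n%:R^-1)%:E * lne 'E_P[fun w =>
          (\prod_(1 <= i < n.+1) Z i w `^ a)%R])%E)
         @ \oo --> (Gamma a)%:E) ->
  exists a C rho : R, [/\ 0 < a, a <= 1, 0 < C, 0 < rho < 1 & forall n : nat,
    \int[P]_w (\prod_(1 <= i < n.+1) Z i w `^ a) <= C * rho ^+ n].
Proof.
move=> mZ k0 kZK Estat contr eta0 dG Glim.
have Zgt0 i w : 0 < Z i w by have /andP[+ _] := kZK i w; exact: lt_le_trans.
have [w0 _] : exists w : T, setT w.
  apply/set0P; apply/eqP => T0; have := probability_setT P.
  by rewrite T0 measure0 => /eqP; rewrite eq_sym onee_eq0.
have kK : k <= K by have /andP[a b] := kZK 0%N w0; exact: le_trans b.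
have K0 : 0 < K by exact: lt_le_trans kK.
pose L := Num.max `|ln k| `|ln K|.
have lnZ i w : `|ln (Z i w)| <= L.
  have /andP[h1 h2] := kZK i w.
  have : ln k <= ln (Z i w) by rewrite ler_ln ?posrE.
  have : ln (Z i w) <= ln K by rewrite ler_ln ?posrE.
  rewrite /L le_max !ler_norml; have := ler_norm (ln K).
  have := ler_norm (- ln k); rewrite normrN.
  by case: (lerP 0 (ln (Z i w))) => ? ? ? ? ?; apply/orP; [right|left]; lra.
have mln i : measurable_fun setT (fun w => ln (Z i w)).
  by apply: measurableT_comp (mZ i).
pose W a n w := \prod_(1 <= i < n.+1) Z i w `^ a.
have WE a n w : W a n w = expR (a * \sum_(1 <= i < n.+1) ln (Z i w)).
  rewrite /W mulr_sumr expR_sum; apply: eq_bigr => i _.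
  by rewrite /powR gt_eqF.
have msum n : measurable_fun setT (fun w => \sum_(1 <= i < n.+1) ln (Z i w)).
  exact: measurable_sum.
have sumL n w : `|\sum_(1 <= i < n.+1) ln (Z i w)| <= n%:R * L.
  apply: (le_trans (ler_norm_sum _ _ _)).
  apply: (@le_trans _ _ (\sum_(1 <= i < n.+1) L)); first exact: ler_sum.
  by rewrite sumr_const_nat subn1 mulr_natl.
have mW a n : measurable_fun setT (W a n).
  rewrite (_ : W a n = expR \o (fun w => a * \sum_(1 <= i < n.+1) ln (Z i w))).
    by apply: measurableT_comp => //; exact: measurable_funM.
  by apply/funext => w; rewrite WE.
have bW a n w : `|W a n w| <= expR (`|a| * (n%:R * L)).
  rewrite WE ger0_norm ?expR_ge0// ler_expR (le_trans (ler_norm _))//.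
  by rewrite normrM ler_wpM2l.
have iW a n := bounded_integrable P (mW a n) (bW a n).
have EW a n : ('E_P[fun w => W a n w] = (\int[P]_w W a n w)%R%:E)%E.
  rewrite unlock fineK//; exact: (integrable_fin_num _ (iW a n)).
set kappa := - \int[P]_w ln (Z 1%N w).
have kappa0 : 0 < kappa by rewrite oppr_gt0.
have iln i : P.-integrable setT (EFin \o (fun w => ln (Z i w))).
  exact: bounded_integrable (mln i) (lnZ i).
have isum n : P.-integrable setT (EFin \o (fun w => \sum_(1 <= i < n.+1) ln (Z i w))).
  exact: bounded_integrable (msum n) (sumL n).
have Esum n : \int[P]_w (\sum_(1 <= i < n.+1) ln (Z i w)) = - n%:R * kappa.
  elim: n => [|n IHn].
    rewrite oppr0 mul0r -[RHS](probability_Rintegral_cst P).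
    by apply: eq_Rintegral => w _; rewrite big_geq.
  transitivity (\int[P]_w (\sum_(1 <= i < n.+1) ln (Z i w) + ln (Z n.+1 w))).
    by apply: eq_Rintegral => w _; rewrite [LHS]big_nat_recr.
  rewrite RintegralD// IHn Estat// -natr1 -[X in _ + X]opprK -/kappa.
  by ring.
have EWpos a n : expR (a * (- n%:R * kappa)) <= \int[P]_w W a n w.
  pose S w := \sum_(1 <= i < n.+1) ln (Z i w).
  have iS : P.-integrable setT (EFin \o S) by exact: isum n.
  set c := a * _.
  have ic (r : R) : P.-integrable setT (EFin \o (fun=> r)).
    exact: finite_measure_integrable_cst.
  (* Jensen by the tangent to [expR] at [c], the mean of [a * S]: the integral of the tangent line
     is [expR c]. *)
  have -> : expR c = \int[P]_w (expR c * (a * S w + (1 - c))).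
    rewrite RintegralZl//; last first.
      by apply: integrable_addR; [exact: integrable_scaleR|exact: ic].
    rewrite RintegralD//; last exact: integrable_scaleR.
    by rewrite RintegralZl// Esum probability_Rintegral_cst -/c addrC subrK mulr1.
  apply: le_Rintegral => //.
    apply: integrable_scaleR.
    by apply: integrable_addR; [exact: integrable_scaleR|exact: ic].
  move=> w _; rewrite WE -/(S w) -{2}(subrK c (a * S w)) expRD mulrC.
  rewrite ler_wpM2r ?expR_ge0//.
  by rewrite addrCA expR_ge1Dx.
have G0 : Gamma 0 = 0.
  have := Glim 0; rewrite oppr_lt0 eta0 => /(_ isT).
  rewrite (_ : (fun n => _) = fun=> 0%E).
    move=> /fine_cvgP[_ h]; rewrite -(cvg_lim (@Rhausdorff R) h).
    by rewrite (_ : fine \o _ = fun=> 0) ?lim_cst.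
  apply/funext => n; rewrite -/(W 0 n) EW (_ : \int[P]_w _ = 1) ?lne1 ?mule0//.
  rewrite -[RHS](probability_Rintegral_cst P).
  by apply: eq_Rintegral => w _; rewrite WE mul0r expR0.
have lneW a n : lne ('E_P[fun w => W a n w])%E = (ln (\int[P]_w W a n w))%:E.
  by rewrite EW lne_EFin// (lt_le_trans _ (EWpos a n)) ?expR_gt0.
have Glim' a : - eta < a < eta ->
    (fun n => n%:R^-1 * ln (\int[P]_w W a n w)) @ \oo --> Gamma a.
  move=> /Glim; rewrite (_ : (fun n => _) =
    EFin \o (fun n => n%:R^-1 * ln (\int[P]_w W a n w))); last first.
    by apply/funext => n /=; rewrite -/(W a n) lneW.
  by move=> /fine_cvgP[].
have Gneg a : - eta < a < 0 -> - kappa * a <= Gamma a.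
  move=> /andP[ea a0].
  have ae : - eta < a < eta by rewrite ea (lt_trans a0).
  rewrite -(cvg_lim (@Rhausdorff R) (Glim' a ae)).
  apply: limr_ge; first by apply/cvg_ex; exists (Gamma a); exact: Glim'.
  near=> n.
  have n0 : 0 < n%:R :> R by rewrite ltr0n; near: n; exists 1%N.
  rewrite [leRHS]mulrC ler_pdivlMr//.
  have := EWpos a n; rewrite -ler_ln ?posrE ?expR_gt0 ?(lt_le_trans _ (EWpos a n)) ?expR_gt0//.
  by rewrite expRK; apply: le_trans; rewrite le_eqVlt; apply/orP; left; apply/eqP; ring.
have [a [a0 aeta a1 Ga]] : exists a, [/\ 0 < a, a < eta, a <= 1 & Gamma a < 0].
  apply: (@negative_right_of_zero eta kappa) => //.
  by apply: dG; rewrite oppr_lt0 eta0.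
have ae : - eta < a < eta by rewrite aeta (lt_trans _ a0)// oppr_lt0.
(* Half of the negative number [Gamma a] leaves the margin needed to pass from the limit to all
   large [n]. *)
pose rho := expR (Gamma a / 2).
have rho01 : 0 < rho < 1 by rewrite expR_gt0 -expR0 ltr_expR; lra.
have /andP[rho0 rho1] := rho01.
have : \forall n \near \oo, n%:R^-1 * ln (\int[P]_w W a n w) <= Gamma a / 2.
  by apply: (cvgr_le _ (Glim' a ae)); lra.
move=> [N0 _ HN0].
(* The quotient handles [n < N0], where the moment is at most its numerator and [rho ^+ n] is at
   least [rho ^+ N0]; the added 1 gives [1 <= C] for the other [n]. *)
pose C := expR (a * (N0%:R * L)) / rho ^+ N0 + 1.
have rhoN n : 0 < rho ^+ n by rewrite exprn_gt0.
exists a, C, rho; split => //.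
  by rewrite /C ltr_wpDl// divr_ge0 ?expR_ge0// ltW.
move=> n; rewrite -/(W a n).
have [nN0|nN0] := ltnP n N0; last first.
  (* If [N0] is 0 then [n] may be 0, where [n%:R^-1] is 0 and the logarithmic bound is void; there
     the product is empty. *)
  have n0 : 0 < n%:R :> R \/ n = 0%N.
    by case: n {nN0} => [|n]; [right|left; rewrite ltr0n].
  have W0 := lt_le_trans (expR_gt0 _) (EWpos a n).
  apply: (@le_trans _ _ (rho ^+ n)); last first.
    rewrite ler_peMl ?(ltW (rhoN _))// /C lerDr divr_ge0 ?expR_ge0// ltW//.
  case: n0 => [n0|->]; last first.
    rewrite expr0 -[leRHS](probability_Rintegral_cst P).
    apply: le_Rintegral; [by []|exact: iW|exact: finite_measure_integrable_cst|].
    move=> w _; have := WE a 0%N w; rewrite big_geq// mulr0 expR0.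
  have := HN0 n nN0; rewrite /= mulrC ler_pdivrMr// => h.
  by rewrite -ler_ln ?posrE// lnXn// /rho expRK -[leRHS]mulr_natr.
have W0 : \int[P]_w W a n w <= expR (a * (N0%:R * L)).
  rewrite -[leRHS](probability_Rintegral_cst P).
  apply: le_Rintegral; [by []|exact: iW|exact: finite_measure_integrable_cst|].
  move=> w _; apply: (le_trans (ler_norm _)); apply: (le_trans (bW _ _ _)).
  rewrite ler_expR (gtr0_norm a0); apply: ler_wpM2l; first exact: ltW.
  apply: ler_wpM2r; first by rewrite /L le_max normr_ge0.
  by rewrite ler_nat ltnW.
apply: (le_trans W0); apply: (@le_trans _ _ (expR (a * (N0%:R * L)) / rho ^+ N0 * rho ^+ n)).
  rewrite -mulrA ler_peMr ?expR_ge0// mulrC ler_pdivlMr// mul1r.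
  by apply: ler_wiXn2l; [exact: ltW|exact: ltW|exact: ltnW].
by rewrite ler_wpM2r ?(ltW (rhoN n))// /C lerDl.
Unshelve. all: by end_near. Qed.

End exponent.

(** * The chain in a fixed environment *)

Section quenched.
Context (R : realType) (m d : nat).
Variables (A B : 'cV[R]_m -> 'M[R]_d) (nu : probability 'cV[R]_d R).
Hypotheses (mA : measurable_fun setT A) (mB : measurable_fun setT B).

Lemma measurable_mulmx_cv du (U : measurableType du)
    (M : U -> 'M[R]_d) (x : U -> 'cV[R]_d) :
  measurable_fun setT M -> measurable_fun setT x ->
  measurable_fun setT (fun u => M u *m x u).
Proof.
move=> /measurable_fun_mxP mM /measurable_fun_mxP mx.
apply/measurable_fun_mxP => i j.
rewrite (_ : (fun u => _) = (fun u => \sum_k M u i k * x u k j)); last first.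
  by apply/funext => u; rewrite mxE.
by apply: measurable_sum => k; exact: measurable_funM.
Qed.

Lemma measurable_mulmx_mx du (U : measurableType du) (M N : U -> 'M[R]_d) :
  measurable_fun setT M -> measurable_fun setT N ->
  measurable_fun setT (fun u => M u *m N u).
Proof.
move=> /measurable_fun_mxP mM /measurable_fun_mxP mx.
apply/measurable_fun_mxP => i j.
rewrite (_ : (fun u => _) = (fun u => \sum_k M u i k * N u k j)); last first.
  by apply/funext => u; rewrite mxE.
by apply: measurable_sum => k; exact: measurable_funM.
Qed.

Lemma measurable_addmx du (U : measurableType du) (x y : U -> 'cV[R]_d) :
  measurable_fun setT x -> measurable_fun setT y ->
  measurable_fun setT (fun u => x u + y u).
Proof.
move=> /measurable_fun_mxP mx /measurable_fun_mxP my.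
apply/measurable_fun_mxP => i j.
rewrite (_ : (fun u => _) = (fun u => x u i j + y u i j)); last first.
  by apply/funext => u; rewrite mxE.
exact: measurable_funD.
Qed.

Lemma measurable_normmx : measurable_fun setT (fun v : 'cV[R]_d => `|v|).
Proof.
rewrite (_ : (fun v => _) = (fun v : 'cV[R]_d => \big[Num.max/0]_ij `|v ij.1 ij.2|)); last first.
  by apply/funext => v; rewrite [LHS]/Num.norm/= mx_normrE.
elim: (index_enum _) => [|ij s IHs].
  rewrite (_ : (fun v => _) = cst 0)//.
  by apply/funext => v; rewrite big_nil.
rewrite (_ : (fun v => _) = (fun v : 'cV[R]_d =>
  Num.max `|v ij.1 ij.2| (\big[Num.max/0]_(ij <- s) `|v ij.1 ij.2|))); last first.
  by apply/funext => v; rewrite big_cons.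
apply: measurable_maxr => //; apply: measurableT_comp => //.
exact: measurable_mx_coord.
Qed.

(* [quenched n s phi y x] is the expectation of [phi] at time [s + n] for the
   chain started from [x] at time [s] in the fixed environment [y]. *)
Fixpoint quenched (n : nat) (s : int) (phi : 'cV[R]_d -> R)
    (y : int -> 'cV[R]_m) (x : 'cV[R]_d) : R :=
  match n with
  | 0 => phi x
  | n'.+1 => \int[nu]_e quenched n' (s + 1) phi y (A (y s) *m x + B (y s) *m e)
  end.

(** The product A(y_{s+n-1}) ... A(y_s), with the earliest factor split off so that the recursion
    runs in step with that of [quenched]. *)
Fixpoint cocycle (y : int -> 'cV[R]_m) (s : int) (n : nat) : 'M[R]_d :=
  match n with
  | 0 => 1%:M
  | n'.+1 => cocycle y (s + 1) n' *m A (y s)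
  end.

(** This class contains the indicators, which give total variation, and every bounded measurable
    function after an affine change of scale. *)
Definition unit_valued (phi : 'cV[R]_d -> R) :=
  measurable_fun setT phi /\ forall x, 0 <= phi x <= 1.

Section bounds.
Variables (phi : 'cV[R]_d -> R) (uphi : unit_valued phi).

Lemma quenched_ge0 n s y x : 0 <= quenched n s phi y x.
Proof.
elim: n s x => [|n IHn] s x /=; first by have /andP[] := uphi.2 x.
exact: Rintegral_ge0.
Qed.

(** Environment and state both depend on a parameter in an arbitrary space [U], because the
    induction replaces [U] by its product with the noise space. *)
Lemma measurable_quenched n s du (U : measurableType du)
    (y : U -> int -> 'cV[R]_m) (x : U -> 'cV[R]_d) :
  (forall j, measurable_fun setT (fun u => y u j)) -> measurable_fun setT x ->
  measurable_fun setT (fun u => quenched n s phi (y u) (x u)).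
Proof.
elim: n s du U y x => [|n IHn] s du U y x my mx /=.
  exact: measurableT_comp uphi.1 mx.
apply: (@measurable_Rintegral_snd _ _ _ _ _ _ (fun ue => quenched n (s + 1) phi
  (y ue.1) (A (y ue.1 s) *m x ue.1 + B (y ue.1 s) *m ue.2))).
- apply: IHn => [j|].
    exact: (measurableT_comp (my j) measurable_fst).
  apply: measurable_addmx; apply: measurable_mulmx_cv => //.
  + by apply: (measurableT_comp mA); exact: (measurableT_comp (my s) measurable_fst).
  + exact: (measurableT_comp mx measurable_fst).
  + by apply: (measurableT_comp mB); exact: (measurableT_comp (my s) measurable_fst).
- by move=> z; exact: quenched_ge0.
Qed.

Lemma measurable_quenched_step n s (y : int -> 'cV[R]_m) (x : 'cV[R]_d) :
  measurable_fun setT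
    (fun e => quenched n (s + 1) phi y (A (y s) *m x + B (y s) *m e)).
Proof.
apply: measurable_quenched => //.
by apply: measurable_addmx => //; exact: measurable_mulmx_cv.
Qed.

Lemma quenched_le1 n s y x : quenched n s phi y x <= 1.
Proof.
elim: n s x => [|n IHn] s x /=; first by have /andP[] := uphi.2 x.
apply: le_trans (ler_norm _) _; apply: probability_Rintegral_bound.
  exact: measurable_quenched_step.
by move=> e; rewrite ger0_norm ?quenched_ge0.
Qed.

Lemma quenched_norm_le1 n s y x : `|quenched n s phi y x| <= 1.
Proof. by rewrite ger0_norm ?quenched_ge0 ?quenched_le1. Qed.

Lemma quenched_step_integrable n s y x : nu.-integrable setT
  (EFin \o (fun e => quenched n (s + 1) phi y (A (y s) *m x + B (y s) *m e))).
Proof.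
apply: bounded_integrable; first exact: measurable_quenched_step.
by move=> e; exact: quenched_norm_le1.
Qed.

Lemma quenched_shift n s u y x :
  quenched n (s + u) phi y x = quenched n s phi (fun j => y (j + u)) x.
Proof.
elim: n s x => [|n IHn] s x //=.
by apply: eq_Rintegral => e _; rewrite addrAC IHn.
Qed.

End bounds.

Lemma cocycleD y s n k :
  cocycle y s (n + k) = cocycle y (s + n%:Z) k *m cocycle y s n.
Proof.
elim: n s => [|n IHn] s /=; first by rewrite mulmx1 addr0.
rewrite IHn mulmxA; congr (cocycle _ _ _ *m _ *m _).
by rewrite -addrA; congr (_ + _); rewrite -PoszD add1n.
Qed.

Lemma cocycle_shift y s u n :
  cocycle y (s + u) n = cocycle (fun j => y (j + u)) s n.
Proof. by elim: n s => [|n IHn] s //=; rewrite addrAC IHn. Qed.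

Lemma measurable_cocycle n s du (U : measurableType du)
    (y : U -> int -> 'cV[R]_m) :
  (forall j, measurable_fun setT (fun u => y u j)) ->
  measurable_fun setT (fun u => cocycle (y u) s n).
Proof.
move=> my; elim: n s => [|n IHn] s /=; first exact: measurable_cst.
apply: measurable_mulmx_mx; first exact: IHn.
exact: (measurableT_comp mA (my s)).
Qed.

Lemma cocycle_bound (KA : R) y s n : 0 <= KA -> (forall z, op_norm (A z) <= KA) ->
  op_norm (cocycle y s n) <= KA ^+ n.
Proof.
move=> KA0 AK; elim: n s => [|n IHn] s /=; first by rewrite expr0 op_norm1.
apply: (le_trans (op_norm_mulmx _ _)); rewrite exprSr.
by apply: ler_pM; rewrite ?op_norm_ge0.
Qed.

Lemma cocycle_block_prod y p i : (0 < i)%N ->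
  cocycle y (1 + (i.-1 * p)%N%:Z) p = block_prod A y p i.
Proof.
case: i => // i _ /=; rewrite /block_prod.
have H n k : cocycle y (1 + k%:Z) n =
    \big[mulmx/1%:M]_(0 <= j < n) A (y (k + n - j)%N%:Z).
  elim: n k => [|n IHn] k; first by rewrite big_geq.
  rewrite big_nat_recl// -addn1 cocycleD IHn /= mul1mx; congr (A (y _) *m _).
    by rewrite addrAC -addrA -!PoszD; congr Posz; lia.
  by apply: eq_bigr => j _; congr (A (y _)); congr Posz; lia.
by rewrite H; apply: eq_bigr => j _; congr (A (y _)); congr Posz; lia.
Qed.

(* Under common noise the difference of two trajectories is deterministic. *)
Lemma quenched_common phi (uphi : unit_valued phi) n L s y z z' (beta : R) :
  (forall x x', `|x - x'| <= 1 ->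
     `|quenched n (s + L%:Z) phi y x - quenched n (s + L%:Z) phi y x'| <= beta) ->
  `|cocycle y s L *m (z - z')| <= 1 ->
  `|quenched (L + n) s phi y z - quenched (L + n) s phi y z'| <= beta.
Proof.
elim: L s z z' => [|L IHL] s z z'; first by rewrite mul1mx addr0; exact.
rewrite /= => H zz.
rewrite -RintegralB//; [|exact: quenched_step_integrable..].
have mm : measurable_fun setT (fun e =>
    quenched (L + n) (s + 1) phi y (A (y s) *m z + B (y s) *m e) -
    quenched (L + n) (s + 1) phi y (A (y s) *m z' + B (y s) *m e)).
  by apply: measurable_funB; exact: measurable_quenched_step.
apply: probability_Rintegral_bound => // e.
have E : s + 1 + L%:Z = s + L.+1%:Z by rewrite -addrA -PoszD add1n.
apply: IHL; first by rewrite E.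
by rewrite opprD addrACA subrr addr0 -mulmxBr mulmxA.
Qed.

Lemma powR1E (a : R) : 1 `^ a = 1.
Proof. by rewrite powR1. Qed.

(** Turns a fractional power of a distance into an affine function, which the first moment of the
    noise can integrate. *)
Lemma powR_le1D (a r : R) : 0 < a -> a <= 1 -> 0 <= r -> r `^ a <= 1 + r.
Proof.
move=> a0 a1 r0; have [r1|r1] := leP r 1.
  apply: (@le_trans _ _ 1); last by rewrite lerDl.
  by rewrite -(powR1E a); apply: ge0_ler_powR; rewrite ?nnegrE// ltW.
apply: (@le_trans _ _ r); last by rewrite lerDr.
by rewrite -{2}(powRr1 r0) ler_powR// ltW.
Qed.

Lemma attempt_arith (alpha b K S q : R) : 0 <= alpha -> 0 <= K -> 0 <= S ->
  (1 - alpha) * (b + K * S) + K * q <= (1 - alpha) * b + K * (q + S).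
Proof. by move=> a0 K0 S0; have := mulr_ge0 a0 (mulr_ge0 K0 S0); lra. Qed.

Lemma forgetting_arith (b K S q t : R) :
  0 <= b -> 0 <= K -> 0 <= S -> 0 <= t ->
  b + K * S + q * (1 + t) <= (b + K * S + q) * (1 + t).
Proof.
by move=> b0 K0 S0 t0; have := mulr_ge0 (addr_ge0 b0 (mulr_ge0 K0 S0)) t0; lra.
Qed.

(** * Coupling attempts and their cost *)

Section attempts.
Variables (phi : 'cV[R]_d -> R) (uphi : unit_valued phi) (a : R).
Hypotheses (a0 : 0 < a) (a1 : a <= 1).

(** The Markov-inequality cost of two copies not being within distance 1 after [L] steps. The
    exponent [a] is there because only small moments of the matrix product are known to decay. *)
Definition contraction L y s : R :=
  (d%:R * op_norm (cocycle y s L)) `^ a.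

Lemma contraction_ge0 L y s : 0 <= contraction L y s.
Proof. exact: powR_ge0. Qed.

(** In a fixed environment this is a dichotomy: either the product brings the copies within distance
    1 and [beta] applies, or the a-th power of d |||M||| |z - z'| exceeds 1 and pays for the trivial
    bound. *)
Lemma quenched_common_le n L s y z z' (beta : R) :
  (forall x x', `|x - x'| <= 1 ->
     `|quenched n (s + L%:Z) phi y x - quenched n (s + L%:Z) phi y x'| <= beta) ->
  `|quenched (L + n) s phi y z - quenched (L + n) s phi y z'| <=
    beta + contraction L y s * (1 + `|z - z'|).
Proof.
move=> H.
have b0 : 0 <= beta.
  by apply: le_trans (normr_ge0 _) (H 0 0 _); rewrite subrr normr0.
have q0 := contraction_ge0 L y s.
have [small|big] := leP `|cocycle y s L *m (z - z')| 1.
  apply: (le_trans (quenched_common uphi H small)).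
  by rewrite lerDl mulr_ge0// addr_ge0.
have g0 x : 0 <= quenched (L + n) s phi y x := quenched_ge0 uphi _ _ _ _.
have g1 x : quenched (L + n) s phi y x <= 1 := quenched_le1 uphi _ _ _ _.
apply: (@le_trans _ _ 1).
  have := g0 z; have := g0 z'; have := g1 z; have := g1 z'.
  by rewrite ler_norml; lra.
rewrite -[leLHS]add0r lerD//.
have t1 := lt_le_trans big (norm_mulmx_le _ _).
apply: (@le_trans _ _ (contraction L y s * `|z - z'| `^ a)).
  rewrite /contraction -powRM ?mulr_ge0 ?op_norm_ge0//.
  rewrite -[leLHS](powR1E a); apply: ge0_ler_powR; rewrite ?nnegrE ?(ltW a0)//.
    by rewrite !mulr_ge0 ?op_norm_ge0.
  exact: ltW.
by rewrite ler_wpM2l// powR_le1D.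
Qed.

Variables (KA KB KI alpha : R).
Hypotheses (HKA : forall y (x : 'cV[R]_d), `|A y *m x| <= KA * `|x|)
  (HKB : forall y (e : 'cV[R]_d), `|B y *m e| <= KB * `|e|)
  (HKI : forall y (x : 'cV[R]_d), `|invmx (B y) *m (A y *m x)| <= KI * `|x|)
  (uB : forall y, B y \in unitmx)
  (KA0 : 0 <= KA) (KB0 : 0 <= KB) (KI0 : 0 <= KI)
  (alpha0 : 0 < alpha) (alpha1 : alpha < 1)
  (minor : forall v : 'cV[R]_d, `|v| <= KI ->
    exists ka1 ka2 : {finite_measure set 'cV[R]_d -> \bar R},
      [/\ forall E, measurable E -> (ka1 E <= nu E)%E,
          forall E, measurable E -> (ka2 E <= nu E)%E,
          ka1 setT = alpha%:E, ka2 setT = alpha%:E &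
          forall h : 'cV[R]_d -> R, measurable_fun setT h ->
            (forall e, `|h e| <= 1) ->
            \int[ka1]_e h (e + v) = \int[ka2]_e h e])
  (inu : nu.-integrable setT (EFin \o (fun e : 'cV[R]_d => `|e|))).

(** Twice the integral of the cost [w] in [quenched_attempt_half], per unit of [contraction]: after
    one step with unrelated noises [e], [e'] the copies are at distance at most KA + KB |e| + KB
    |e'|, and the 1 comes from [powR_le1D]. *)
Definition attempt_cst := 1 + KA + 2 * KB * \int[nu]_e `|e|.

Lemma attempt_cst_ge0 : 0 <= attempt_cst.
Proof.
have i0 : 0 <= \int[nu]_e `|e| by exact: Rintegral_ge0.
by rewrite /attempt_cst addr_ge0 ?addr_ge0// mulr_ge0// mulr_ge0.
Qed.

(** With [v] equal to B^-1 A (x - x'), the copy at [x] driven by [e] lands where the copy at [x']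
    driven by [e + v] does. The minorizing parts are matched along this translation and cancel; from
    the remainders the copies have [L] further steps to approach each other. *)
Lemma quenched_attempt_half n L s y x x' (beta : R) :
  (forall x x', `|x - x'| <= 1 ->
     `|quenched n (s + L.+1%:Z) phi y x - quenched n (s + L.+1%:Z) phi y x'|
       <= beta) ->
  `|x - x'| <= 1 ->
  quenched (L + n).+1 s phi y x - quenched (L + n).+1 s phi y x' <=
    (1 - alpha) * beta + attempt_cst * contraction L y (s + 1).
Proof.
move=> H xx.
set q := contraction _ _ _; have q0 : 0 <= q by exact: contraction_ge0.
pose h x e := quenched (L + n) (s + 1) phi y (A (y s) *m x + B (y s) *m e).
(* The part [1 + KA] of the cost is shared equally between the two noises, so that [w e + w e'] is
   the full cost. *)
pose w (e : 'cV[R]_d) := q * ((1 + KA) / 2) + q * KB * `|e|.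
pose v := invmx (B (y s)) *m (A (y s) *m (x - x')).
have vKI : `|v| <= KI.
  apply: (le_trans (HKI _ _)); rewrite -[leRHS]mulr1 ler_wpM2l//.
have [ka1 [ka2 [k1 k2 m1 m2 shift]]] := minor vKI.
have mh z : measurable_fun setT (h z) by exact: measurable_quenched_step.
have bh z e : `|h z e| <= 1 by exact: quenched_norm_le1.
have iw1 : nu.-integrable setT (EFin \o (fun e : 'cV[R]_d => q * KB * `|e|)).
  exact: integrable_scaleR.
have ic r : nu.-integrable setT (EFin \o (fun=> r : R)).
  exact: finite_measure_integrable_cst.
have iw : nu.-integrable setT (EFin \o w) by apply: integrable_addR.
have E2 : 2 * \int[nu]_e w e = attempt_cst * q.
  rewrite /w RintegralD// probability_Rintegral_cst RintegralZl//.
  by rewrite /attempt_cst; field.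
rewrite /= -/(h x) -/(h x') -E2.
apply: (@coupling_step _ _ _ nu ka1 ka2 alpha beta (h x) (h x') w k1 k2 m1 m2
  alpha1 (mh x) (mh x') (bh x) (bh x') iw).
- move=> e; apply: addr_ge0; apply: mulr_ge0 => //.
    by apply: divr_ge0 => //; exact: addr_ge0.
  exact: mulr_ge0.
- rewrite -shift//; apply: eq_Rintegral => e _; rewrite /h; congr quenched.
  rewrite mulmxDr /v mulmxA mulmxV// mul1mx mulmxBr.
  by rewrite [RHS]addrCA subrKC addrC.
- move=> e e'; apply: (le_trans (ler_norm _)).
  apply: (@le_trans _ _ (beta + q * (1 + (KA + KB * `|e| + KB * `|e'|)))).
    apply: (le_trans (@quenched_common_le _ _ _ _ _ _ beta _)).
      by move=> u u' uu; have := H u u' uu; rewrite -addrA -PoszD add1n.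
    rewrite lerD2l ler_wpM2l// lerD2l.
    rewrite opprD addrACA -mulmxBr (le_trans (ler_normD _ _))// -addrA lerD//.
      apply: (le_trans (HKA _ _)); rewrite -[leRHS]mulr1.
      by rewrite ler_wpM2l.
    by rewrite (le_trans (ler_normB _ _))// lerD.
  by rewrite /w le_eqVlt; apply/orP; left; apply/eqP; field.
Qed.

Lemma quenched_attempt n L s y x x' (beta : R) :
  (forall x x', `|x - x'| <= 1 ->
     `|quenched n (s + L.+1%:Z) phi y x - quenched n (s + L.+1%:Z) phi y x'|
       <= beta) ->
  `|x - x'| <= 1 ->
  `|quenched (L + n).+1 s phi y x - quenched (L + n).+1 s phi y x'| <=
    (1 - alpha) * beta + attempt_cst * contraction L y (s + 1).
Proof.
move=> H xx; rewrite ler_norml; apply/andP; split.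
  by rewrite lerNl opprB quenched_attempt_half// distrC.
exact: quenched_attempt_half.
Qed.

(** An attempt lasts [L.+1] steps: one to couple, then [L] to come close again, whose cost starts
    one step late. Costs of later attempts are kept without their factors [1 - alpha]. *)
Lemma quenched_attempts n L k s y x x' : `|x - x'| <= 1 ->
  `|quenched (k * L.+1 + n) s phi y x - quenched (k * L.+1 + n) s phi y x'| <=
   (1 - alpha) ^+ k + attempt_cst *
     \sum_(0 <= j < k) contraction L y (s + (j * L.+1).+1%:Z).
Proof.
elim: k s x x' => [|k IHk] s x x' xx.
  rewrite expr0 big_geq// mulr0 addr0 add0n.
  have := quenched_ge0 uphi n s y x; have := quenched_ge0 uphi n s y x'.
  have := quenched_le1 uphi n s y x; have := quenched_le1 uphi n s y x'.
  by rewrite ler_norml; lra.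
have -> : (k.+1 * L.+1 + n = (L + (k * L.+1 + n)).+1)%N by lia.
apply: (le_trans (quenched_attempt (fun u u' => IHk _ u u') xx)).
have E : \sum_(0 <= j < k) contraction L y (s + (j.+1 * L.+1).+1%:Z) =
    \sum_(0 <= j < k) contraction L y (s + L.+1%:Z + (j * L.+1).+1%:Z).
  apply: eq_bigr => j _; rewrite -addrA -PoszD.
  by congr (contraction L y (s + Posz _)); lia.
have E' : \sum_(0 <= j < k.+1) contraction L y (s + (j * L.+1).+1%:Z) =
    contraction L y (s + 1) +
    \sum_(0 <= j < k) contraction L y (s + L.+1%:Z + (j * L.+1).+1%:Z).
  by rewrite -E; apply: big_nat_recl.
rewrite E' exprS; apply: attempt_arith; first exact: ltW.
  exact: attempt_cst_ge0.
by apply: sumr_ge0 => j _; exact: contraction_ge0.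
Qed.

(** The terms account for [k] failed attempts, for a failed approach after one of them, and for a
    failed initial approach. Neither the test function nor the starting points occur. *)
Definition forgetting L k y s : R := (1 - alpha) ^+ k + attempt_cst *
  \sum_(0 <= j < k) contraction L y (s + (L + (j * L.+1).+1)%N%:Z) +
  contraction L y s.

Lemma forgetting_ge0 L k y s : 0 <= forgetting L k y s.
Proof.
rewrite /forgetting !addr_ge0 ?contraction_ge0 ?exprn_ge0 ?mulr_ge0//.
- by rewrite subr_ge0; exact: ltW.
- exact: attempt_cst_ge0.
- by apply: sumr_ge0 => j _; exact: contraction_ge0.
Qed.

Lemma quenched_forgetting n L k s y z z' :
  `|quenched (L + (k * L.+1 + n)) s phi y z -
    quenched (L + (k * L.+1 + n)) s phi y z'| <=
  forgetting L k y s * (1 + `|z - z'|).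
Proof.
have := quenched_common_le z z' (fun x x' => @quenched_attempts n L k (s + L%:Z) y x x').
have E : \sum_(0 <= j < k) contraction L y (s + L%:Z + (j * L.+1).+1%:Z) =
    \sum_(0 <= j < k) contraction L y (s + (L + (j * L.+1).+1)%N%:Z).
  by apply: eq_bigr => j _; rewrite -addrA -PoszD.
rewrite E /forgetting => /le_trans; apply; apply: forgetting_arith.
- by apply: exprn_ge0; rewrite subr_ge0; exact: ltW.
- exact: attempt_cst_ge0.
- by apply: sumr_ge0 => j _; exact: contraction_ge0.
- exact: normr_ge0.
Qed.

End attempts.
End quenched.

(** * The Markov property *)

Section markov.
Context (R : realType) (m d : nat) (disp : measure_display)
  (Omega : measurableType disp) (P : probability Omega R).
Variables (Y : int -> {RV P >-> 'cV[R]_m}) (eps : nat -> {RV P >-> 'cV[R]_d}).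

(** A pi-system generating the sigma-algebra of the whole environment and of the noise up to time
    [t]. The future environment belongs to it because [quenched] reads it. *)
Definition past t : set (set Omega) := [set C | exists E B,
  [/\ process_sigma setT (fun j => Y j : Omega -> 'cV[R]_m) E,
      forall i, measurable (B i : set 'cV[R]_d) &
      C = E `&` \bigcap_(i in [set` iota 1 t]) (eps i @^-1` B i)]].

Lemma process_sigma_measurable (I : Type) (D : set I) d1
    (T1 : measurableType d1) (Z : I -> {RV P >-> T1}) :
  process_sigma D (fun i => Z i : Omega -> T1) `<=` measurable.
Proof.
apply: smallest_sub; first exact: sigma_algebra_measurable.
move=> _ [i _ [E mE <-]].
by rewrite -[X in measurable X]setTI; exact: measurable_funP.
Qed.

Lemma past_measurable t : past t `<=` measurable.
Proof.
move=> _ [E [C [sE mC ->]]]; apply: measurableI.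
  exact: process_sigma_measurable sE.
apply: fin_bigcap_measurable => // i _.
by rewrite -[X in measurable X]setTI; exact: measurable_funP.
Qed.

Lemma past_setI t : setI_closed (past t).
Proof.
move=> _ _ [E [C [sE mC ->]]] [E' [C' [sE' mC' ->]]].
exists (E `&` E'), (fun i => C i `&` C' i); split.
- exact: (@measurableI _ (g_sigma_algebraType
    [set (Y i : Omega -> 'cV[R]_m) @^-1` B | i in setT & B in measurable]) E E').
- by move=> i; exact: measurableI.
- rewrite setIACA; congr (_ `&` _); apply/seteqP; split => w /=.
    by move=> [h1 h2] i it; split; [exact: h1|exact: h2].
  by move=> h; split=> i it; have [] := h i it.
Qed.

Lemma past_setT t : past t setT.
Proof.
exists setT, (fun=> setT); split => //.
  exact: (@measurableT _ (g_sigma_algebraType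
    [set (Y i : Omega -> 'cV[R]_m) @^-1` B | i in setT & B in measurable])).
by rewrite setTI; apply/seteqP; split.
Qed.

(** With this structure on [Omega], being a function of the past is plain measurability, and
    products with the noise space are available. *)
Definition pastType t := g_sigma_algebraType (past t).

Lemma past_sigma_measurable t : <<s past t >> `<=` @measurable _ Omega.
Proof.
apply: smallest_sub; first exact: sigma_algebra_measurable.
exact: past_measurable.
Qed.

Lemma past_mono t t' : (t <= t')%N -> <<s past t >> `<=` <<s past t' >>.
Proof.
move=> tt'; apply: smallest_sub; first exact: smallest_sigma_algebra.
move=> _ [E [C [sE mC ->]]]; apply: sub_sigma_algebra.
exists E, (fun i => if i \in iota 1 t then C i else setT); split => //.
  by move=> i; case: ifP.
congr (_ `&` _); apply/seteqP; split => w /= h i /=.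
  by move=> it'; case: ifP => // it; exact: h.
move=> it; have := h i; rewrite it; apply.
have it' : i \in iota 1 t' by move: it; rewrite !mem_iota; lia.
exact: it'.
Qed.

Lemma pastType_measurable_mono t t' d1 (T1 : measurableType d1)
    (g : Omega -> T1) : (t <= t')%N ->
  measurable_fun setT (g : pastType t -> T1) ->
  measurable_fun setT (g : pastType t' -> T1).
Proof.
move=> tt' mg _ B mB; apply: (past_mono tt').
exact: (mg measurableT B mB).
Qed.

Lemma pastType_measurable t d1 (T1 : measurableType d1) (g : Omega -> T1) :
  measurable_fun setT (g : pastType t -> T1) -> measurable_fun setT g.
Proof.
move=> mg _ B mB; apply: (@past_sigma_measurable t).
exact: (mg measurableT B mB).
Qed.

Lemma past_measurable_env t j : measurable_fun setT (Y j : pastType t -> 'cV[R]_m).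
Proof.
move=> _ B mB; rewrite setTI; apply: sub_sigma_algebra.
exists (Y j @^-1` B), (fun=> setT); split => //.
  by apply: sub_sigma_algebra; exists j => //; exists B.
by rewrite (_ : \bigcap_(_ in _) _ = setT) ?setIT//; apply/seteqP; split.
Qed.

Lemma past_measurable_noise t i : (0 < i <= t)%N ->
  measurable_fun setT (eps i : pastType t -> 'cV[R]_d).
Proof.
move=> it _ B mB; rewrite setTI; apply: sub_sigma_algebra.
exists setT, (fun j => if j == i then B else setT); split => //.
- exact: (@measurableT _ (g_sigma_algebraType
    [set (Y i : Omega -> 'cV[R]_m) @^-1` B | i in setT & B in measurable])).
- by move=> j; case: ifP.
- rewrite setTI; apply/seteqP; split => w /=.
    by move=> Bw j _; rewrite /preimage/=; case: eqP => // ->.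
  move=> /(_ i); rewrite /preimage/= eqxx; apply.
  by rewrite mem_iota; lia.
Qed.

Hypothesis eps_iid : iid [set t | (1 <= t)%N] eps.
Hypothesis eps_Y : independent_processes [set t | (1 <= t)%N] setT eps Y.

Let nu : probability 'cV[R]_d R := distribution P (eps 1%N).

(** As functions of [C], both sides are finite measures. They agree on the pi-system [past t]:
    independence of the noise sequence from the environment and independence of the noises among
    themselves give the product there. *)
Lemma past_indep t C D : <<s past t >> C -> measurable D ->
  P (C `&` eps t.+1 @^-1` D) = (P C * nu D)%E.
Proof.
move=> sC mD.
have mD' : measurable (eps t.+1 @^-1` D).
  by rewrite -[X in measurable X]setTI; exact: measurable_funP.
have nuE : nu D = P (eps t.+1 @^-1` D) by apply: (eps_iid.2 1%N t.+1) => //=.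
have [r r0 rE] : exists2 r : R, 0 <= r & nu D = r%:E.
  exists (fine (nu D)); first exact: fine_ge0.
  by rewrite fineK// fin_num_measure.
pose m1 : {measure set Omega -> \bar R} := mrestr P mD'.
pose m2 : {measure set Omega -> \bar R} := mscale (NngNum r0) P.
have m1E Z : m1 Z = P (Z `&` eps t.+1 @^-1` D) by [].
have m2E Z : m2 Z = (r%:E * P Z)%E by [].
suff : m1 C = m2 C by rewrite m1E m2E rE muleC.
apply: (g_sigma_algebra_measure_unique (past t) (@past_measurable t) (fun=> setT)) => //.
- by move=> _; exact: past_setT.
- by rewrite bigcup_const.
- exact: past_setI.
- move=> _ [E [B [sE mB ->]]].
  rewrite m1E m2E -rE nuE.
  pose F := \bigcap_(i in [set` iota 1 t]) (eps i @^-1` B i).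
  pose B' i := if i == t.+1 then D else B i.
  have mB' i : measurable (B' i) by rewrite /B'; case: ifP.
  have iotaS : iota 1 t.+1 = iota 1 t ++ [:: t.+1].
    by rewrite -{1}(addn1 t) iotaD add1n.
  have FE : F `&` eps t.+1 @^-1` D =
      \bigcap_(i in [set` iota 1 t.+1]) (eps i @^-1` B' i).
    rewrite iotaS; apply/seteqP; split => w /=.
      move=> [Fw Dw] i /=; rewrite mem_cat inE /preimage/= /B' => /orP[it|/eqP ->].
        by case: eqP => [->//|_]; exact: Fw.
      by rewrite eqxx.
    move=> h; split => [i /= it|].
      have := h i; rewrite /= mem_cat it /preimage/= /B' => /(_ isT).
      by case: eqP => // it'; move: it; rewrite mem_iota it'; lia.
    have := h t.+1; rewrite /= mem_cat inE eqxx orbT /preimage/= /B'.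
    by rewrite eqxx; apply.
  have sF (t' : nat) (B0 : nat -> set 'cV[R]_d) : (forall i, measurable (B0 i)) ->
      process_sigma [set t | (1 <= t)%N] (fun i => eps i : Omega -> 'cV[R]_d)
        (\bigcap_(i in [set` iota 1 t']) (eps i @^-1` B0 i)).
    move=> mB0; apply: (@fin_bigcap_measurable _ (g_sigma_algebraType
      [set (eps i : Omega -> 'cV[R]_d) @^-1` B | i in [set t | (1 <= t)%N] & B in measurable])) => // i.
    rewrite /= mem_iota => it; apply: sub_sigma_algebra; exists i => /=; first lia.
    by exists (B0 i).
  have muJ (t' : nat) (B0 : nat -> set 'cV[R]_d) : (forall i, measurable (B0 i)) ->
      P (\bigcap_(i in [set` iota 1 t']) (eps i @^-1` B0 i)) =
      (\prod_(i <- iota 1 t') P (eps i @^-1` B0 i))%E.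
    move=> mB0; apply: eps_iid.1 => //; first exact: iota_uniq.
    by move=> i; rewrite mem_iota => /andP[].
  have PF : P (F `&` eps t.+1 @^-1` D) = (P F * P (eps t.+1 @^-1` D))%E.
    rewrite FE !muJ// iotaS big_cat/= big_seq1 {2}/B' eqxx.
    congr (_ * _)%E; rewrite big_seq [in RHS]big_seq; apply: eq_bigr => i.
    by rewrite mem_iota /B' => it; case: eqP => // it'; lia.
  have sFD := sF t.+1 B' mB'; rewrite -FE in sFD.
  rewrite -/F -setIA (setIC E (F `&` _)) (eps_Y sFD sE) PF.
  by rewrite (setIC E) (eps_Y (sF _ _ mB) sE) -/F muleA (muleC (P (eps t.+1 @^-1` D))).
- move=> _; rewrite m1E setTI (le_lt_trans (probability_le1 _ _))//.
  exact: ltry.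
Qed.

(** The identity of [Omega], seen as a map into [pastType s], is the first variable of
    [indep_Rintegral]; this replaces a conditional expectation. *)
Lemma markov_step s (H : pastType s * 'cV[R]_d -> R) (K : R) :
  measurable_fun setT H -> (forall z, `|H z| <= K) ->
  \int[P]_w H (w, eps s.+1 w) = \int[P]_w (\int[nu]_e H (w, e)).
Proof.
move=> mH HK.
apply: (@indep_Rintegral R _ _ _ Omega (pastType s) _ P nu id (eps s.+1) H K) => //.
- by move=> _ B mB; rewrite setTI; exact: (@past_sigma_measurable s).
- by move=> C D mC mD; exact: past_indep.
Qed.

Variables (A B : 'cV[R]_m -> 'M[R]_d).
Hypotheses (mA : measurable_fun setT A) (mB : measurable_fun setT B).

Section chain.
Variables (x0 : 'cV[R]_d) (X : nat -> Omega -> 'cV[R]_d).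
Hypothesis X0 : forall w, X 0%N w = x0.
Hypothesis XS : forall t w,
  X t.+1 w = A (Y t%:Z w) *m X t w + B (Y t%:Z w) *m eps t.+1 w.

Lemma past_measurable_chain s t : (s <= t)%N ->
  measurable_fun setT (X s : pastType t -> 'cV[R]_d).
Proof.
elim: s => [|s IHs] st.
  by rewrite (_ : X 0%N = cst x0); [exact: measurable_cst|exact/funext].
rewrite (_ : X s.+1 = fun w => A (Y s%:Z w) *m X s w + B (Y s%:Z w) *m eps s.+1 w);
  last exact/funext/XS.
apply: measurable_addmx; apply: measurable_mulmx_cv.
- exact: (measurableT_comp mA (@past_measurable_env t _)).
- by apply: IHs; exact: ltnW.
- exact: (measurableT_comp mB (@past_measurable_env t _)).
- exact: past_measurable_noise.
Qed.

Lemma measurable_chain s : measurable_fun setT (X s).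
Proof. exact: (pastType_measurable (past_measurable_chain (leqnn s))). Qed.

(** Testing against all bounded past-measurable [W] says that [quenched] is the conditional
    expectation of [phi (X (k + n))] given the past at [k]. A weight for time [k] is also one for
    time [k + 1], so induction leaves a single noise to integrate out. *)
Lemma markov_property phi (uphi : unit_valued phi) n k (W : Omega -> R) (K : R) :
  measurable_fun setT (W : pastType k -> R) -> (forall w, `|W w| <= K) ->
  \int[P]_w (W w * phi (X (k + n)%N w)) =
  \int[P]_w (W w * quenched A B nu n k%:Z phi (fun j => Y j w) (X k w)).
Proof.
elim: n k => [|n IHn] k mW WK; first by rewrite addn0.
have {}IHn := IHn k.+1 (pastType_measurable_mono (leqnSn k) mW) WK.
rewrite -addSnnS IHn /=.
pose H (z : pastType k * 'cV[R]_d) := W z.1 *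
  quenched A B nu n (k%:Z + 1) phi (fun j => Y j z.1)
    (A (Y k%:Z z.1) *m X k z.1 + B (Y k%:Z z.1) *m z.2).
have mY j : measurable_fun setT (fun z : pastType k * 'cV[R]_d => Y j z.1).
  exact: (measurableT_comp (@past_measurable_env k j) measurable_fst).
have mH : measurable_fun setT H.
  apply: measurable_funM; first exact: (measurableT_comp mW measurable_fst).
  apply: measurable_quenched => //.
  apply: measurable_addmx; apply: measurable_mulmx_cv.
  - exact: (measurableT_comp mA (mY _)).
  - exact: (measurableT_comp (past_measurable_chain (leqnn k)) measurable_fst).
  - exact: (measurableT_comp mB (mY _)).
  - exact: measurable_snd.
have bH z : `|H z| <= K.
  rewrite /H normrM -[leRHS]mulr1.
  by apply: ler_pM => //; exact: quenched_norm_le1.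
have K1 : k.+1%:Z = k%:Z + 1 by rewrite -addn1 PoszD.
transitivity (\int[P]_w H (w, eps k.+1 w)).
  by apply: eq_Rintegral => w _; rewrite /H /= K1 XS.
rewrite (markov_step mH bH); apply: eq_Rintegral => w _.
by rewrite /H/= RintegralZl//; exact: quenched_step_integrable.
Qed.

End chain.
End markov.

(** * Stationarity on path space *)

Section path_space.
Context d (T : measurableType d).

Definition coordinate_sets : set (set (int -> T)) :=
  [set (fun y : int -> T => y j) @^-1` B | j in setT & B in measurable].

Definition pathType := g_sigma_algebraType coordinate_sets.

Lemma path_measurableE : @path_measurable d T = @measurable _ pathType.
Proof. by []. Qed.

Lemma measurable_coordinate j : measurable_fun setT (fun y : pathType => y j).
Proof.
move=> _ B mB; rewrite setTI; apply: sub_sigma_algebra.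
by exists j => //; exists B.
Qed.

Lemma measurable_path d1 (U : measurableType d1) (f : U -> pathType) :
  (forall j, measurable_fun setT (fun u => f u j)) -> measurable_fun setT f.
Proof.
move=> mf; apply: (@measurability _ _ U pathType setT f coordinate_sets) => //.
move=> _ [_ [j _ [B mB <-]] <-].
exact: (mf j measurableT B mB).
Qed.

Lemma measurable_translation s :
  measurable_fun setT (fun y : pathType => (fun j => y (j + s)) : pathType).
Proof. by apply: measurable_path => j; exact: measurable_coordinate. Qed.

Definition cylinder : set (set pathType) := [set E | exists n B,
  [/\ forall j : int, measurable (B j : set T),
      forall j : int, (n <= `|j|)%N -> B j = setT &
      E = [set y : pathType | forall j, B j (y j)]]].

Lemma cylinder_setI : setI_closed cylinder.
Proof.
move=> _ _ [n [B [mB nB ->]]] [n' [B' [mB' nB' ->]]].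
exists (maxn n n'), (fun j => B j `&` B' j); split.
- by move=> j; exact: measurableI.
- by move=> j; rewrite geq_max => /andP[? ?]; rewrite nB// nB'// setIT.
- apply/seteqP; split => y /=; first by move=> [? ?] j; split.
  by move=> h; split => j; have [] := h j.
Qed.

Lemma cylinder_setT : cylinder setT.
Proof.
by exists 0%N, (fun=> setT); split => //; apply/seteqP; split.
Qed.

(** Enumerates the integers from -n to n, so that a cylinder becomes a condition on a tuple, the
    form in which stationarity is assumed. *)
Definition window (n : nat) (i : 'I_(n.*2.+1)) : int := (i : nat)%:Z - n%:Z.

Lemma windowP n (j : int) : (`|j| < n)%N -> exists i : 'I_(n.*2.+1), window i = j.
Proof.
move=> jn; have jP : (`|(j + n%:Z)%R|%N < n.*2.+1)%N by lia.
exists (Ordinal jP); rewrite /window /=; lia.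
Qed.

Lemma cylinder_windowE n (B : int -> set T) : (forall j, (n <= `|j|)%N -> B j = setT) ->
  [set y : pathType | forall j, B j (y j)] =
  [set y : pathType | forall i : 'I_(n.*2.+1), B (window i) (y (window i))].
Proof.
move=> nB; apply/seteqP; split => y /= h; first by move=> i; exact: h.
move=> j; have [jn|jn] := leqP n `|j|%N; first by rewrite nB.
by have [i <-] := windowP jn; exact: h.
Qed.

Lemma cylinder_measurable : cylinder `<=` measurable.
Proof.
move=> _ [n [B [mB nB ->]]]; rewrite (cylinder_windowE nB).
rewrite (_ : [set _ | _] = \bigcap_(i in [set: 'I_(n.*2.+1)])
   (fun y : pathType => y (window i)) @^-1` B (window i)).
  apply: fin_bigcap_measurable => // i _.
  by rewrite -[X in measurable X]setTI; exact: measurable_coordinate.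
apply/seteqP; split => y /= h; first by move=> i _; exact: h.
by move=> i; exact: h.
Qed.

Lemma cylinder_generates : @measurable _ pathType = <<s cylinder >>.
Proof.
apply/seteqP; split; last first.
  apply: smallest_sub; last exact: cylinder_measurable.
  exact: sigma_algebra_measurable.
apply: smallest_sub; first exact: smallest_sigma_algebra.
move=> _ [j _ [B mB <-]]; apply: sub_sigma_algebra.
exists `|j|.+1, (fun i => if i == j then B else setT); split.
- by move=> i; case: ifP.
- by move=> i ij; case: eqP => // ij'; move: ij; rewrite ij' ltnn.
- apply/seteqP; split => y /=; rewrite /preimage/=.
    by move=> By i; case: eqP => // ->.
  by move=> /(_ j); rewrite eqxx.
Qed.

Section stationary.
Context (R : realType) disp (Omega : measurableType disp)
  (P : probability Omega R) (Y : int -> {RV P >-> T}).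

Lemma measurable_path_of s :
  measurable_fun setT (fun w => (fun j => Y (j + s) w) : pathType).
Proof. by apply: measurable_path => j; exact: measurable_funP. Qed.

Hypothesis Ystat : strictly_stationary Y.

(** Stationarity for finite tuples is equality of the two path laws on cylinders, a pi-system that
    generates the path sigma-algebra. *)
Lemma stationary_path s E : @measurable _ pathType E ->
  P [set w | E (fun j => Y (j + s) w)] = P [set w | E (fun j => Y j w)].
Proof.
move=> mE.
pose m1 : {measure set pathType -> \bar R} := law P (measurable_path_of s).
pose m2 : {measure set pathType -> \bar R} := law P (measurable_path_of 0).
have m2E : m2 E = P [set w | E (fun j => Y j w)].
  rewrite /m2/= /distribution /pushforward/=; congr (P _).
  apply/seteqP; split => w /=; rewrite /preimage/=.
    by rewrite (_ : (fun j => Y (j + 0) w) = (fun j => Y j w))//; apply/funext => j; rewrite addr0.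
  by rewrite (_ : (fun j => Y (j + 0) w) = (fun j => Y j w))//; apply/funext => j; rewrite addr0.
rewrite -m2E -[LHS]/(m1 E).
apply: (measure_unique cylinder (fun=> setT)) => //.
- exact: cylinder_generates.
- exact: cylinder_setI.
- by move=> _; exact: cylinder_setT.
- by rewrite bigcup_const.
- move=> _ [n [B [mB nB ->]]]; rewrite (cylinder_windowE nB).
  pose BT : set (n.*2.+1.-tuple T) := [set u | forall i, B (window i) (tnth u i)].
  have mBT : measurable BT.
    rewrite (_ : BT = \bigcap_(i in [set: 'I_(n.*2.+1)])
        (@tnth _ T ^~ i) @^-1` B (window i)).
      apply: fin_bigcap_measurable => // i _.
      by rewrite -[X in measurable X]setTI; exact: measurable_tnth.
    by apply/seteqP; split => u /= h i; [move=> _|]; exact: h.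
  have E1 r : [set w | BT [tuple Y (window i + r) w | i < n.*2.+1]] =
      (fun w => (fun j => Y (j + r) w) : pathType) @^-1`
      [set y : pathType | forall i : 'I_(n.*2.+1), B (window i) (y (window i))].
    apply/seteqP; split => w; rewrite /preimage/= => h i.
      by have := h i; rewrite tnth_mktuple.
    by rewrite tnth_mktuple; exact: h.
  have st r : P [set w | BT [tuple Y (window i + r) w | i < n.*2.+1]] =
      P [set w | BT [tuple Y (window i) w | i < n.*2.+1]].
    exact: Ystat.
  by have := etrans (st s) (esym (st 0)); rewrite !E1.
- by move=> _; rewrite (le_lt_trans (probability_le1 _ _)) ?ltry.
Qed.

Lemma stationary_Rintegral s (h : pathType -> R) (K : R) :
  measurable_fun setT h -> (forall y, `|h y| <= K) ->
  \int[P]_w h (fun j => Y (j + s) w) = \int[P]_w h (fun j => Y j w).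
Proof.
move=> mh hK.
have E0 : (fun w => h (fun j => Y j w)) = (fun w => h (fun j => Y (j + 0) w)).
  apply/funext => w; congr h; apply/funext => j; by rewrite addr0.
rewrite E0 -(Rintegral_law (measurable_path_of s) mh); last first.
  apply: (@bounded_integrable _ _ _ _ _ K) => [|w]; last exact: hK.
  exact: (measurableT_comp mh (measurable_path_of s)).
rewrite -(Rintegral_law (measurable_path_of 0) mh); last first.
  apply: (@bounded_integrable _ _ _ _ _ K) => [|w]; last exact: hK.
  exact: (measurableT_comp mh (measurable_path_of 0)).
rewrite /Rintegral; congr fine; apply: eq_measure_integral => E mE _.
have := stationary_path s mE; have := stationary_path 0 mE => <-.
exact.
Qed.

End stationary.
End path_space.

(** * Minorization of the noise *)

Section minorization.
Context (R : realType) (d : nat).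

Lemma cv_ball_box (c : 'cV[R]_d) (r : R) : 0 <= r ->
  [set v : 'cV[R]_d | `|v - c| <= r] =
  [set v : 'cV[R]_d | forall i, v i ord0 \in
     `[(\col_i (c i ord0 - r)) i ord0, (\col_i (c i ord0 + r)) i ord0]].
Proof.
move=> r0; apply/seteqP; split => v /= h.
  move=> i; rewrite !mxE in_itv/= -ler_distl.
  apply: le_trans h; have := cv_coord_le (v - c) i; by rewrite !mxE.
apply: cv_norm_le => // i; have := h i.
by rewrite !mxE in_itv/= -ler_distl.
Qed.

Lemma measurable_cv_ball (c : 'cV[R]_d) (r : R) :
  measurable [set v : 'cV[R]_d | `|v - c| <= r].
Proof.
have mn : measurable_fun setT (fun v : 'cV[R]_d => `|v + (- c)|).
  apply: (measurableT_comp (@measurable_normmx R d)).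
  by apply: measurable_addmx; [exact: measurable_id|exact: measurable_cst].
rewrite (_ : [set _ | _] = (fun v : 'cV[R]_d => `|v + (- c)|) @^-1` `]-oo, r]%classic).
  by rewrite -[X in measurable X]setTI; apply: mn => //; exact: measurable_itv.
by apply/seteqP; split => v; rewrite /preimage/= in_itv.
Qed.

Lemma cv_lebesgue_unit_ball :
  cv_lebesgue [set v : 'cV[R]_d | `|v - 0| <= 1] = (2 ^+ d)%:E.
Proof.
rewrite cv_ball_box// cv_lebesgue_box; last first.
  by move=> i; rewrite !mxE lerD2l; lra.
congr EFin; rewrite (eq_bigr (fun=> 2)); last by move=> i _; rewrite !mxE; lra.
by rewrite prodr_const card_ord.
Qed.

Lemma compact_cv_ball (r : R) : 0 <= r ->
  compact [set v : 'cV[R]_d | `|v - 0| <= r].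
Proof.
move=> r0.
rewrite (_ : [set _ | _] = (@trmx R 1 d) @`
    [set u : 'rV[R]_d | forall i, `[- r, r]%classic (u ord0 i)]).
  apply: continuous_compact; last first.
    exact: (@rV_compact R d (fun=> `[- r, r]%classic) (fun i => @segment_compact R (- r) r)).
  apply: continuous_subspaceT => u /= U [A hA AU].
  exists (fun i j => A j i); first by move=> i j; have := hA j i; rewrite mxE.
  by move=> v hv; apply: AU => i j; rewrite mxE.
apply/seteqP; split => v /=; rewrite subr0.
  move=> h; exists v^T; last by rewrite trmxK.
  move=> i; rewrite mxE in_itv/= -ler_norml.
  exact: le_trans (cv_coord_le _ _) h.
move=> [u hu <-]; apply: cv_norm_le => // i.
by have := hu i; rewrite mxE in_itv/= -ler_norml.
Qed.

Variables (nu : probability 'cV[R]_d R) (f : 'cV[R]_d -> R).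
Hypotheses (f_meas : measurable_fun setT f) (f_ge0 : forall x, 0 <= f x).
Hypothesis f_density : forall E : set 'cV[R]_d, measurable E ->
   nu E = (\int[@cv_lebesgue R d]_(x in E) (f x)%:E)%E.
Hypothesis f_bnd_away : forall K : set 'cV[R]_d, compact K ->
  exists2 delta : R, 0 < delta &
    {ae @cv_lebesgue R d, forall x, K x -> delta <= f x}.

(** [ka1] is [del] times Lebesgue measure on the unit ball and [ka2] its translate by [v]. Both live
    in the ball of radius [1 + r], where the density is almost everywhere at least [del]; the common
    mass does not depend on [v]. *)
Lemma density_minorization (r : R) : 0 <= r ->
  exists alpha : R, [/\ 0 < alpha, alpha < 1 &
   forall v : 'cV[R]_d, `|v| <= r ->
    exists ka1 ka2 : {finite_measure set 'cV[R]_d -> \bar R},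
      [/\ forall E, measurable E -> (ka1 E <= nu E)%E,
          forall E, measurable E -> (ka2 E <= nu E)%E,
          ka1 setT = alpha%:E, ka2 setT = alpha%:E &
          forall h : 'cV[R]_d -> R, measurable_fun setT h ->
            (forall e, `|h e| <= 1) ->
            \int[ka1]_e h (e + v) = \int[ka2]_e h e]].
Proof.
move=> r0.
have [delta delta0 fdelta] := f_bnd_away (compact_cv_ball (addr_ge0 ler01 r0)).
(* The second term forces [alpha], which is [del] times the volume 2^d of the ball, to be at most
   1/2. *)
pose del := Num.min delta (2 ^- d.+1).
have del0 : 0 < del by rewrite lt_min delta0 invr_gt0 exprn_gt0.
have domin (E S : set 'cV[R]_d) : measurable E -> measurable S ->
    (forall v, S v -> `|v - 0| <= 1 + r) ->
    (del%:E * @cv_lebesgue R d (E `&` S) <= nu E)%E.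
  move=> mE mS SK.
  rewrite -integral_cst; last exact: measurableI.
  rewrite f_density//; apply: (@le_trans _ _ (\int[@cv_lebesgue R d]_(x in E `&` S) (f x)%:E)%E).
    apply: ae_ge0_le_integral => //.
    - exact: measurableI.
    - by move=> x _; rewrite lee_fin ltW.
    - by move=> x _; rewrite lee_fin.
    - by apply/measurable_EFinP; exact: measurable_funTS.
    - move: fdelta; apply: filterS => x hx [_ /SK/hx hd].
      by rewrite lee_fin (le_trans _ hd)// ge_min lexx.
  apply: ge0_subset_integral => //.
  - exact: measurableI.
  - by apply/measurable_EFinP; exact: measurable_funTS.
  - by move=> x _; rewrite lee_fin.
pose S0 := [set v : 'cV[R]_d | `|v - 0| <= 1].
have mS0 : measurable S0 by exact: measurable_cv_ball.
pose m1 : {measure set 'cV[R]_d -> \bar R} :=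
  mscale (NngNum (ltW del0)) (mrestr (@cv_lebesgue R d) mS0).
have m1E E : m1 E = (del%:E * @cv_lebesgue R d (E `&` S0))%E by [].
have m1le E : measurable E -> (m1 E <= nu E)%E.
  move=> mE; rewrite m1E; apply: domin => // v /le_trans; apply.
  by rewrite lerDl.
have nufin E : measurable E -> (nu E < +oo)%E.
  by move=> mE; rewrite (le_lt_trans (probability_le1 _ _)) ?ltry.
have fin1 : fin_num_fun m1.
  move=> E mE; rewrite ge0_fin_numE; last exact: measure_ge0.
  exact: le_lt_trans (m1le E mE) (nufin E mE).
pose k1 : {finite_measure set 'cV[R]_d -> \bar R} :=
  HB.pack (Measure.sort m1) (@Measure_isFinite.Build _ _ _ m1 fin1).
pose alpha := del * 2 ^+ d.
have k1T : m1 setT = alpha%:E.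
  by rewrite m1E setTI cv_lebesgue_unit_ball EFinM.
have pw0 : 0 < 2 ^+ d :> R by rewrite exprn_gt0.
have alpha_half : alpha <= 2^-1.
  apply: (@le_trans _ _ (2 ^- d.+1 * 2 ^+ d)).
    by rewrite ler_wpM2r ?(ltW pw0)// ge_min lexx orbT.
  by rewrite exprS invfM mulfVK// gt_eqF.
exists alpha; split.
- by rewrite mulr_gt0.
- by apply: (le_lt_trans alpha_half); lra.
move=> v vr.
have mv : measurable_fun setT (fun e : 'cV[R]_d => e + v).
  by apply: measurable_addmx; [exact: measurable_id|exact: measurable_cst].
pose m2 : {measure set 'cV[R]_d -> \bar R} :=
  measure_function_pushforward__canonical__measure_function_Measure k1 mv.
have m2E E : m2 E = m1 ((fun e => e + v) @^-1` E) by [].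
have m2le E : measurable E -> (m2 E <= nu E)%E.
  move=> mE; rewrite m2E m1E.
  pose S := [set e : 'cV[R]_d | `|e - v| <= 1].
  have mS : measurable S by exact: measurable_cv_ball.
  have -> : (fun e => e + v) @^-1` E `&` S0 = [set e | (E `&` S) (e + v)].
    by apply/seteqP; split => e; rewrite /S0 /S /preimage/= subr0 addrK.
  rewrite (cv_lebesgue_translate v (measurableI _ _ mE mS)).
  apply: domin => // e; rewrite /S/= subr0 => ev.
  rewrite -(subrK v e) (le_trans (ler_normD _ _))// lerD//.
have fin2 : fin_num_fun m2.
  move=> E mE; rewrite ge0_fin_numE; last exact: measure_ge0.
  exact: le_lt_trans (m2le E mE) (nufin E mE).
pose k2 : {finite_measure set 'cV[R]_d -> \bar R} :=
  HB.pack (Measure.sort m2) (@Measure_isFinite.Build _ _ _ m2 fin2).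
exists k1, k2; split => //.
move=> h mh h1; rewrite /Rintegral; congr fine; apply/esym.
have := @integral_pushforward _ _ _ _ R _ mv k1 setT (EFin \o h) _ _ measurableT.
apply; first exact/measurable_EFinP.
apply: (@bounded_integrable _ _ _ k1 (fun e => h (e + v)) 1) => [|e]; last exact: h1.
exact: (measurableT_comp mh mv).
Qed.

End minorization.

(** * The mean ergodic theorem *)

Section ergodic.
Context (R : realType) d (T : measurableType d) (Q : probability T R)
  (S : T -> T).
Hypothesis mS : measurable_fun setT S.
Hypothesis SQ : forall E, measurable E -> Q (S @^-1` E) = Q E.

Lemma invariant_Rintegral (h : T -> R) (K : R) :
  measurable_fun setT h -> (forall x, `|h x| <= K) ->
  \int[Q]_x h (S x) = \int[Q]_x h x.
Proof.
move=> mh hK; rewrite -(Rintegral_law mS mh); last first.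
  apply: (@bounded_integrable _ _ _ _ _ K) => [|w]; last exact: hK.
  exact: measurableT_comp.
rewrite /Rintegral; congr fine; apply: eq_measure_integral => E mE _.
exact: SQ.
Qed.

Lemma bounded_cvg_Rintegral (g : nat -> T -> R) (h : T -> R) (N : set T) (K : R) :
  (forall n, measurable_fun setT (g n)) -> measurable_fun setT h ->
  (forall n x, `|g n x| <= K) -> (forall x, `|h x| <= K) ->
  measurable N -> Q N = 0%E -> (forall x, ~ N x -> g ^~ x @ \oo --> h x) ->
  (fun n => \int[Q]_x g n x) @ \oo --> \int[Q]_x h x.
Proof.
move=> mg mh gK hK mN N0 gh.
have ih := integrable_fin_num measurableT (bounded_integrable Q mh hK).
have : (fun n => \int[Q]_x (g n x)%:E)%E @ \oo --> (\int[Q]_x h x)%R%:E.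
  rewrite fineK//.
  have [] // := @dominated_convergence _ _ _ Q setT measurableT
    (fun n => EFin \o g n) (EFin \o h) (cst K%:E).
  - by move=> n; exact/measurable_EFinP.
  - exact/measurable_EFinP.
  - exists N; split => // x /= Hx; apply: contrapT => Nx; apply: Hx => _.
    by apply: cvg_EFin; [exact: nearW|exact: gh].
  - exact: finite_measure_integrable_cst.
  - by apply/aeW => x n _; rewrite lee_fin; exact: gK.
by move=> /fine_cvgP[].
Qed.

Definition birkhoff (h : T -> R) n x := \sum_(0 <= k < n) h (iter k S x).

Lemma birkhoffS h n x : birkhoff h n.+1 x = h x + birkhoff h n (S x).
Proof.
rewrite /birkhoff big_nat_recl//; congr (_ + _).
by apply: eq_bigr => k _; rewrite iterSr.
Qed.

Lemma birkhoff_le (h : T -> R) (K : R) n x : (forall x, `|h x| <= K) ->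
  `|birkhoff h n x| <= n%:R * K.
Proof.
move=> hK; apply: (le_trans (ler_norm_sum _ _ _)).
apply: (@le_trans _ _ (\sum_(0 <= k < n) K)); first exact: ler_sum.
by rewrite sumr_const_nat subn0 mulr_natl.
Qed.

Lemma measurable_iter k : measurable_fun setT (iter k S).
Proof.
elim: k => [|k IHk] /=; first exact: measurable_id.
exact: (measurableT_comp mS IHk).
Qed.

Lemma measurable_birkhoff h n : measurable_fun setT h ->
  measurable_fun setT (birkhoff h n).
Proof.
move=> mh; apply: measurable_sum => k.
exact: (measurableT_comp mh (measurable_iter k)).
Qed.

(** The maximum of the Birkhoff sums of lengths 0 to n. The recursive form is the identity on which
    Garsia's argument rests. *)
Fixpoint birkhoff_max (h : T -> R) n x : R :=
  match n with
  | 0 => 0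
  | n'.+1 => Num.max 0 (h x + birkhoff_max h n' (S x))
  end.

Lemma birkhoff_max_ge0 h n x : 0 <= birkhoff_max h n x.
Proof. by case: n => [|n] //=; rewrite le_max lexx. Qed.

Lemma birkhoff_max_nd h n x : birkhoff_max h n x <= birkhoff_max h n.+1 x.
Proof.
elim: n x => [|n IHn] x; first exact: birkhoff_max_ge0.
rewrite /= ge_max !le_max lexx /=; apply/orP; right.
by rewrite lerD2l; exact: IHn.
Qed.

Lemma birkhoff_le_max h n x : birkhoff h n x <= birkhoff_max h n x.
Proof.
elim: n x => [|n IHn] x; first by rewrite /birkhoff big_geq.
by rewrite birkhoffS /= le_max lerD2l IHn orbT.
Qed.

Lemma birkhoff_max_bound (h : T -> R) (K : R) n x : (forall x, `|h x| <= K) ->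
  birkhoff_max h n x <= n%:R * K.
Proof.
move=> hK; have K0 : 0 <= K by apply: le_trans (hK x).
elim: n x => [|n IHn] x /=; first by rewrite mul0r.
rewrite ge_max mulr_ge0//= -natr1 mulrDl mul1r addrC.
by rewrite lerD// (le_trans (ler_norm _) (hK x)).
Qed.

Lemma measurable_birkhoff_max h n : measurable_fun setT h ->
  measurable_fun setT (birkhoff_max h n).
Proof.
move=> mh; elim: n => [|n IHn] /=; first exact: measurable_cst.
apply: measurable_maxr => //; apply: measurable_funD => //.
exact: (measurableT_comp IHn mS).
Qed.

(** Garsia's proof. Where the maximum is positive it equals [h] plus the previous maximum after [S];
    elsewhere it is 0, at most that previous maximum. So the integrand dominates a difference whose
    integral is nonnegative by invariance and monotonicity in [n]. *)
Lemma maximal_ergodic (h : T -> R) (K : R) n :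
  measurable_fun setT h -> (forall x, `|h x| <= K) ->
  0 <= \int[Q]_x (if 0 < birkhoff_max h n x then h x else 0).
Proof.
move=> mh hK; case: n => [|n].
  by apply: Rintegral_ge0 => x _; rewrite /= ltxx.
have bM k x : `|birkhoff_max h k x| <= k%:R * K.
  by rewrite ger0_norm ?birkhoff_max_ge0 ?birkhoff_max_bound.
have mM k := @measurable_birkhoff_max h k mh.
have iM k := bounded_integrable Q (mM k) (bM k).
have iMS : Q.-integrable setT (EFin \o (fun x => birkhoff_max h n (S x))).
  apply: (@bounded_integrable _ _ _ _ _ (n%:R * K)) => [|x]; last exact: bM.
  exact: (measurableT_comp (mM n) mS).
have K0 : 0 <= K by apply: le_trans (hK point).
apply: (@le_trans _ _ (\int[Q]_x (birkhoff_max h n.+1 x - birkhoff_max h n (S x)))).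
  rewrite RintegralB// (@invariant_Rintegral (birkhoff_max h n) (n%:R * K))//.
  rewrite subr_ge0; apply: le_Rintegral => // x _.
  exact: birkhoff_max_nd.
apply: le_Rintegral => //; first exact: integrable_subR.
  apply: (@bounded_integrable _ _ _ _ _ K) => [|x]; last by case: ifP => // _; rewrite normr0.
  apply: measurable_fun_ifT => //.
  by apply: measurable_fun_ltr => //; exact: measurable_cst.
move=> x _; case: ltP => [|M0].
  by rewrite /= lt_max ltxx /= => hp; rewrite max_r ?addrK// ltW.
have -> : birkhoff_max h n.+1 x = 0.
  by apply/le_anti; rewrite M0 birkhoff_max_ge0.
by rewrite sub0r oppr_le0 birkhoff_max_ge0.
Qed.

Hypothesis Serg : forall E, measurable E -> S @^-1` E = E -> Q E = 0%E \/ Q E = 1%E.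

(** The event that the Birkhoff sums are unbounded above. For bounded [h] it is strictly invariant
    under [S], not only up to null sets, as the ergodicity hypothesis demands. *)
Definition unbounded_sums (h : T -> R) : set T :=
  [set x | forall k : nat, exists n, k%:R < birkhoff h n x].

Lemma measurable_unbounded_sums h : measurable_fun setT h ->
  measurable (unbounded_sums h).
Proof.
move=> mh.
rewrite (_ : unbounded_sums h = \bigcap_k \bigcup_n
  (birkhoff h n @^-1` [set r | k%:R < r])).
  apply: bigcap_measurable => // k _; apply: bigcup_measurable => n _.
  rewrite -[X in measurable X]setTI; apply: measurable_birkhoff => //.
  rewrite (_ : [set r | _] = `]k%:R, +oo[%classic); first exact: measurable_itv.
  by rewrite set_itvE.
by apply/seteqP; split => x h' k => [_|]; have := h' k; [case=> n; exists n|case=> // n; exists n].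
Qed.

Lemma unbounded_sums_invariant (h : T -> R) (K : R) : (forall x, `|h x| <= K) ->
  S @^-1` unbounded_sums h = unbounded_sums h.
Proof.
move=> hK; apply/seteqP; split => x /= Hx k.
  have [n] := Hx (k + Num.truncn K).+1; rewrite /preimage/= => Hn.
  exists n.+1; rewrite birkhoffS.
  have := hK x; rewrite ler_norml => /andP[h1 _].
  have := truncnS_gt K; move: Hn; rewrite -natr1 natrD -natr1; lra.
have [n] := Hx (k + Num.truncn K).+1.
have K0 : 0 <= K by apply: le_trans (hK x).
have := truncnS_gt K; rewrite -natr1 -natr1 natrD => hK1.
case: n => [|n]; first by rewrite /birkhoff big_geq//; have := ler0n R k; lra.
rewrite birkhoffS => Hn; exists n.
have := hK x; rewrite ler_norml => /andP[_ h2]; lra.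
Qed.

(** On this event the maxima are eventually positive, so the integrands of the maximal inequality
    converge to [h], and the inequality passes to the limit. *)
Lemma unbounded_sums_Rintegral (h : T -> R) (K : R) :
  measurable_fun setT h -> (forall x, `|h x| <= K) ->
  Q (unbounded_sums h) = 1%E -> 0 <= \int[Q]_x h x.
Proof.
move=> mh hK Q1.
pose g n x := if 0 < birkhoff_max h n x then h x else 0.
have mU := measurable_unbounded_sums mh.
have mg n : measurable_fun setT (g n).
  apply: measurable_fun_ifT => //; apply: measurable_fun_ltr => //.
  exact: measurable_birkhoff_max.
have bg n x : `|g n x| <= K.
  by rewrite /g; case: ifP => // _; rewrite normr0 (le_trans _ (hK x)).
have cg : (fun n => \int[Q]_x g n x) @ \oo --> \int[Q]_x h x.
  apply: (@bounded_cvg_Rintegral g h (~` unbounded_sums h) K) => //.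
  - exact: measurableC.
  - by have := probability_setC Q mU; rewrite Q1 subee.
  - move=> x /contrapT Ux; have [n Hn] := Ux 0%N.
    apply: cvg_near_cst; exists n => // k /= nk; rewrite /g.
    suff -> : 0 < birkhoff_max h k x by [].
    apply: (lt_le_trans Hn); apply: (le_trans (birkhoff_le_max _ _ _)).
    elim: k nk => [|k IHk]; first by rewrite leqn0 => /eqP ->.
    rewrite leq_eqVlt => /predU1P[->//|nk].
    exact: le_trans (IHk nk) (birkhoff_max_nd _ _ _).
rewrite -(cvg_lim (@Rhausdorff R) cg); apply: limr_ge.
  by apply/cvg_ex; exists (\int[Q]_x h x).
by apply: nearW => n; exact: maximal_ergodic hK.
Qed.

Lemma birkhoff_Rintegral (h : T -> R) (K : R) n :
  measurable_fun setT h -> (forall x, `|h x| <= K) ->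
  \int[Q]_x birkhoff h n x = n%:R * \int[Q]_x h x.
Proof.
move=> mh hK; have ih := bounded_integrable Q mh hK.
have mb k := measurable_birkhoff k mh.
have bb k x := birkhoff_le k x hK.
have ib k := bounded_integrable Q (mb k) (bb k).
elim: n => [|n IHn].
  rewrite mul0r -[RHS](probability_Rintegral_cst Q).
  by apply: eq_Rintegral => x _; rewrite /birkhoff big_geq.
transitivity (\int[Q]_x (h x + birkhoff h n (S x))).
  by apply: eq_Rintegral => x _; exact: birkhoffS.
rewrite RintegralD//; last first.
  apply: (@bounded_integrable _ _ _ _ _ (n%:R * K)) => [|x]; last exact: bb.
  exact: (measurableT_comp (mb n) mS).
rewrite (@invariant_Rintegral (birkhoff h n) (n%:R * K))// IHn -natr1; ring.
Qed.

(** An upper bound suffices: the averages r have mean [c0], and |r - c0| is twice the positive part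
    of r - c0 minus r - c0 itself, whose integral vanishes. *)
Lemma mean_ergodic (h : T -> R) (K : R) :
  measurable_fun setT h -> (forall x, `|h x| <= K) ->
  (fun n => \int[Q]_x `|birkhoff h n x / n%:R - \int[Q]_x h x|) @ \oo --> (0 : R).
Proof.
move=> mh hK; set c0 := \int[Q]_x h x.
have K0 : 0 <= K by apply: le_trans (hK point).
have ih := bounded_integrable Q mh hK.
have mb k := measurable_birkhoff k mh.
have bb k x := birkhoff_le k x hK.
have c0K : `|c0| <= K by exact: probability_Rintegral_bound.
have bA n x : `|birkhoff h n x / n%:R| <= K.
  case: n => [|n]; first by rewrite invr0 mulr0 normr0.
  rewrite normrM normfV ler_pdivrMr ?normr_gt0// mulrC.
  by rewrite (ger0_norm (ler0n _ _)); exact: bb.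
have mAn n : measurable_fun setT (fun x => birkhoff h n x / n%:R).
  exact: measurable_funM.
apply/cvgrPdist_le => eps eps0.
(* Centering slightly above the mean gives [hc] a negative integral; the sums of [hc] are then
   almost surely bounded above, and the positive part of the average minus [c] tends to 0. *)
pose c := c0 + eps / 4.
have e40 : 0 < eps / 4 by rewrite divr_gt0.
pose hc x := h x - c.
have mhc : measurable_fun setT hc by exact: measurable_funB.
have bhc x : `|hc x| <= K + `|c| by rewrite (le_trans (ler_normB _ _))// lerD.
have U0 : Q (unbounded_sums hc) = 0%E.
  have [//|Q1] := Serg (measurable_unbounded_sums mhc) (unbounded_sums_invariant bhc).
  have : \int[Q]_x hc x < 0.
    rewrite /hc RintegralB//; last exact: finite_measure_integrable_cst.
    by rewrite probability_Rintegral_cst -/c0 /c; lra.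
  by rewrite ltNge (unbounded_sums_Rintegral mhc bhc Q1).
pose p n x := Num.max 0 (birkhoff h n x / n%:R - c).
have mp n : measurable_fun setT (p n).
  by apply: measurable_maxr => //; exact: measurable_funB.
have bp n x : `|p n x| <= K + `|c|.
  rewrite (@ger0_norm _ (p n x)); last by rewrite /p le_max lexx.
  rewrite /p ge_max addr_ge0//=.
  by rewrite (le_trans (ler_norm _))// (le_trans (ler_normB _ _))// lerD.
have birkhoff_sub n x : birkhoff hc n x = birkhoff h n x - n%:R * c.
  by rewrite /birkhoff /hc sumrB sumr_const_nat subn0 mulr_natl.
have : (fun n => \int[Q]_x p n x) @ \oo --> \int[Q]_x (0 : R).
  apply: (@bounded_cvg_Rintegral p (fun=> 0) (unbounded_sums hc) (K + `|c|)) => //.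
  - by move=> x; rewrite normr0 addr_ge0.
  - exact: measurable_unbounded_sums.
  - move=> x /existsNP[k nk].
    have bk n : birkhoff h n x - n%:R * c <= k%:R.
      by rewrite leNgt -birkhoff_sub; apply/negP => hh; apply: nk; exists n.
    apply/cvgrPdist_le => e e0.
    exists (Num.truncn (k%:R / e)).+1 => // n /= kn.
    have n0 : 0 < n%:R :> R by rewrite ltr0n (leq_trans _ kn).
    rewrite sub0r normrN ger0_norm; last by rewrite /p le_max lexx.
    rewrite /p ge_max (ltW e0)/=.
    rewrite -(ler_pM2r n0) mulrBl mulfVK ?gt_eqF// (mulrC c).
    apply: (le_trans (bk n)); rewrite mulrC -ler_pdivrMr//.
    apply: (le_trans (ltW (truncnS_gt _))); rewrite ler_nat//.
rewrite probability_Rintegral_cst => /cvgrPdist_le /(_ _ e40) [N _ HN].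
exists N.+1 => // n /= Nn; rewrite sub0r normrN ger0_norm ?Rintegral_ge0//.
have := HN n (ltnW Nn); rewrite /= sub0r normrN ger0_norm; last first.
  by apply: Rintegral_ge0 => x _; rewrite /p le_max lexx.
move=> pn.
have ip := bounded_integrable Q (mp n) (bp n).
have iA := bounded_integrable Q (mAn n) (bA n).
have ic (r : R) : Q.-integrable setT (EFin \o (fun=> r)).
  exact: finite_measure_integrable_cst.
have EA : \int[Q]_x (birkhoff h n x / n%:R) = c0.
  rewrite RintegralZr//; last exact: (bounded_integrable Q (mb n) (bb n)).
  rewrite (@birkhoff_Rintegral h K)// mulrAC mulfV ?mul1r//.
  by rewrite gt_eqF// ltr0n (leq_trans _ Nn).
have i1 : Q.-integrable setT (EFin \o (fun x => 2 * p n x + (2 * (eps / 4) + c0))).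
  by apply: integrable_addR; [exact: integrable_scaleR|exact: ic].
(* The positive part of r - c0 is at most [p] plus [eps / 4]; the two halves of [eps] come from this
   correction and from [pn]. *)
apply: (@le_trans _ _ (\int[Q]_x (2 * p n x + (2 * (eps / 4) + c0) - birkhoff h n x / n%:R))).
  apply: le_Rintegral => //.
  - apply: (@bounded_integrable _ _ _ _ _ (K + K)) => [|x].
      by apply: measurableT_comp => //; exact: measurable_funB.
    by rewrite normr_id (le_trans (ler_normB _ _))// lerD.
  - exact: integrable_subR.
  - move=> x _; rewrite /p; set r := birkhoff h n x / n%:R.
    by rewrite ler_norml; case: (lerP 0 (r - c)); rewrite /c => ?; apply/andP; split; lra.
rewrite RintegralB// RintegralD//; last exact: integrable_scaleR.
rewrite RintegralZl// probability_Rintegral_cst EA; lra.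
Qed.

End ergodic.

(** * Rate of forgetting the initial state *)

Section moments.
Context (R : realType) (m d : nat) (disp : measure_display)
  (Omega : measurableType disp) (P : probability Omega R).
Variables (A : 'cV[R]_m -> 'M[R]_d) (Y : int -> {RV P >-> 'cV[R]_m}).
Hypotheses (hd : (1 <= d)%N) (mA : measurable_fun setT A)
  (Ystat : strictly_stationary Y).

Lemma cocycle_lower (Kinv : R) y s n (v : 'cV[R]_d) : 0 <= Kinv ->
  (forall z, A z \in unitmx) -> (forall z, op_norm (invmx (A z)) <= Kinv) ->
  eucl_norm v <= Kinv ^+ n * eucl_norm (cocycle A y s n *m v).
Proof.
move=> K0 uA AK; elim: n s v => [|n IHn] s v /=.
  by rewrite expr0 mul1r mul1mx.
apply: (le_trans (op_norm_inv_ge v (mulVmx (uA (y s))))).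
rewrite exprS -mulrA; apply: ler_pM; rewrite ?op_norm_ge0 ?eucl_norm_ge0//.
by rewrite -mulmxA; exact: IHn.
Qed.

(** Tested on a nonzero vector, which [hd] provides. This lower bound makes the logarithms of the
    block norms bounded. *)
Lemma op_norm_cocycle_ge (Kinv : R) y s n : 0 < Kinv ->
  (forall z, A z \in unitmx) -> (forall z, op_norm (invmx (A z)) <= Kinv) ->
  Kinv ^- n <= op_norm (cocycle A y s n).
Proof.
move=> K0 uA AK; pose v : 'cV[R]_d := const_mx 1.
have v0 : 0 < eucl_norm v.
  rewrite lt_neqAle eucl_norm_ge0 andbT eq_sym; apply/eqP => /eucl_norm_eq0 v0.
  have := congr1 (fun u : 'cV[R]_d => u (Ordinal hd) ord0) v0.
  by rewrite !mxE => /eqP; rewrite oner_eq0.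
have K0n : 0 < Kinv ^+ n by rewrite exprn_gt0.
rewrite -(ler_pM2r v0); apply: le_trans (eucl_mulmx_le _ _).
rewrite -(ler_pM2l K0n) mulVKf ?gt_eqF//.
exact: cocycle_lower (ltW K0) uA AK.
Qed.

Variables (a : R).
Hypotheses (a0 : 0 < a).

Lemma measurable_contraction L s du (U : measurableType du)
    (y : U -> int -> 'cV[R]_m) :
  (forall j, measurable_fun setT (fun u => y u j)) ->
  measurable_fun setT (fun u => contraction A a L (y u) s).
Proof.
move=> my; apply: (measurableT_comp (measurable_powR a)).
apply: measurable_funM; first exact: measurable_cst.
apply: (measurableT_comp (@measurable_op_norm R d)).
exact: measurable_cocycle.
Qed.

Lemma contraction_bounded (KA : R) L y s : 0 <= KA ->
  (forall z, op_norm (A z) <= KA) ->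
  `|contraction A a L y s| <= (d%:R * KA ^+ L) `^ a.
Proof.
move=> K0 AK; rewrite ger0_norm ?powR_ge0//.
apply: ge0_ler_powR; rewrite ?nnegrE ?mulr_ge0 ?op_norm_ge0 ?exprn_ge0//.
  exact: ltW.
by rewrite ler_wpM2l// cocycle_bound.
Qed.

Lemma contraction_shift L y s : contraction A a L y (1 + s) =
  contraction A a L (fun j => y (j + s)) 1.
Proof. by rewrite /contraction cocycle_shift. Qed.

Lemma contraction_stationary (KA : R) L s : 0 <= KA ->
  (forall z, op_norm (A z) <= KA) ->
  \int[P]_w contraction A a L (fun j => Y j w) s =
  \int[P]_w contraction A a L (fun j => Y j w) 1.
Proof.
move=> KA0 AK; pose h (y : pathType 'cV[R]_m) := contraction A a L y 1.
have mh : measurable_fun setT h.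
  by apply: measurable_contraction => // j; exact: measurable_coordinate.
have hK y : `|h y| <= (d%:R * KA ^+ L) `^ a by exact: contraction_bounded.
apply: etrans (stationary_Rintegral Ystat (s - 1) mh hK).
apply: eq_Rintegral => w _.
by rewrite /h; have := contraction_shift L (fun j => Y j w) (s - 1); rewrite addrC subrK.
Qed.

End moments.

Lemma cocycle_prod_le (R : realType) (m d : nat) (A : 'cV[R]_m -> 'M[R]_d) (a : R)
    (y : int -> 'cV[R]_m) p n : 0 < a ->
  op_norm (cocycle A y 1 (n * p)) `^ a <=
  \prod_(1 <= i < n.+1) op_norm (cocycle A y (1 + (i.-1 * p)%N%:Z) p) `^ a.
Proof.
move=> a0; elim: n => [|n IHn].
  rewrite big_geq// mul0n -(powR1E a); apply: ge0_ler_powR;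
    rewrite ?nnegrE ?op_norm_ge0//; [exact: ltW|exact: op_norm1].
rewrite big_nat_recr//= mulSn addnC cocycleD.
set c := cocycle A y 1 (n * p) in IHn *; set c' := cocycle A y (1 + _) p.
apply: (@le_trans _ _ ((op_norm c' * op_norm c) `^ a)).
  apply: ge0_ler_powR; rewrite ?nnegrE ?mulr_ge0 ?op_norm_ge0//; first exact: ltW.
  exact: op_norm_mulmx.
rewrite (powRM _ (op_norm_ge0 c') (op_norm_ge0 c)) [leRHS]mulrC.
by apply: ler_wpM2l; [exact: powR_ge0|exact: IHn].
Qed.

Section contraction_moment.
Context (R : realType) (m d : nat) (disp : measure_display)
  (Omega : measurableType disp) (P : probability Omega R).
Variables (A : 'cV[R]_m -> 'M[R]_d) (Y : int -> {RV P >-> 'cV[R]_m}).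
Hypotheses (hd : (1 <= d)%N) (mA : measurable_fun setT A)
  (Ystat : strictly_stationary Y).

(** The blocks in [Gamma_lim] begin at time 1; stationarity carries the bound to every starting time
    [s]. Submultiplicativity passes from the product of block norms to the norm of the product, and
    the factor [d] in [contraction] contributes d^a. *)
Lemma contraction_moment (KA Kinv : R) (p : nat) (eta : R) (Gamma : R -> R) :
  0 <= KA -> 0 < Kinv -> (forall z, op_norm (A z) <= KA) ->
  (forall z, A z \in unitmx) -> (forall z, op_norm (invmx (A z)) <= Kinv) ->
  ('E_P[fun w => ln (op_norm (block_prod A (fun t => Y t w) p 1))] < 0)%E ->
  0 < eta -> (forall a, - eta < a < eta -> derivable Gamma a 1) ->
  (forall a, - eta < a < eta ->
       (fun n : nat => ((n%:R^-1)%:E * lne 'E_P[fun w =>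
          (\prod_(1 <= i < n.+1)
             op_norm (block_prod A (fun t => Y t w) p i) `^ a)%R])%E)
         @ \oo --> (Gamma a)%:E) ->
  exists a C rho : R, [/\ 0 < a, a <= 1, 0 < C, 0 < rho < 1 & forall (n : nat) s,
    \int[P]_w contraction A a (n * p) (fun j => Y j w) s <= C * rho ^+ n].
Proof.
move=> KA0 K0 AK uA AinvK contr eta0 dG Glim.
have [Z ZD] : exists Z : nat -> Omega -> R, forall i w,
    Z i w = op_norm (cocycle A (fun j => Y j w) (1 + (i.-1 * p)%N%:Z) p).
  by exists (fun i w => op_norm (cocycle A (fun j => Y j w) (1 + (i.-1 * p)%N%:Z) p)).
have ZE i w : (0 < i)%N ->
    op_norm (block_prod A (fun t => Y t w) p i) = Z i w.
  by move=> i0; rewrite ZD cocycle_block_prod.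
have mY j : measurable_fun setT (fun w => Y j w) by exact: measurable_funP.
have mZ i : measurable_fun setT (Z i).
  rewrite (_ : Z i = fun w => op_norm (cocycle A (fun j => Y j w) (1 + (i.-1 * p)%N%:Z) p)).
    by apply: (measurableT_comp (@measurable_op_norm R d)); exact: measurable_cocycle.
  by apply/funext => w; exact: ZD.
have k0 : 0 < Kinv ^- p by rewrite invr_gt0 exprn_gt0.
have ck y s : Kinv ^- p <= op_norm (cocycle A y s p) <= KA ^+ p.
  by rewrite op_norm_cocycle_ge//= cocycle_bound.
have Zk i w : Kinv ^- p <= Z i w <= KA ^+ p by rewrite ZD.
have Z0 i w : 0 <= Z i w by rewrite ZD op_norm_ge0.
pose h (y : pathType 'cV[R]_m) := ln (op_norm (cocycle A y 1 p)).
have mh : measurable_fun setT h.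
  apply: (measurableT_comp (@measurable_ln R)).
  apply: (measurableT_comp (@measurable_op_norm R d)); apply: measurable_cocycle => //.
  exact: measurable_coordinate.
have [K hK] : exists K, forall y, `|h y| <= K.
  exists (`|ln (Kinv ^- p)| + `|ln (KA ^+ p)|) => y.
  have /andP[h1 h2] := ck y 1.
  have z0 := lt_le_trans k0 h1.
  have l1 : ln (Kinv ^- p) <= h y by rewrite ler_ln ?posrE.
  have l2 : h y <= ln (KA ^+ p) by rewrite ler_ln ?posrE// (lt_le_trans z0).
  have := ler_norm (ln (KA ^+ p)); have := ler_norm (- ln (Kinv ^- p)).
  rewrite normrN ler_norml; have := normr_ge0 (ln (KA ^+ p)).
  by have := normr_ge0 (ln (Kinv ^- p)); lra.
have hZ i w : ln (Z i w) = h (fun j => Y (j + (i.-1 * p)%N%:Z) w).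
  by rewrite ZD /h cocycle_shift.
have Zst i : (0 < i)%N -> \int[P]_w ln (Z i w) = \int[P]_w ln (Z 1%N w).
  have st j : \int[P]_w ln (Z j w) = \int[P]_w h (fun j => Y j w).
    apply: etrans (stationary_Rintegral Ystat (j.-1 * p)%N%:Z mh hK).
    by apply: eq_Rintegral => w _; exact: hZ.
  by move=> _; rewrite !st.
have iZ : P.-integrable setT (EFin \o (fun w => ln (Z 1%N w))).
  apply: (@bounded_integrable _ _ _ P (fun w => ln (Z 1%N w)) K) => [|w].
    exact: (measurableT_comp (@measurable_ln R) (mZ 1%N)).
  by rewrite hZ.
have contr' : \int[P]_w ln (Z 1%N w) < 0.
  have fin := integrable_fin_num measurableT iZ.
  have E : ('E_P[fun w => ln (op_norm (block_prod A (fun t => Y t w) p 1))] =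
      (\int[P]_w ln (Z 1%N w))%:E)%E.
    rewrite unlock /Rintegral (fineK fin).
    by apply: eq_integral => w _; rewrite ZE.
  by rewrite -lte_fin -E.
have Glim' (b : R) : - eta < b < eta -> (fun n : nat => ((n%:R^-1)%:E * lne 'E_P[fun w =>
    (\prod_(1 <= i < n.+1) Z i w `^ b)%R])%E) @ \oo --> (Gamma b)%:E.
  move=> /Glim.
  have E n w : \prod_(1 <= i < n.+1) op_norm (block_prod A (fun t => Y t w) p i) `^ b =
      \prod_(1 <= i < n.+1) Z i w `^ b.
    by rewrite !big_nat; apply: eq_bigr => i /andP[i0 _]; rewrite ZE.
  have -> // : (fun n : nat => ((n%:R^-1)%:E * lne 'E_P[fun w =>
      (\prod_(1 <= i < n.+1) op_norm (block_prod A (fun t => Y t w) p i) `^ b)%R])%E) =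
    (fun n : nat => ((n%:R^-1)%:E * lne 'E_P[fun w => (\prod_(1 <= i < n.+1) Z i w `^ b)%R])%E).
  apply/funext => n; congr (_ * lne 'E_P[_])%E; apply/funext => w; exact: E.
have [a [C [rho [a0 a1 C0 rho01 HC]]]] := moment_contraction mZ k0 Zk Zst contr' eta0 dG Glim'.
exists a, (d%:R `^ a * C), rho; split => //.
  by rewrite mulr_gt0// powR_gt0// ltr0n.
move=> n s; rewrite (contraction_stationary mA Ystat a0 _ _ KA0 AK).
have mprod : measurable_fun setT (fun w => \prod_(1 <= i < n.+1) Z i w `^ a).
  apply: measurable_prod => i _.
  exact: (measurableT_comp (measurable_powR a) (mZ i)).
have bprod w : `|\prod_(1 <= i < n.+1) Z i w `^ a| <= \prod_(1 <= i < n.+1) (KA ^+ p) `^ a.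
  rewrite normr_prod; apply: ler_prod => i _; rewrite normr_ge0/= ger0_norm ?powR_ge0//.
  have /andP[h1 h2] := Zk i w.
  apply: ge0_ler_powR; rewrite ?nnegrE ?Z0 ?exprn_ge0//; exact: ltW.
apply: (@le_trans _ _ (\int[P]_w (d%:R `^ a * \prod_(1 <= i < n.+1) Z i w `^ a))).
  apply: le_Rintegral => //.
  - apply: (@bounded_integrable _ _ _ P (fun w => contraction A a (n * p) (fun j => Y j w) 1)
      _ _ (fun w => contraction_bounded a0 (n * p) _ 1 KA0 AK)).
    exact: measurable_contraction.
  - exact: integrable_scaleR (bounded_integrable P mprod bprod).
  - move=> w _; rewrite /contraction powRM ?op_norm_ge0//.
    apply: ler_wpM2l; first exact: powR_ge0.
    apply: (le_trans (cocycle_prod_le _ _ _ _ a0)).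
    rewrite le_eqVlt; apply/orP; left; apply/eqP.
    by apply: eq_bigr => i _; rewrite ZD.
rewrite (RintegralZl _ measurableT (bounded_integrable P mprod bprod)).
rewrite -mulrA; apply: ler_wpM2l; [exact: powR_ge0|exact: HC].
Qed.

End contraction_moment.

(** * Explicit rates in terms of N^(1/3) *)

Lemma Rintegral_sum_le (R : realType) d (T : measurableType d)
    (P : probability T R) (g : nat -> T -> R) (b : R) k :
  (forall j, P.-integrable setT (EFin \o g j)) ->
  (forall j, \int[P]_x g j x <= b) ->
  P.-integrable setT (EFin \o (fun x => \sum_(0 <= j < k) g j x)) /\
  \int[P]_x (\sum_(0 <= j < k) g j x) <= k%:R * b.
Proof.
move=> ig gb; elim: k => [|k [IHi IHb]].
  have E : (fun x => \sum_(0 <= j < 0) g j x) = cst 0 by apply/funext => x; rewrite big_nil.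
  rewrite E; split; first exact: finite_measure_integrable_cst.
  by rewrite probability_Rintegral_cst mul0r.
have E : (fun x => \sum_(0 <= j < k.+1) g j x) = (fun x => \sum_(0 <= j < k) g j x + g k x).
  by apply/funext => x; rewrite big_nat_recr.
rewrite E; split; first exact: integrable_addR.
by rewrite RintegralD// -natr1 mulrDl mul1r lerD.
Qed.

(** Applied with [x] the cube root of the time and [n] its integer part. Writing [r ^+ n] as
    exp(-2cn), one half of the exponent absorbs the factor n + 1 and the other half remains. Below
    [3 * p] the trivial bound 1 is fitted into the constant. *)
Lemma rate_arith (R : realType) (r K : R) (p : nat) : 0 < r < 1 -> 0 <= K ->
  exists c C : R, [/\ 0 < c, 0 < C & forall (n : nat) (x : R), x <= n.+1%:R ->
    K * n.+1%:R * r ^+ n <= C * expR (- c * x) /\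
    ((n < 3 * p)%N -> 1 <= C * expR (- c * x))].
Proof.
move=> /andP[r0 r1] K0.
pose c := - ln r / 2.
have lr : ln r < 0 by rewrite ln_lt0// r0.
have c0 : 0 < c by rewrite /c divr_gt0// oppr_gt0.
have cE : r = expR (- (2 * c)).
  by rewrite (_ : - (2 * c) = ln r) ?lnK ?posrE// /c; field.
exists c, (K * (expR (2 * c) / c) + expR (c * (3 * p)%:R)); split => //.
  by apply: ltr_wpDl; rewrite ?expR_gt0// mulr_ge0// divr_ge0 ?expR_ge0// ltW.
move=> n x xn.
have e0 := expR_gt0 (- c * x).
have ex : expR (- c * n.+1%:R) <= expR (- c * x).
  by rewrite ler_expR !mulNr lerN2 ler_pM2l.
split.
  apply: (@le_trans _ _ (K * (expR (2 * c) / c) * expR (- c * x))); last first.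
    by rewrite ler_pM2r// lerDl expR_ge0.
  rewrite -!mulrA ler_wpM2l// cE -expRM_natr.
  apply: (@le_trans _ _ (expR (2 * c) * (c^-1 * expR (- c * n.+1%:R)))); last first.
    by rewrite ler_wpM2l ?expR_ge0// ler_wpM2l// invr_ge0 ltW.
  have -> : expR (- (2 * c) * n%:R) = expR (2 * c) * (expR (- c * n.+1%:R) * expR (- c * n.+1%:R)).
    by rewrite -!expRD; congr expR; rewrite -natr1; ring.
  rewrite mulrCA ler_wpM2l ?expR_ge0// mulrA ler_wpM2r ?expR_ge0//.
  rewrite mulNr expRN ler_pdivrMr ?expR_gt0// -(ler_pM2l c0) mulrA mulfV ?gt_eqF// mul1r.
  by apply: le_trans (expR_ge1Dx _); rewrite lerDr.
move=> np; apply: (@le_trans _ _ (expR (c * (3 * p)%:R) * expR (- c * x))).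
  rewrite -expRD -[leLHS]expR0 ler_expR mulNr subr_ge0 ler_pM2l//.
  by apply: (le_trans xn); rewrite ler_nat.
rewrite ler_pM2r// lerDr mulr_ge0// divr_ge0 ?expR_ge0//; exact: ltW.
Qed.

(** The initial approach and the [n] attempts take about p n^2 steps, which is at most n^3, hence at
    most N, once [3 * p <= n]. The remaining time [M] is left to the chain. *)
Lemma cube_root_split (R : realType) (p N : nat) : (1 <= p)%N -> let n := Num.truncn (N%:R `^ 3^-1 : R) in
  (3 * p <= n)%N -> exists M, N = (n * p + (n * (n * p).+1 + M))%N.
Proof.
move=> p1 n np; exists (N - (n * p + n * (n * p).+1))%N.
have n3 : (n ^ 3 <= N)%N.
  rewrite -(ler_nat R) natrX.
  have x0 : (0 : R) <= N%:R `^ 3^-1 by exact: powR_ge0.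
  have h : n%:R <= (N%:R `^ 3^-1 : R) by rewrite truncn_le.
  have -> : N%:R = (N%:R `^ 3^-1) ^+ 3 :> R.
    by rewrite -powR_mulrn// -powRrM mulVf// powRr1.
  by apply: lerXn2r; rewrite ?nnegrE.
have n1 : (1 <= n)%N by apply: leq_trans np; rewrite muln_gt0.
move: (n) n3 np n1 => {}n n3 np n1.
have key : (n * p + n * (n * p).+1 <= N)%N.
  by apply: leq_trans n3; rewrite !expnS expn0 muln1; nia.
by rewrite addnA subnKC.
Qed.

Section forgetting_rate.
Context (R : realType) (m d : nat) (disp : measure_display)
  (Omega : measurableType disp) (P : probability Omega R).
Variables (A B : 'cV[R]_m -> 'M[R]_d) (nu : probability 'cV[R]_d R)
  (Y : int -> {RV P >-> 'cV[R]_m}).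
Hypotheses (mA : measurable_fun setT A) (mB : measurable_fun setT B).
Variables (a KA KB KI alpha : R).
Hypotheses (a0 : 0 < a) (a1 : a <= 1)
  (HKA : forall y (x : 'cV[R]_d), `|A y *m x| <= KA * `|x|)
  (HKB : forall y (e : 'cV[R]_d), `|B y *m e| <= KB * `|e|)
  (HKI : forall y (x : 'cV[R]_d), `|invmx (B y) *m (A y *m x)| <= KI * `|x|)
  (uB : forall y, B y \in unitmx)
  (KA0 : 0 <= KA) (KB0 : 0 <= KB) (KI0 : 0 <= KI)
  (alpha0 : 0 < alpha) (alpha1 : alpha < 1)
  (minor : forall v : 'cV[R]_d, `|v| <= KI ->
    exists ka1 ka2 : {finite_measure set 'cV[R]_d -> \bar R},
      [/\ forall E, measurable E -> (ka1 E <= nu E)%E,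
          forall E, measurable E -> (ka2 E <= nu E)%E,
          ka1 setT = alpha%:E, ka2 setT = alpha%:E &
          forall h : 'cV[R]_d -> R, measurable_fun setT h ->
            (forall e, `|h e| <= 1) ->
            \int[ka1]_e h (e + v) = \int[ka2]_e h e])
  (inu : nu.-integrable setT (EFin \o (fun e : 'cV[R]_d => `|e|))).
Variables (KO C rho : R) (p : nat).
Hypotheses (KO0 : 0 <= KO) (AKO : forall z, op_norm (A z) <= KO) (hp : (1 <= p)%N)
  (C0 : 0 < C) (rho01 : 0 < rho < 1)
  (moment : forall n s,
    \int[P]_w contraction A a (n * p) (fun j => Y j w) s <= C * rho ^+ n).

Let G := forgetting A nu a KA KB alpha.

(** Each of the n + 1 costs has mean at most C rho^n at whatever time it starts, and the expectation
    is linear, so the dependence between blocks does not matter. *)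
Lemma Rintegral_forgetting n :
  P.-integrable setT (EFin \o (fun w => G (n * p) n (fun j => Y j w) 0)) /\
  \int[P]_w G (n * p) n (fun j => Y j w) 0 <=
    (1 + attempt_cst nu KA KB * C + C) * n.+1%:R * (Num.max (1 - alpha) rho) ^+ n.
Proof.
have /andP[rho0 rho1] := rho01.
have ic s : P.-integrable setT (EFin \o (fun w => contraction A a (n * p) (fun j => Y j w) s)).
  apply: (@bounded_integrable _ _ _ P (fun w => contraction A a (n * p) (fun j => Y j w) s)
      _ _ (fun w => contraction_bounded a0 (n * p) _ s KO0 AKO)).
  by apply: measurable_contraction => // j; exact: measurable_funP.
have cst0 := attempt_cst_ge0 nu KA0 KB0.
pose t j : int := 0 + (n * p + (j * (n * p).+1).+1)%N%:Z.
have [iS bS] := Rintegral_sum_le n (fun j => ic (t j)) (fun j => moment n (t j)).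
have i1 := finite_measure_integrable_cst P ((1 - alpha) ^+ n) measurableT.
have i2 := integrable_scaleR (attempt_cst nu KA KB) iS.
have i12 := integrable_addR i1 i2.
split; first exact: integrable_addR i12 (ic 0).
rewrite /G /forgetting (RintegralD measurableT i12 (ic 0)) (RintegralD measurableT i1 i2).
rewrite (RintegralZl _ measurableT iS) probability_Rintegral_cst.
set q := Num.max (1 - alpha) rho.
have q0 : 0 <= q by rewrite le_max (ltW rho0) orbT.
have qn0 : 0 <= q ^+ n by rewrite exprn_ge0.
have h1 : (1 - alpha) ^+ n <= q ^+ n.
  by apply: lerXn2r; rewrite ?nnegrE ?le_max ?lexx// subr_ge0 ltW.
have h2 : rho ^+ n <= q ^+ n.
  apply: lerXn2r; rewrite ?nnegrE ?q0//; first exact: ltW.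
  by rewrite le_max lexx orbT.
have h3 : C * rho ^+ n <= C * q ^+ n by rewrite ler_pM2l.
have nn : (0 : R) <= n%:R by [].
apply: (@le_trans _ _ (q ^+ n + attempt_cst nu KA KB * (n%:R * (C * q ^+ n)) + C * q ^+ n)).
  rewrite !lerD//.
  - rewrite ler_wpM2l//; apply: (le_trans bS).
    by rewrite ler_wpM2l.
  - exact: le_trans (moment n 0) h3.
have -> : (1 + attempt_cst nu KA KB * C + C) * n.+1%:R * q ^+ n =
   (q ^+ n + attempt_cst nu KA KB * (n%:R * (C * q ^+ n)) + C * q ^+ n) +
   (n%:R * q ^+ n + attempt_cst nu KA KB * (C * q ^+ n) + n%:R * (C * q ^+ n)).
  by rewrite -natr1; ring.
have Cq0 : 0 <= C * q ^+ n by rewrite mulr_ge0// ltW.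
by rewrite lerDl !addr_ge0// mulr_ge0.
Qed.

(** [V] hides the coupling: what follows uses only that it is a bounded function of the environment,
    that it controls the influence of the starting point for all test functions at once, and that
    its mean decays. *)
Lemma forgetting_rate : exists V : nat -> pathType 'cV[R]_m -> R,
  [/\ forall N, measurable_fun setT (V N) /\ (exists K, forall y, `|V N y| <= K),
      forall N y, 0 <= V N y,
      forall N (phi : 'cV[R]_d -> R), unit_valued phi -> forall y z z',
        `|quenched A B nu N 0 phi y z - quenched A B nu N 0 phi y z'| <=
        V N y * (1 + `|z - z'|) &
      exists c C' : R, [/\ 0 < c, 0 < C' & forall N,
        \int[P]_w V N (fun j => Y j w) <= C' * expR (- c * N%:R `^ 3^-1)]].
Proof.
have /andP[rho0 rho1] := rho01.
pose n N := Num.truncn (N%:R `^ 3^-1 : R).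
(* For [n N] below [3 * p] there is no room for the attempts, and the constant 1 is a valid bound
   for test functions in [0, 1]. *)
pose V N : pathType 'cV[R]_m -> R :=
  if (3 * p <= n N)%N then (fun y => G (n N * p) (n N) y 0) else cst 1.
have cst0 := attempt_cst_ge0 nu KA0 KB0.
exists V; split.
- move=> N; rewrite /V; case: ifP => _; last first.
    by split; [exact: measurable_cst|exists 1 => y; rewrite normr1].
  have mc s : measurable_fun setT
      (fun y : pathType 'cV[R]_m => contraction A a (n N * p) y s).
    by apply: measurable_contraction => // j; exact: measurable_coordinate.
  split.
    apply: measurable_funD; last exact: mc.
    apply: measurable_funD; first exact: measurable_cst.
    apply: measurable_funM; first exact: measurable_cst.
    by apply: measurable_sum => j; exact: mc.
  exists ((1 - alpha) ^+ n N + attempt_cst nu KA KB * \sum_(0 <= j < n N)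
      (d%:R * KO ^+ (n N * p)) `^ a + (d%:R * KO ^+ (n N * p)) `^ a) => y.
  have cb s : contraction A a (n N * p) y s <= (d%:R * KO ^+ (n N * p)) `^ a.
    exact: le_trans (ler_norm _) (contraction_bounded a0 _ y s KO0 AKO).
  rewrite ger0_norm ?forgetting_ge0//.
  by rewrite lerD// lerD2l ler_wpM2l// ler_sum.
- by move=> N y; rewrite /V; case: ifP => // _; exact: forgetting_ge0.
- move=> N phi uphi y z z'; rewrite /V; case: ifP => [nN|_].
    have [M NE] := cube_root_split hp nN.
    rewrite [in X in X <= _]NE.
    exact: (quenched_forgetting mA mB uphi a0 a1 HKA HKB HKI uB KA0 KB0 KI0 alpha0 alpha1 minor inu).
  have z0 := normr_ge0 (z - z').
  have := quenched_ge0 A B nu uphi N 0 y z; have := quenched_ge0 A B nu uphi N 0 y z'.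
  have := quenched_le1 nu mA mB uphi N 0 y z; have := quenched_le1 nu mA mB uphi N 0 y z'.
  by rewrite /= ler_norml; lra.
- set q := Num.max (1 - alpha) rho.
  have q01 : 0 < q < 1.
    by rewrite lt_max rho0 orbT gt_max rho1 andbT ltrBlDr ltrDl.
  have K0 : 0 <= 1 + attempt_cst nu KA KB * C + C.
    by rewrite !addr_ge0// ?mulr_ge0// ltW.
  have [c [C' [c0 C'0 H]]] := rate_arith p q01 K0.
  exists c, C'; split => // N.
  have [|h1 h2] := H (n N) (N%:R `^ 3^-1).
    by apply: ltW; exact: truncnS_gt.
  rewrite /V; case: ifP => nN; last first.
    by rewrite probability_Rintegral_cst; apply: h2; rewrite ltnNge nN.
  by apply: le_trans h1; exact: (Rintegral_forgetting _).2.
Qed.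

End forgetting_rate.

(** With x the cube root of j and t = b / 6, exp(bx) is the sixth power of exp(tx), hence at least
    (1 + tx)^6, which is at least (tau (j + 1))^2. The difference of reciprocals is comparable with
    1 / (j + 1)^2 and telescopes. *)
Lemma stretched_exp_le (R : realType) (b : R) : 0 < b ->
  exists2 K : R, 0 < K & forall j : nat,
    expR (- b * j%:R `^ 3^-1) <= K * (j.+1%:R^-1 - j.+2%:R^-1).
Proof.
move=> b0; pose t := b / 6.
have t0 : 0 < t by rewrite divr_gt0.
pose tau := Num.min 1 (t ^+ 3).
have tau0 : 0 < tau by rewrite lt_min ltr01 exprn_gt0.
have tau1 : tau <= 1 by rewrite ge_min lexx.
have taut : tau <= t ^+ 3 by rewrite ge_min lexx orbT.
exists (2 / tau ^+ 2); first by rewrite divr_gt0// exprn_gt0.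
move=> j; set x := j%:R `^ 3^-1.
have x0 : 0 <= x by exact: powR_ge0.
have jx : j%:R = x ^+ 3 :> R by rewrite /x -powR_mulrn// -powRrM mulVf// powRr1.
have j0 : 0 <= (j%:R : R) by [].
have tx0 : 0 <= t * x by rewrite mulr_ge0// ltW.
have h3 : tau * j.+1%:R <= (1 + t * x) ^+ 3.
  apply: (@le_trans _ _ (1 + t ^+ 3 * x ^+ 3)).
    by rewrite -jx -natr1 mulrDr mulr1 addrC lerD// ler_wpM2r.
  rewrite -exprMn; move: (t * x) tx0 => u u0.
  have u2 : 0 <= u ^+ 2 by rewrite exprn_ge0.
  have -> : (1 + u) ^+ 3 = 1 + u ^+ 3 + (3 * u + 3 * u ^+ 2) by ring.
  by rewrite lerDl addr_ge0// mulr_ge0.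
have h6 : (tau * j.+1%:R) ^+ 2 <= expR (b * x).
  have -> : expR (b * x) = (expR (t * x) ^+ 3) ^+ 2.
    by rewrite -exprM -expRM_natl; congr expR; rewrite /t; field.
  have tj : 0 <= tau * j.+1%:R by rewrite mulr_ge0// ltW.
  apply: lerXn2r; rewrite ?nnegrE ?exprn_ge0 ?expR_ge0//.
  apply: (le_trans h3); apply: lerXn2r; rewrite ?nnegrE ?expR_ge0 ?addr_ge0//.
  exact: expR_ge1Dx.
have p1 : (0 : R) < j.+1%:R by [].
have tj : 0 < tau * j.+1%:R by rewrite mulr_gt0.
rewrite mulNr expRN; apply: (@le_trans _ _ ((tau * j.+1%:R) ^+ 2)^-1).
  by rewrite lef_pV2// posrE ?expR_gt0// exprn_gt0.
have -> : j.+2%:R = j.+1%:R + 1 :> R by rewrite -natr1.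
have : (1 : R) <= j.+1%:R by rewrite ler1n.
move: (j.+1%:R) p1 => u u0 u1.
have u10 : 0 < u + 1 by rewrite addr_gt0.
rewrite -subr_ge0.
have -> : 2 / tau ^+ 2 * (u^-1 - (u + 1)^-1) - (tau * u) ^- 2 =
    (u - 1) / (tau ^+ 2 * (u ^+ 2 * (u + 1))).
  by field; rewrite !gt_eqF.
by rewrite divr_ge0 ?subr_ge0// !mulr_ge0 ?exprn_ge0//; exact: ltW.
Qed.

(** Half of the exponent is bounded by its value at [N] and taken out of the sum; the other half is
    summed by telescoping. *)
Lemma stretched_tail (R : realType) (c : R) : 0 < c ->
  exists2 K : R, 0 < K & forall N N' : nat, (N <= N')%N ->
    \sum_(N <= j < N') expR (- c * j%:R `^ 3^-1) <=
    K * expR (- (c / 2) * N%:R `^ 3^-1).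
Proof.
move=> c0; have c20 : 0 < c / 2 by rewrite divr_gt0.
have [K K0 HK] := stretched_exp_le c20.
exists K => // N N' NN'.
set e := expR (- (c / 2) * N%:R `^ 3^-1).
have e0 : 0 <= e by exact: expR_ge0.
apply: (@le_trans _ _ (\sum_(N <= j < N') e * K * (- j.+2%:R^-1 - - j.+1%:R^-1))).
  apply: ler_sum_nat => j /andP[Nj _].
  have -> : - c * j%:R `^ 3^-1 = - (c / 2) * j%:R `^ 3^-1 + - (c / 2) * j%:R `^ 3^-1.
    by field.
  rewrite expRD -mulrA opprK [- _ + _]addrC; apply: ler_pM; rewrite ?expR_ge0//.
  rewrite ler_expR !mulNr lerN2 ler_pM2l//.
  by apply: ge0_ler_powR; rewrite ?nnegrE ?invr_ge0// ler_nat.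
rewrite -mulr_sumr (telescope_sumr (fun j => - j.+1%:R^-1))//.
rewrite mulrAC [leRHS]mulrC -[leRHS]mulr1 mulrAC; apply: ler_wpM2l.
  by rewrite mulr_ge0// ltW.
rewrite opprK; apply: (@le_trans _ _ N.+1%:R^-1).
  by rewrite gerDr oppr_le0 invr_ge0.
by rewrite invf_le1// ler1n.
Qed.

Lemma cvg_stretched_exp (R : realType) (c K : R) : 0 < c ->
  (fun N : nat => K * expR (- c * N%:R `^ 3^-1)) @ \oo --> (0 : R).
Proof.
move=> c0; rewrite -[X in _ --> X](mulr0 K); apply: cvgM; first exact: cvg_cst.
have [C C0 HC] := stretched_exp_le c0.
apply: (@squeeze_cvgr _ _ _ _ (fun=> 0) (fun N : nat => C * N.+1%:R^-1)).
- near=> N; rewrite expR_ge0/=; apply: (le_trans (HC N)).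
  by rewrite ler_pM2l// gerDl oppr_le0 invr_ge0.
- exact: cvg_cst.
- rewrite -[X in _ --> X](mulr0 C); apply: cvgM; first exact: cvg_cst.
  exact: cvg_harmonic.
Unshelve. all: by end_near. Qed.

Lemma Rintegral_indic (R : realType) d (T : measurableType d)
    (mu : probability T R) E : measurable E -> \int[mu]_x \1_E x = fine (mu E).
Proof. by move=> mE; rewrite /Rintegral integral_indic// setIT. Qed.

(** Layer cake: the indicators of the level sets of n phi add up to its integer part, so n times the
    difference of integrals is at most n e + 2, and the error 2 / n is arbitrarily small. The
    constant [e] is kept. *)
Lemma tv_Rintegral_le (R : realType) d (T : measurableType d)
    (mu nu : probability T R) (e : R) (phi : T -> R) :
  (forall E, measurable E -> `|fine (mu E) - fine (nu E)| <= e) ->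
  measurable_fun setT phi -> (forall x, 0 <= phi x <= 1) ->
  `|\int[mu]_x phi x - \int[nu]_x phi x| <= e.
Proof.
move=> tv mphi phi01.
have phib x : `|phi x| <= 1 by have /andP[p0 p1] := phi01 x; rewrite ger0_norm.
apply/ler_addgt0Pr => del del0.
pose n := (Num.truncn (2 / del)).+1.
have n0 : (0 : R) < n%:R by [].
have n2 : 2 / n%:R <= del.
  rewrite ler_pdivrMr// -ler_pdivrMl// mulrC; apply: ltW; exact: truncnS_gt.
pose E i := [set x | i.+1%:R <= n%:R * phi x].
have mE i : measurable (E i).
  rewrite -[E i]setTI; apply: measurable_fun_le => //.
  exact: measurable_funM.
pose psi k x : R := \sum_(0 <= i < k) \1_(E i) x.
have iE (Q : probability T R) i : Q.-integrable setT (EFin \o (\1_(E i) : T -> R)).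
  by apply: (@bounded_integrable _ _ _ Q _ 1) => // x; rewrite indicE; case: (_ \in _); rewrite ?normr0 ?normr1.
have psiI (Q : probability T R) k : Q.-integrable setT (EFin \o psi k) /\
    \int[Q]_x psi k x = \sum_(0 <= i < k) fine (Q (E i)).
  elim: k => [|k [IHi IHb]].
    have -> : psi 0%N = cst 0 by apply/funext => x; rewrite /psi big_nil.
    split; first exact: finite_measure_integrable_cst.
    by rewrite probability_Rintegral_cst big_nil.
  have -> : psi k.+1 = (fun x => psi k x + \1_(E k) x).
    by apply/funext => x; rewrite /psi big_nat_recr.
  split; first exact: integrable_addR IHi (iE Q k).
  by rewrite (RintegralD measurableT IHi (iE Q k)) IHb Rintegral_indic// big_nat_recr.
have psib : `|\int[mu]_x psi n x - \int[nu]_x psi n x| <= n%:R * e.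
  rewrite !(psiI _ _).2 -sumrB; apply: (le_trans (ler_norm_sum _ _ _)).
  rewrite -[in leRHS](subn0 n) mulr_natl -sumr_const_nat; apply: ler_sum => i _.
  exact: tv.
have psip x : `|n%:R * phi x - psi n x| <= 1.
  have /andP[p0 p1] := phi01 x.
  have np0 : 0 <= n%:R * phi x by rewrite mulr_ge0.
  set k := Num.truncn (n%:R * phi x).
  have kn : (k <= n)%N.
    by rewrite -(ler_nat R); apply: (@le_trans _ _ (n%:R * phi x)); rewrite ?truncn_le// ler_piMr.
  have -> : psi n x = k%:R.
    have aux : forall r, psi r x = (minn r k)%:R.
      elim=> [|r IHr]; first by rewrite /psi big_nil min0n.
      rewrite /psi big_nat_recr//= -/(psi r x) IHr indicE.
      have -> : (x \in E r) = (r.+1 <= k)%N.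
        by apply/idP/idP; rewrite inE /E/= truncn_ge_nat.
      by rewrite -natrD; congr (_%:R); case: ltnP; lia.
    by rewrite aux (minn_idPr kn).
  have h1 : k%:R <= n%:R * phi x by rewrite truncn_le.
  have h2 : n%:R * phi x < k.+1%:R by exact: truncnS_gt.
  rewrite ger0_norm ?subr_ge0// lerBlDl; rewrite -natr1 in h2; exact: ltW.
have close (Q : probability T R) : `|n%:R * \int[Q]_x phi x - \int[Q]_x psi n x| <= 1.
  have ip := bounded_integrable Q mphi phib.
  have inp := integrable_scaleR n%:R ip.
  have [ipsi _] := psiI Q n.
  rewrite -(RintegralZl _ measurableT ip) -(RintegralB measurableT inp ipsi).
  apply: probability_Rintegral_bound psip.
  apply: measurable_funB; first exact: measurable_funM.
  exact/measurable_EFinP/(measurable_int _ ipsi).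
have := close mu; have := close nu; move: psib.
set a1 := \int[mu]_x phi x; set a2 := \int[nu]_x phi x.
set b1 := \int[mu]_x psi n x; set b2 := \int[nu]_x psi n x => H1 H2 H3.
have : n%:R * `|a1 - a2| <= n%:R * e + 2.
  rewrite -[X in X * _](ger0_norm (ltW n0)) -normrM.
  by move: H1 H2 H3; rewrite !ler_norml; set u := n%:R * a1; set v := n%:R * a2;
    rewrite mulrBr -/u -/v; move: u v (n%:R * e) => u v w; clear; lra.
rewrite -ler_pdivlMl// mulrDr mulKf ?gt_eqF// => /le_trans; apply.
by rewrite lerD2l mulrC.
Qed.
(** * The limiting law *)

Section limit_law.
Context (R : realType) (m d : nat) (disp : measure_display)
  (Omega : measurableType disp) (P : probability Omega R).
Variables (Y : int -> {RV P >-> 'cV[R]_m}) (eps : nat -> {RV P >-> 'cV[R]_d}).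
Variables (A B : 'cV[R]_m -> 'M[R]_d).
Hypotheses (mA : measurable_fun setT A) (mB : measurable_fun setT B)
  (Ystat : strictly_stationary Y) (eps_iid : iid [set t | (1 <= t)%N] eps)
  (eps_Y : independent_processes [set t | (1 <= t)%N] setT eps Y).

Let nu : probability 'cV[R]_d R := distribution P (eps 1%N).

Variables (KA KB : R).
Hypotheses (HKA : forall y (x : 'cV[R]_d), `|A y *m x| <= KA * `|x|)
  (HKB : forall y (e : 'cV[R]_d), `|B y *m e| <= KB * `|e|)
  (KA0 : 0 <= KA) (KB0 : 0 <= KB)
  (inu : nu.-integrable setT (EFin \o (fun e : 'cV[R]_d => `|e|))).

Variable V : nat -> pathType 'cV[R]_m -> R.
Hypotheses (mbV : forall N, measurable_fun setT (V N) /\ exists K, forall y, `|V N y| <= K)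
  (V0 : forall N y, 0 <= V N y)
  (VQ : forall N (phi : 'cV[R]_d -> R), unit_valued phi -> forall y z z',
     `|quenched A B nu N 0 phi y z - quenched A B nu N 0 phi y z'| <=
     V N y * (1 + `|z - z'|)).

Let EV N := \int[P]_w V N (fun j => Y j w).

Lemma quenched_translate_le N s phi (y : int -> 'cV[R]_m) z z' : unit_valued phi ->
  `|quenched A B nu N s phi y z - quenched A B nu N s phi y z'| <=
  V N (fun j => y (j + s)) * (1 + `|z - z'|).
Proof. by move=> uphi; rewrite -(add0r s) !quenched_shift add0r; exact: VQ. Qed.

Lemma translate_integrable N s :
  P.-integrable setT (EFin \o (fun w => V N (fun j => Y (j + s) w))).
Proof.
have [mV [K VK]] := mbV N.
apply: (@bounded_integrable _ _ _ P _ K) => [|w]; last exact: VK.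
exact: (measurableT_comp mV (measurable_path_of Y s)).
Qed.

Lemma translate_mean N s : \int[P]_w V N (fun j => Y (j + s) w) = EV N.
Proof. by have [mV [K VK]] := mbV N; exact: stationary_Rintegral VK. Qed.

Lemma env_mean_ge0 N : 0 <= EV N.
Proof. exact: Rintegral_ge0. Qed.

(** The expectation at time [N] for the start [x], expressed without a process, so that different
    starting points share one environment. *)
Definition quenched_mean (phi : 'cV[R]_d -> R) N x :=
  \int[P]_w quenched A B nu N 0 phi (fun j => Y j w) x.

Section unit_valued_test.
Variables (phi : 'cV[R]_d -> R) (uphi : unit_valued phi).

Lemma quenched_env_integrable N s x :
  P.-integrable setT (EFin \o (fun w => quenched A B nu N s phi (fun j => Y j w) x)).
Proof.
apply: (@bounded_integrable _ _ _ P _ 1) => [|w].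
  by apply: measurable_quenched => // j; exact: measurable_funP.
exact: quenched_norm_le1.
Qed.

Lemma quenched_mean_translate N s x :
  \int[P]_w quenched A B nu N s phi (fun j => Y j w) x = quenched_mean phi N x.
Proof.
pose h (y : pathType 'cV[R]_m) := quenched A B nu N 0 phi y x.
have mh : measurable_fun setT h.
  by apply: measurable_quenched => // j; exact: measurable_coordinate.
have hb y : `|h y| <= 1 by exact: quenched_norm_le1.
rewrite -[RHS](stationary_Rintegral Ystat s mh hb).
apply: eq_Rintegral => w _; rewrite /h.
by have := quenched_shift A B nu phi N 0 s (fun j => Y j w) x; rewrite add0r.
Qed.

Lemma quenched_mean_le N x x' :
  `|quenched_mean phi N x - quenched_mean phi N x'| <= EV N * (1 + `|x - x'|).
Proof.
have i1 := quenched_env_integrable N 0 x; have i2 := quenched_env_integrable N 0 x'.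
have i12 := integrable_subR i1 i2.
have iV := translate_integrable N 0.
have iVc := integrable_scaleR (1 + `|x - x'|) iV.
rewrite /quenched_mean -(RintegralB measurableT i1 i2).
apply: (le_trans (le_normr_Rintegral measurableT i12)).
rewrite -(translate_mean N 0) [leRHS]mulrC -(RintegralZl _ measurableT iV).
apply: le_Rintegral => //; first exact: integrable_abse i12.
by move=> w _; rewrite [leRHS]mulrC; exact: quenched_translate_le.
Qed.

(** The integral over [e] of an upper bound for 1 + |A x + B e - x|, the factor that [V] acquires
    when the start [x] is compared with its successor. *)
Definition step_cst (x : 'cV[R]_d) := 1 + KA * `|x| + `|x| + KB * \int[nu]_e `|e|.

Lemma step_cst_gt0 x : 0 < step_cst x.
Proof.
have i0 : 0 <= \int[nu]_e `|e| by exact: Rintegral_ge0.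
by rewrite /step_cst -!addrA ltr_pwDl// !addr_ge0// mulr_ge0.
Qed.

(** The first step turns the start [x] at time 0 into the random start A x + B e at time 1, which is
    compared with [x] itself at time 1. *)
Lemma quenched_step_le N (y : int -> 'cV[R]_m) x :
  `|quenched A B nu N.+1 0 phi y x - quenched A B nu N 1 phi y x| <=
  step_cst x * V N (fun j => y (j + 1)).
Proof.
set v := V N _.
have v0 : 0 <= v by exact: V0.
have i1 := quenched_step_integrable nu mA mB uphi N 0 y x.
rewrite add0r in i1.
have i2 := finite_measure_integrable_cst nu (quenched A B nu N 1 phi y x) measurableT.
have i12 := integrable_subR i1 i2.
have i3 := finite_measure_integrable_cst nu (1 + KA * `|x| + `|x|) measurableT.
have i4 := integrable_scaleR KB inu.
have i34 := integrable_addR i3 i4.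
have i5 := integrable_scaleR v i34.
rewrite /= add0r -[X in _ - X](probability_Rintegral_cst nu).
rewrite -(RintegralB measurableT i1 i2).
apply: (le_trans (le_normr_Rintegral measurableT i12)).
have -> : step_cst x * v = \int[nu]_e (v * (cst (1 + KA * `|x| + `|x|) e + KB * `|e|)).
  rewrite (RintegralZl _ measurableT i34) (RintegralD measurableT i3 i4).
  by rewrite (RintegralZl _ measurableT inu) probability_Rintegral_cst mulrC.
apply: le_Rintegral => //; first exact: integrable_abse i12.
move=> e _; apply: (le_trans (quenched_translate_le _ _ _ _ _ uphi)).
apply: ler_wpM2l => //=; rewrite -!addrA lerD2l.
apply: (le_trans (ler_normD _ _)); rewrite addrA addrC -addrA.
apply: (@le_trans _ _ (`|A (y 0) *m x| + `|B (y 0) *m e| + `|x|)).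
  by rewrite -addrA lerD2l (le_trans (ler_normD _ _))// normrN addrC.
by have := HKA (y 0) x; have := HKB (y 0) e; lra.
Qed.

Lemma quenched_mean_step N x :
  `|quenched_mean phi N.+1 x - quenched_mean phi N x| <= step_cst x * EV N.
Proof.
have i1 := quenched_env_integrable N.+1 0 x; have i2 := quenched_env_integrable N 1 x.
have i12 := integrable_subR i1 i2.
have iV := translate_integrable N 1.
have iVc := integrable_scaleR (step_cst x) iV.
rewrite -(quenched_mean_translate N 1) /quenched_mean -(RintegralB measurableT i1 i2).
apply: (le_trans (le_normr_Rintegral measurableT i12)).
rewrite -(translate_mean N 1) -(RintegralZl _ measurableT iV).
apply: le_Rintegral => //; first exact: integrable_abse i12.
by move=> w _; exact: quenched_step_le.
Qed.

Lemma chain_mean (x0 : 'cV[R]_d) (X : nat -> Omega -> 'cV[R]_d) N :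
  (forall w, X 0%N w = x0) ->
  (forall t w, X t.+1 w = A (Y t%:Z w) *m X t w + B (Y t%:Z w) *m eps t.+1 w) ->
  \int[P]_w phi (X N w) = quenched_mean phi N x0.
Proof.
move=> X0 XS.
have mW : measurable_fun setT (cst 1 : pastType Y eps 0 -> R) by exact: measurable_cst.
have bW (w : Omega) : `|cst 1 w : R| <= 1 by rewrite normr1.
have := markov_property eps_iid eps_Y mA mB X0 XS uphi N mW bW.
rewrite add0n => E; transitivity (\int[P]_w (cst 1 w * phi (X N w))).
  by apply: eq_Rintegral => w _; rewrite mul1r.
by rewrite E; apply: eq_Rintegral => w _; rewrite mul1r X0.
Qed.

End unit_valued_test.

Lemma unit_valued_indic (E : set 'cV[R]_d) : measurable E -> unit_valued (\1_E : _ -> R).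
Proof.
move=> mE; split => [|x]; first exact: measurable_indic.
by rewrite indicE; case: (_ \in _); rewrite ?lexx ?ler01.
Qed.

(** The limit law has to exist before any process [X] is given; it is obtained from this explicit
    chain started at 0. *)
Fixpoint chain (x : 'cV[R]_d) t w : 'cV[R]_d :=
  match t with
  | 0 => x
  | t'.+1 => A (Y t'%:Z w) *m chain x t' w + B (Y t'%:Z w) *m eps t w
  end.

Variables (c C : R).
Hypotheses (c0 : 0 < c) (C0 : 0 < C)
  (VR : forall N, EV N <= C * expR (- c * N%:R `^ 3^-1)).

Lemma quenched_mean_cauchy : exists2 K : R, 0 < K &
  forall phi, unit_valued phi -> forall x N N', (N <= N')%N ->
  `|quenched_mean phi N x - quenched_mean phi N' x| <=
  step_cst x * K * expR (- (c / 2) * N%:R `^ 3^-1).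
Proof.
have [K K0 HK] := stretched_tail c0.
exists (C * K); first exact: mulr_gt0.
move=> phi uphi x N N' NN'.
have tel : `|quenched_mean phi N x - quenched_mean phi N' x| <=
    \sum_(N <= j < N') step_cst x * EV j.
  rewrite -(subnKC NN'); elim: (N' - N)%N => [|r IHr].
    by rewrite addn0 subrr normr0 big_geq.
  rewrite addnS big_nat_recr/= ?leq_addr//.
  apply: le_trans (ler_distD (quenched_mean phi (N + r) x) _ _) _.
  by rewrite lerD// distrC; exact: quenched_mean_step.
apply: (le_trans tel); rewrite -mulr_sumr -mulrA ler_pM2l ?step_cst_gt0//.
apply: (@le_trans _ _ (\sum_(N <= j < N') C * expR (- c * j%:R `^ 3^-1))).
  by apply: ler_sum_nat => j _; exact: VR.
by rewrite -mulr_sumr -mulrA ler_pM2l//; exact: HK.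
Qed.

Lemma limit_law : exists mu : probability 'cV[R]_d R, exists2 b : R, 0 < b &
  forall x, exists2 K : R, 0 < K & forall N E, measurable E ->
  `|quenched_mean \1_E N x - fine (mu E)| <= K * expR (- b * N%:R `^ 3^-1).
Proof.
have [K K0 HK] := quenched_mean_cauchy.
have mX N : measurable_fun setT (chain 0 N).
  exact: (@measurable_chain _ _ _ _ _ _ _ _ _ _ mA mB 0 (chain 0)).
have XE N E : measurable E -> fine (law P (mX N) E) = quenched_mean \1_E N 0.
  move=> mE; rewrite -(chain_mean (unit_valued_indic mE) (X := chain 0))//.
  have uE := unit_valued_indic mE.
  rewrite -(Rintegral_law (mX N) uE.1) ?Rintegral_indic//.
  apply: (@bounded_integrable _ _ _ P _ 1) => [|w]; first exact: (measurableT_comp uE.1).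
  by rewrite /= ger0_norm; have /andP[] := uE.2 (chain 0 N w).
have [mu Hmu] := @uniform_limit_probability R _ _ (fun N => law P (mX N))
  (fun N => step_cst 0 * K * expR (- (c / 2) * N%:R `^ 3^-1))
  (cvg_stretched_exp _ (divr_gt0 c0 (ltr0n R 2))) (fun N N' E NN' mE =>
   eq_ind_r (fun r => `|r - _| <= _) (eq_ind_r (fun r => `|_ - r| <= _)
     (HK _ (unit_valued_indic mE) 0 N N' NN') (XE N' E mE)) (XE N E mE)).
exists mu, (c / 2); first exact: divr_gt0.
(* The first term compares the starts [x] and 0 at time [N], the second is the tail of the chain
   started at 0. Only this constant depends on [x]. *)
move=> x; exists (C * (1 + `|x|) + step_cst 0 * K).
  by rewrite addr_gt0 ?mulr_gt0 ?step_cst_gt0// ltr_pwDl.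
move=> N E mE; have := Hmu N E mE; rewrite XE// => H.
apply: (le_trans (ler_distD (quenched_mean \1_E N 0) _ _)); rewrite mulrDl lerD//.
apply: (le_trans (quenched_mean_le (unit_valued_indic mE) _ _ _)).
rewrite subr0 mulrAC ler_wpM2r ?addr_ge0//.
apply: (le_trans (VR N)); rewrite ler_pM2l// ler_expR.
rewrite ler_wpM2r ?powR_ge0// lerN2 ler_pdivrMr// ler_peMr ?(ltW c0)//.
by rewrite ler1n.
Qed.

End limit_law.

(** * The law of large numbers *)

Section second_moment.
Context (R : realType) d (T : measurableType d) (P : probability T R).
Variable D : nat -> T -> R.
Hypotheses (mD : forall i, measurable_fun setT (D i)) (bD : forall i x, `|D i x| <= 1).

Definition partial_sum n x := \sum_(0 <= i < n) D i x.

Lemma partial_sum_bound r n x : (r <= n)%N -> `|partial_sum n x - partial_sum r x| <= (n - r)%:R.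
Proof.
move=> rn; rewrite -(subnKC rn) addKn; elim: (n - r)%N => [|k IHk].
  by rewrite addn0 subrr normr0.
rewrite addnS /partial_sum big_nat_recr//= -/(partial_sum _ x) addrAC -natr1.
by apply: (le_trans (ler_normD _ _)); rewrite lerD.
Qed.

Lemma partial_sum_le n x : `|partial_sum n x| <= n%:R.
Proof.
have := partial_sum_bound x (leq0n n); rewrite subn0.
by rewrite [partial_sum 0 x]/partial_sum big_nil subr0.
Qed.

Lemma measurable_partial_sum n : measurable_fun setT (partial_sum n).
Proof. exact: measurable_sum. Qed.

(** Expanding the square of the sum with one more term, the hypothesis bounds the cross term; the
    main part [e * n%:R ^+ 2] is small relative to n^2 without exact orthogonality. *)
Lemma partial_sum_second_moment (e L : R) n : 0 <= e ->
  (forall n, \int[P]_x (D n x * partial_sum n x) <= e * n%:R + L) ->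
  \int[P]_x (partial_sum n x) ^+ 2 <= e * n%:R ^+ 2 + (2 * L + 1) * n%:R.
Proof.
move=> e0 H; elim: n => [|n IHn].
  rewrite (_ : (fun x => _) = cst 0).
    by rewrite probability_Rintegral_cst mulr0 addr0 expr0n mulr0.
  by apply/funext => x; rewrite /partial_sum big_nil expr0n.
have mS := measurable_partial_sum n.
have iS : P.-integrable setT (EFin \o (fun x => partial_sum n x ^+ 2)).
  apply: (@bounded_integrable _ _ _ P _ (n%:R ^+ 2)) => [|x]; first exact: measurable_funX.
  by rewrite normrX; apply: lerXn2r; rewrite ?nnegrE ?normr_ge0 ?partial_sum_le.
have iDS : P.-integrable setT (EFin \o (fun x => D n x * partial_sum n x)).
  apply: (@bounded_integrable _ _ _ P _ n%:R) => [|x]; first exact: measurable_funM.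
  by rewrite normrM -[leRHS]mul1r; apply: ler_pM; rewrite ?normr_ge0 ?partial_sum_le.
have iD : P.-integrable setT (EFin \o (fun x => D n x ^+ 2)).
  apply: (@bounded_integrable _ _ _ P _ 1) => [|x]; first exact: measurable_funX.
  by rewrite normrX exprn_ile1.
have i2 := integrable_scaleR 2 iDS.
have i12 := integrable_addR iS i2.
have -> : (fun x => partial_sum n.+1 x ^+ 2) =
    (fun x => partial_sum n x ^+ 2 + 2 * (D n x * partial_sum n x) + D n x ^+ 2).
  apply/funext => x; rewrite /partial_sum big_nat_recr//= -/(partial_sum n x); ring.
rewrite (RintegralD measurableT i12 iD) (RintegralD measurableT iS i2).
rewrite (RintegralZl _ measurableT iDS).
have h1 : \int[P]_x D n x ^+ 2 <= 1.
  apply: le_trans (ler_norm _) _; apply: probability_Rintegral_bound.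
    exact: measurable_funX.
  by move=> x; rewrite normrX exprn_ile1.
have h2 := H n.
have -> : e * n.+1%:R ^+ 2 + (2 * L + 1) * n.+1%:R =
  e * n%:R ^+ 2 + (2 * L + 1) * n%:R + 2 * (e * n%:R + L) + 1 + e.
  by rewrite -natr1; ring.
move: IHn h1 h2; set a1 := \int[P]_x _; set a2 := \int[P]_x _; set a3 := \int[P]_x _.
by move: a1 a2 a3 (e * n%:R ^+ 2 + _) (e * n%:R + L) => a1 a2 a3 a4 a5; lra.
Qed.

(** Uses |r| <= r^2 / (2 del) + del / 2, which avoids square roots of integrals. *)
Lemma partial_sum_mean_abs (e L del : R) n : 0 <= e -> 0 < del -> (0 < n)%N ->
  (forall n, \int[P]_x (D n x * partial_sum n x) <= e * n%:R + L) ->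
  \int[P]_x `|partial_sum n x / n%:R| <=
  (e + (2 * L + 1) / n%:R) / (2 * del) + del / 2.
Proof.
move=> e0 del0 n0 H; have Hn := partial_sum_second_moment n e0 H.
have mS := measurable_partial_sum n.
have n0' : (0 : R) < n%:R by rewrite ltr0n.
have iS : P.-integrable setT (EFin \o (fun x => partial_sum n x ^+ 2)).
  apply: (@bounded_integrable _ _ _ P _ (n%:R ^+ 2)) => [|x]; first exact: measurable_funX.
  by rewrite normrX; apply: lerXn2r; rewrite ?nnegrE ?normr_ge0 ?partial_sum_le.
pose k := (n%:R ^+ 2 * (2 * del))^-1.
have k0 : 0 < k by rewrite invr_gt0 mulr_gt0 ?exprn_gt0// mulr_gt0.
have i1 := integrable_scaleR k iS.
have i2 := finite_measure_integrable_cst P (del / 2) measurableT.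
apply: (@le_trans _ _ (\int[P]_x (k * partial_sum n x ^+ 2 + cst (del / 2) x))).
  apply: le_Rintegral => //.
  - apply: (@bounded_integrable _ _ _ P _ 1) => [|x].
      by apply: measurableT_comp => //; exact: measurable_funM.
    rewrite normr_id normrM normfV (ger0_norm (ltW n0')) ler_pdivrMr// mul1r.
    exact: partial_sum_le.
  - exact: integrable_addR i1 i2.
  - move=> x _ /=; set s := partial_sum n x.
    have -> : k * s ^+ 2 = `|s / n%:R| ^+ 2 / (2 * del).
      by rewrite real_normK ?num_real// /k; field; rewrite !gt_eqF.
    move: (`|s / n%:R|) => r; rewrite -subr_ge0.
    have -> : r ^+ 2 / (2 * del) + del / 2 - r = (r - del) ^+ 2 / (2 * del).
      by field; rewrite gt_eqF.
    by rewrite divr_ge0 ?sqr_ge0// mulr_ge0// ltW.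
rewrite (RintegralD measurableT i1 i2) (RintegralZl _ measurableT iS).
rewrite probability_Rintegral_cst lerD2r.
apply: (le_trans (ler_wpM2l (ltW k0) Hn)).
rewrite le_eqVlt; apply/orP; left; apply/eqP; rewrite /k; field.
by rewrite !gt_eqF.
Qed.

End second_moment.

Lemma shifted_sum_le (R : realType) (a : nat -> R) (k n : nat) :
  (forall i, 0 <= a i <= 1) ->
  `|\sum_(1 <= i < n.+1) a i - \sum_(0 <= i < n) a (i + k)%N| <= k.+1%:R.
Proof.
move=> a01.
have step j : `|\sum_(0 <= i < n) a (i + j.+1)%N - \sum_(0 <= i < n) a (i + j)%N| <= 1.
  have -> : \sum_(0 <= i < n) a (i + j.+1)%N - \sum_(0 <= i < n) a (i + j)%N =
      a (n + j)%N - a j.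
    rewrite -sumrB (eq_bigr (fun i => a (i.+1 + j)%N - a (i + j)%N)).
      by rewrite (telescope_sumr (fun i => a (i + j)%N)).
    by move=> i _; rewrite addSnnS.
  by have := a01 (n + j)%N; have := a01 j; rewrite ler_norml; lra.
have s1 : \sum_(1 <= i < n.+1) a i = \sum_(0 <= i < n) a (i + 1)%N.
  by rewrite big_add1/=; apply: eq_bigr => i _; rewrite addn1.
elim: k => [|k IHk].
  by rewrite s1; exact: step.
apply: (@le_trans _ _ (k.+1%:R + 1)); last by rewrite natr1.
apply: le_trans (ler_distD (\sum_(0 <= i < n) a (i + k)%N) _ _) _.
by rewrite lerD// distrC.
Qed.
Lemma unit_dist (R : realType) (a b : R) : 0 <= a <= 1 -> 0 <= b <= 1 -> `|a - b| <= 1.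
Proof. by rewrite ler_norml; lra. Qed.

Section law_of_large_numbers.
Context (R : realType) (m d : nat) (disp : measure_display)
  (Omega : measurableType disp) (P : probability Omega R).
Variables (Y : int -> {RV P >-> 'cV[R]_m}) (eps : nat -> {RV P >-> 'cV[R]_d}).
Variables (A B : 'cV[R]_m -> 'M[R]_d).
Hypotheses (mA : measurable_fun setT A) (mB : measurable_fun setT B)
  (Ystat : strictly_stationary Y) (eps_iid : iid [set t | (1 <= t)%N] eps)
  (eps_Y : independent_processes [set t | (1 <= t)%N] setT eps Y).

Let nu : probability 'cV[R]_d R := distribution P (eps 1%N).

Variable V : nat -> pathType 'cV[R]_m -> R.
Hypotheses (mbV : forall N, measurable_fun setT (V N) /\ exists K, forall y, `|V N y| <= K)
  (V0 : forall N y, 0 <= V N y)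
  (VQ : forall N (phi : 'cV[R]_d -> R), unit_valued phi -> forall y z z',
     `|quenched A B nu N 0 phi y z - quenched A B nu N 0 phi y z'| <=
     V N y * (1 + `|z - z'|)).

Let EV N := \int[P]_w V N (fun j => Y j w).

Variables (x0 : 'cV[R]_d) (X : nat -> {RV P >-> 'cV[R]_d}).
Hypotheses (X0 : forall w, X 0%N w = x0)
  (XS : forall t w,
     X t.+1 w = A (Y t%:Z w) *m X t w + B (Y t%:Z w) *m eps t.+1 w).

Variables (mu : probability 'cV[R]_d R) (u : nat -> R).
Hypotheses (EV_cvg : EV @ \oo --> (0 : R)) (u_cvg : u @ \oo --> (0 : R))
  (tvX : forall N E, measurable E ->
     `|fine (P (X N @^-1` E)) - fine (mu E)| <= u N).

Let mX N : measurable_fun setT (X N) := measurable_funP (X N).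

Lemma chain_Rintegral_le (phi : 'cV[R]_d -> R) N : unit_valued phi ->
  `|\int[P]_w phi (X N w) - \int[mu]_z phi z| <= u N.
Proof.
move=> uphi; rewrite -(Rintegral_law (mX N) uphi.1); last first.
  apply: (@bounded_integrable _ _ _ P _ 1) => [|w]; first exact: (measurableT_comp uphi.1).
  by rewrite /= ger0_norm; have /andP[] := uphi.2 (X N w).
by apply: tv_Rintegral_le; [exact: tvX|exact: uphi.1|exact: uphi.2].
Qed.

Definition far (M : R) : set 'cV[R]_d := [set z | M < `|z - x0|].

Lemma measurable_far M : measurable (far M).
Proof.
rewrite (_ : far M = (fun z : 'cV[R]_d => `|z - x0|) @^-1` `]M, +oo[%classic); last first.
  by apply/seteqP; split => z /=; rewrite in_itv/= andbT.
rewrite -[X in measurable X]setTI; suff mf : measurable_fun setT (fun z : 'cV[R]_d => `|z - x0|).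
  by apply: mf => //; exact: measurable_itv.
apply: (measurableT_comp (@measurable_normmx R d)).
by apply: measurable_addmx => //; exact: measurable_cst.
Qed.

(** The single law [mu] is tight, and the convergence in total variation passes this on to the chain
    at late times; no moment of the chain is estimated. *)
Lemma tightness (e : R) : 0 < e -> exists (M : R) (s0 : nat), 0 <= M /\
  forall s, (s0 <= s)%N -> \int[P]_w \1_(far M) (X s w) <= e.
Proof.
move=> e0; have e20 : 0 < e / 2 by rewrite divr_gt0.
have ufar n := unit_valued_indic (measurable_far n).
have ub n z : `|\1_(far n) z| <= (1 : R).
  by have /andP[? ?] := (ufar n).2 z; rewrite ger0_norm.
have : (fun n : nat => \int[mu]_z \1_(far n%:R) z) @ \oo --> (\int[mu]_z (0 : R)).
  apply: (@bounded_cvg_Rintegral R _ _ mu (fun n => \1_(far n%:R)) (fun=> 0) set0 1) => //.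
  - by move=> n; exact: (ufar _).1.
  - by move=> x; rewrite normr0.
  - move=> z _; apply: cvg_near_cst; near=> n.
    rewrite indicE memNset//= /far/=; apply/negP; rewrite -leNgt.
    near: n; exact: nbhs_infty_ger.
rewrite probability_Rintegral_cst => /cvgrPdist_le /(_ _ e20)[n _ /(_ n (leqnn n))].
rewrite sub0r normrN => Hn.
have /cvgrPdist_le /(_ _ e20)[s0 _ Hs] := u_cvg.
exists n%:R, s0; split => // s ss0.
have := Hs s ss0; rewrite sub0r normrN => us.
have := chain_Rintegral_le s (ufar n%:R).
rewrite ler_norml => /andP[_]; rewrite lerBlDl => /le_trans; apply.
by rewrite (splitr e) lerD// (le_trans (ler_norm _)).
Unshelve. all: by end_near. Qed.

Section test_function.
Variables (phi : 'cV[R]_d -> R) (uphi : unit_valued phi).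

Lemma measurable_test N : measurable_fun setT (fun w => phi (X N w)).
Proof. exact: (measurableT_comp uphi.1). Qed.

Definition frozen k (i : nat) w := quenched A B nu k i%:Z phi (fun j => Y j w) x0.

Lemma measurable_frozen k i : measurable_fun setT (frozen k i).
Proof. by apply: measurable_quenched => // j; exact: measurable_funP. Qed.

Lemma frozen01 k i w : 0 <= frozen k i w <= 1.
Proof. by rewrite quenched_ge0//= quenched_le1. Qed.

Definition fluctuation k i w := phi (X (i + k)%N w) - frozen k i w.

Lemma fluctuation_past k i n : (i + k <= n)%N ->
  measurable_fun setT (fluctuation k i : pastType Y eps n -> R).
Proof.
move=> ikn; apply: measurable_funB.
  apply: (measurableT_comp uphi.1).
  exact: (past_measurable_chain mA mB X0 XS ikn).
by apply: measurable_quenched => // j; exact: past_measurable_env.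
Qed.

Lemma measurable_fluctuation k i : measurable_fun setT (fluctuation k i).
Proof. exact: measurable_funB (measurable_test _) (measurable_frozen _ _). Qed.

Lemma fluctuation_le1 k i w : `|fluctuation k i w| <= 1.
Proof.
exact: unit_dist (uphi.2 _) (frozen01 _ _ _).
Qed.

(* Conditionally on the past up to time [i], the fluctuation has the mean of the
   difference between the chain started from [X i] and the one started from [x0]. *)
Lemma fluctuation_corr k i (W : Omega -> R) (K M : R) : 0 <= M ->
  measurable_fun setT (W : pastType Y eps i -> R) -> (forall w, `|W w| <= K) ->
  `|\int[P]_w (W w * fluctuation k i w)| <=
    K * (\int[P]_w \1_(far M) (X i w) + (1 + M) * EV k).
Proof.
move=> M0 mW bW.
have mW' : measurable_fun setT W := pastType_measurable mW.
have K0 w : 0 <= K := le_trans (normr_ge0 (W w)) (bW w).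
have bound (g : Omega -> R) : measurable_fun setT g -> (forall w, 0 <= g w <= 1) ->
    P.-integrable setT (EFin \o (fun w => W w * g w)).
  move=> mg g01; apply: (@bounded_integrable _ _ _ P _ K) => [|w].
    exact: measurable_funM.
  rewrite normrM -[leRHS]mulr1; have /andP[g0 g1] := g01 w.
  by apply: ler_pM => //; rewrite ger0_norm.
pose q w := quenched A B nu k i%:Z phi (fun j => Y j w) (X i w).
have mq : measurable_fun setT q.
  by apply: measurable_quenched => // j; exact: measurable_funP.
have q01 w : 0 <= q w <= 1 by rewrite /q quenched_ge0//= quenched_le1.
have i1 := bound _ (measurable_test (i + k)) (fun w => uphi.2 _).
have i2 := bound _ (measurable_frozen k i) (frozen01 k i).
have i3 := bound _ mq q01.
have i32 := integrable_subR i3 i2.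
have -> : \int[P]_w (W w * fluctuation k i w) =
    \int[P]_w (W w * q w - W w * frozen k i w).
  rewrite (RintegralB measurableT i3 i2).
  rewrite -(markov_property eps_iid eps_Y mA mB X0 XS uphi k mW bW).
  rewrite -(RintegralB measurableT i1 i2); apply: eq_Rintegral => w _.
  by rewrite /fluctuation mulrBr.
apply: (le_trans (le_normr_Rintegral measurableT i32)).
have ufar := unit_valued_indic (measurable_far M).
have ifar : P.-integrable setT (EFin \o (fun w => \1_(far M) (X i w) : R)).
  apply: (@bounded_integrable _ _ _ P _ 1) => [|w]; first exact: (measurableT_comp ufar.1).
  by have /andP[? ?] := ufar.2 (X i w); rewrite ger0_norm.
have iV := translate_integrable Y mbV k i%:Z.
have iVM := integrable_scaleR (1 + M) iV.
have is1 := integrable_addR ifar iVM.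
have is2 := integrable_scaleR K is1.
rewrite -[EV k](translate_mean Ystat mbV k i%:Z) -(RintegralZl _ measurableT iV).
rewrite -(RintegralD measurableT ifar iVM) -(RintegralZl _ measurableT is1).
apply: le_Rintegral => //; first exact: integrable_abse i32.
move=> w _ /=; rewrite -mulrBr normrM; apply: ler_pM => //.
have v0 : 0 <= V k (fun j => Y (j + i) w) by exact: V0.
(* Far from [x0] the trivial bound 1 is charged to the indicator; otherwise the distance of the two
   starts is at most [M]. *)
rewrite indicE; have [|] := boolP (X i w \in far M).
  rewrite inE => _; apply: (le_trans (unit_dist (q01 w) (frozen01 k i w))).
  by rewrite lerDl mulr_ge0// addr_ge0.
rewrite notin_setE /far/= => /negP; rewrite -leNgt => XM.
apply: (le_trans (quenched_translate_le VQ _ _ _ _ _ uphi)).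
by rewrite add0r mulrC ler_wpM2r// lerD2l.
Qed.

(** [fluctuation k i] is known at time [i + k], so only the terms up to [n - k] belong to the past
    at [n] and are nearly uncorrelated with [fluctuation k n]. The at most [k] overlapping terms
    cost [k], and before [s0], where tightness is missing, the whole sum is at most [s0]. *)
Lemma fluctuation_partial k (e : R) (s0 : nat) (M : R) : 0 <= e -> 0 <= M ->
  (forall s, (s0 <= s)%N -> \int[P]_w \1_(far M) (X s w) + (1 + M) * EV k <= e) ->
  forall n, \int[P]_w (fluctuation k n w * partial_sum (fluctuation k) n w) <=
    e * n%:R + (k + s0)%:R.
Proof.
move=> e0 M0 He n.
have mF i := measurable_fluctuation k i; have bF := fluctuation_le1 k.
have mS r := measurable_partial_sum mF r.
have iprod (g : Omega -> R) (K : R) : measurable_fun setT g -> (forall w, `|g w| <= K) ->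
    P.-integrable setT (EFin \o (fun w => fluctuation k n w * g w)).
  move=> mg bg; apply: (@bounded_integrable _ _ _ P _ K) => [|w].
    exact: measurable_funM.
  by rewrite normrM -[leRHS]mul1r; apply: ler_pM.
have bprod (g : Omega -> R) (K : R) : measurable_fun setT g -> (forall w, `|g w| <= K) ->
    \int[P]_w (fluctuation k n w * g w) <= K.
  move=> mg bg; apply: le_trans (ler_norm _) _; apply: probability_Rintegral_bound.
    exact: measurable_funM.
  by move=> w; rewrite normrM -[leRHS]mul1r; apply: ler_pM.
have [ns|sn] := ltnP n s0.
  apply: (le_trans (bprod _ _ (mS n) (partial_sum_le bF n))).
  apply: (@le_trans _ _ (k + s0)%:R); last by rewrite lerDr mulr_ge0.
  by rewrite ler_nat (leq_trans (ltnW ns))// leq_addl.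
pose r := (n - k)%N.
have rn : (r <= n)%N by exact: leq_subr.
pose g w := partial_sum (fluctuation k) n w - partial_sum (fluctuation k) r w.
have mg : measurable_fun setT g by exact: measurable_funB.
have bg w : `|g w| <= k%:R.
  by apply: (le_trans (partial_sum_bound bF w rn)); rewrite ler_nat /r; lia.
have i1 := iprod _ _ (mS r) (partial_sum_le bF r); have i2 := iprod _ _ mg bg.
have -> : \int[P]_w (fluctuation k n w * partial_sum (fluctuation k) n w) =
   \int[P]_w (fluctuation k n w * partial_sum (fluctuation k) r w) +
   \int[P]_w (fluctuation k n w * g w).
  rewrite -(RintegralD measurableT i1 i2); apply: eq_Rintegral => w _.
  by rewrite /g -mulrDr addrC subrK.
have pS : measurable_fun setT (partial_sum (fluctuation k) r : pastType Y eps n -> R).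
  have [kn|nk] := leqP k n; last first.
    have -> : partial_sum (fluctuation k) r = cst 0.
      apply/funext => w; rewrite /partial_sum /r.
      by rewrite (_ : (n - k)%N = 0%N) ?big_nil//; lia.
    exact: measurable_cst.
  have aux j : (j <= r)%N ->
      measurable_fun setT (partial_sum (fluctuation k) j : pastType Y eps n -> R).
    elim: j => [_|j IHj jr].
      rewrite (_ : partial_sum _ _ = cst 0); first exact: measurable_cst.
      by apply/funext => w; rewrite /partial_sum big_nil.
    rewrite (_ : partial_sum (fluctuation k) j.+1 =
      fun w => partial_sum (fluctuation k) j w + fluctuation k j w); last first.
      by apply/funext => w; rewrite /partial_sum big_nat_recr.
    apply: measurable_funD; first by apply: IHj; exact: ltnW.
    by apply: fluctuation_past; rewrite /r in jr; lia.
  exact: aux.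
have c1 := fluctuation_corr k M0 pS (partial_sum_le bF r).
have h1 : \int[P]_w (fluctuation k n w * partial_sum (fluctuation k) r w) <= e * n%:R.
  rewrite (_ : Rintegral _ _ _ = \int[P]_w (partial_sum (fluctuation k) r w * fluctuation k n w)).
    apply: (le_trans (ler_norm _)); apply: (le_trans c1).
    rewrite mulrC; apply: ler_pM => //; last by rewrite ler_nat.
      by rewrite addr_ge0 ?mulr_ge0 ?addr_ge0 ?(env_mean_ge0 Y V0)//; exact: Rintegral_ge0.
    exact: He.
  by apply: eq_Rintegral => w _; rewrite mulrC.
apply: lerD => //; apply: (le_trans (bprod _ _ mg bg)).
by rewrite ler_nat leq_addr.
Qed.

Hypothesis Yerg : ergodic_process Y.

(** [Omega] carries no shift, so the mean ergodic theorem is applied to the law of [Y] on path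
    space; [frozen k i] is one function of the path evaluated after [i] shifts. *)
Lemma frozen_mean_ergodic k :
  (fun n => \int[P]_w `|(\sum_(0 <= i < n) frozen k i w) / n%:R -
                        quenched_mean Y eps A B phi k x0|) @ \oo --> (0 : R).
Proof.
pose h (y : pathType 'cV[R]_m) := quenched A B nu k 0 phi y x0.
have mh : measurable_fun setT h.
  by apply: measurable_quenched => // j; exact: measurable_coordinate.
have hb y : `|h y| <= 1 by exact: quenched_norm_le1.
have mpath : measurable_fun setT (fun w => (fun j => Y j w) : pathType 'cV[R]_m).
  by apply: measurable_path => j; exact: measurable_funP.
pose S (y : pathType 'cV[R]_m) : pathType 'cV[R]_m := fun j => y (j + 1).
have mS : measurable_fun setT S by exact: measurable_translation.
pose Q : probability (pathType 'cV[R]_m) R := law P mpath.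
have SQ E : measurable E -> Q (S @^-1` E) = Q E by exact: (stationary_path Ystat 1).
have Serg E : measurable E -> S @^-1` E = E -> Q E = 0%E \/ Q E = 1%E.
  by move=> mE SE; apply: Yerg => //; rewrite path_measurableE.
have iterS i y : iter i S y = fun j => y (j + i%:Z).
  elim: i => [|i IHi] /=; first by apply/funext => j; rewrite addr0.
  by rewrite IHi; apply/funext => j; rewrite /S -addrA -(addn1 i) PoszD (addrC 1).
have := mean_ergodic mS SQ Serg mh hb.
have -> : \int[Q]_y h y = quenched_mean Y eps A B phi k x0.
  apply: (Rintegral_law mpath mh).
  apply: (@bounded_integrable _ _ _ P _ 1) => [|w]; last exact: hb.
  exact: (measurableT_comp mh mpath).
move: (quenched_mean Y eps A B phi k x0) => c.
apply: cvg_trans; apply: near_eq_cvg; near=> n.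
pose g y := `|birkhoff S h n y / n%:R - c|.
have mg : measurable_fun setT g.
  apply: measurableT_comp => //; apply: measurable_funB => //.
  by apply: measurable_funM => //; exact: measurable_birkhoff.
have bg y : `|g y| <= n%:R * 1 / n%:R + `|c|.
  rewrite normr_id; apply: (le_trans (ler_normB _ _)); rewrite lerD2r.
  rewrite normrM [X in _ * X]ger0_norm ?invr_ge0//.
  by rewrite ler_wpM2r ?invr_ge0//; exact: birkhoff_le.
have ig : P.-integrable setT (EFin \o (g \o (fun w => (fun j => Y j w) : pathType 'cV[R]_m))).
  apply: (@bounded_integrable _ _ _ P _ (n%:R * 1 / n%:R + `|c|)) => [|w]; last exact: bg.
  exact: (measurableT_comp mg mpath).
apply: etrans (Rintegral_law mpath mg ig) _.
apply: eq_Rintegral => w _; rewrite /g /birkhoff; congr (`|_ / _ - _|).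
apply: eq_bigr => i _; rewrite iterS /h /frozen.
by have := quenched_shift A B nu phi k 0 i (fun j => Y j w) x0; rewrite add0r.
Unshelve. all: by end_near. Qed.

(** The choices are nested: tightness gives the radius [M], then a delay [k] makes [(1 + M) * EV k]
    and the bias small, and only then does [n] grow. *)
Lemma law_of_large_numbers_L1 :
  (fun n => \int[P]_w `|(\sum_(1 <= i < n.+1) phi (X i w)) / n%:R - \int[mu]_z phi z|)
    @ \oo --> (0 : R).
Proof.
apply/cvgrPdist_le => e e0.
have e8 : 0 < e / 8 by rewrite divr_gt0.
have sum8 (a1 a2 : R) : a1 <= 3 * (e / 8) -> a2 <= e / 8 ->
    e / 8 + e / 8 + (a1 + a2) <= e by lra.
pose del := e / 4; have del0 : 0 < del by rewrite divr_gt0.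
(* With [del] equal to e / 4, the bound [(e1 + e1) / (2 * del) + del / 2] of the fluctuation term is
   exactly 3 e / 8. *)
pose e1 := 2 * del * (e / 8); have e10 : 0 < e1 by rewrite !mulr_gt0.
have e12 : 0 < e1 / 2 by rewrite divr_gt0.
have [M [s0 [M0 tight]]] := tightness e12.
have M1 : 0 < 1 + M by rewrite ltr_pwDl.
have [k [EVk uk]] : exists k, (1 + M) * EV k <= e1 / 2 /\ u k <= e / 8.
  have /cvgrPdist_le /(_ _ (divr_gt0 e12 M1)) h1 := EV_cvg.
  have /cvgrPdist_le /(_ _ e8) h2 := u_cvg.
  have [k0 _ Hk] : \forall k \near \oo, (1 + M) * EV k <= e1 / 2 /\ u k <= e / 8.
    near=> k; split.
      rewrite mulrC -ler_pdivlMr//; apply: le_trans (ler_norm _) _.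
      by rewrite -normrN -sub0r; near: k.
    apply: le_trans (ler_norm _) _.
    by rewrite -normrN -sub0r; near: k.
  by exists k0; apply: Hk => /=.
have Hk s : (s0 <= s)%N -> \int[P]_w \1_(far M) (X s w) + (1 + M) * EV k <= e1.
  by move=> ss0; rewrite (splitr e1) lerD// tight.
have Hpart := fluctuation_partial (ltW e10) M0 Hk.
set L : R := (k + s0)%:R in Hpart.
have /cvgrPdist_le /(_ _ e8) Herg := frozen_mean_ergodic k.
set qm := quenched_mean Y eps A B phi k x0 in Herg.
have mT n : measurable_fun setT (fun w => (\sum_(1 <= i < n.+1) phi (X i w)) / n%:R).
  apply: measurable_funM => //; apply: measurable_sum => i; exact: measurable_test.
have mG n : measurable_fun setT (fun w => (\sum_(0 <= i < n) frozen k i w) / n%:R).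
  by apply: measurable_funM => //; apply: measurable_sum => i; exact: measurable_frozen.
pose S n w := partial_sum (fluctuation k) n w / n%:R.
have mS n : measurable_fun setT (S n).
  apply: measurable_funM => //; apply: measurable_partial_sum => i.
  exact: measurable_fluctuation.
have avg01 n (a : nat -> R) : (forall i, 0 <= a i <= 1) ->
    `|(\sum_(0 <= i < n) a i) / n%:R| <= 1.
  move=> a01; rewrite normrM [X in _ * X]ger0_norm ?invr_ge0//.
  case: n => [|n]; first by rewrite invr0 mulr0.
  rewrite ler_pdivrMr// mul1r; apply: le_trans (ler_norm_sum _ _ _) _.
  have -> : n.+1%:R = \sum_(0 <= i < n.+1) (1 : R) by rewrite sumr_const_nat subn0.
  apply: ler_sum => i _; by have /andP[a0 a1] := a01 i; rewrite ger0_norm.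
near=> n.
have n0 : (0 < n)%N by near: n; exact: nbhs_infty_gt.
have n0' : (0 : R) < n%:R by rewrite ltr0n.
rewrite sub0r normrN ger0_norm; last exact: Rintegral_ge0.
have hqm : `|qm - \int[mu]_z phi z| <= e / 8.
  rewrite /qm -(chain_mean mA mB eps_iid eps_Y uphi k X0 XS).
  exact: le_trans (chain_Rintegral_le k uphi) uk.
have h1 : \int[P]_w `|S n w| <= 3 * (e / 8).
  apply: le_trans (partial_sum_mean_abs (measurable_fluctuation k)
    (fluctuation_le1 k) (ltW e10) del0 n0 Hpart) _.
  have hL : (2 * L + 1) / n%:R <= e1.
    rewrite ler_pdivrMr// -ler_pdivrMl//; near: n; exact: nbhs_infty_ger.
  apply: (@le_trans _ _ ((e1 + e1) / (2 * del) + del / 2)).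
    by rewrite lerD2r ler_wpM2r ?lerD2l// invr_ge0 mulr_ge0// ltW.
  rewrite le_eqVlt; apply/orP; left; apply/eqP; rewrite /e1 /del; field.
  by rewrite gt_eqF.
have h2 : \int[P]_w `|(\sum_(0 <= i < n) frozen k i w) / n%:R - qm| <= e / 8.
  apply: le_trans (ler_norm _) _; rewrite -normrN -[X in `|X|]sub0r.
  by near: n; exact: Herg.
have h3 : k.+1%:R / n%:R <= e / 8.
  rewrite ler_pdivrMr// -ler_pdivrMl//; near: n; exact: nbhs_infty_ger.
have i0 := finite_measure_integrable_cst P (e / 8 + e / 8) measurableT.
have i1 : P.-integrable setT (EFin \o (fun w => `|S n w|)).
  apply: (@bounded_integrable _ _ _ P _ 1) => [|w]; first exact: measurableT_comp.
  rewrite normr_id normrM [X in _ * X]ger0_norm ?invr_ge0// ler_pdivrMr// mul1r.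
  exact: partial_sum_le (fluctuation_le1 k) _ _.
have i2 : P.-integrable setT (EFin \o (fun w =>
    `|(\sum_(0 <= i < n) frozen k i w) / n%:R - qm|)).
  apply: (@bounded_integrable _ _ _ P _ (1 + `|qm|)) => [|w].
    by apply: measurableT_comp => //; exact: measurable_funB.
  rewrite normr_id; apply: (le_trans (ler_normB _ _)); rewrite lerD2r.
  by apply: avg01 => i; exact: frozen01.
have i12 := integrable_addR i1 i2.
have i3 := integrable_addR i0 i12.
apply: (@le_trans _ _ (\int[P]_w (cst (e / 8 + e / 8) w + (`|S n w| +
    `|(\sum_(0 <= i < n) frozen k i w) / n%:R - qm|)))); last first.
  rewrite (RintegralD measurableT i0 i12) (RintegralD measurableT i1 i2).
  rewrite probability_Rintegral_cst.
  move: h1 h2; set a1 := \int[P]_w _; set a2 := \int[P]_w _; move: a1 a2 => a1 a2.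
  exact: sum8.
apply: le_Rintegral => //.
  apply: (@bounded_integrable _ _ _ P _ (1 + `|\int[mu]_z phi z|)) => [|w].
    by apply: measurableT_comp => //; exact: measurable_funB.
  rewrite normr_id; apply: (le_trans (ler_normB _ _)); rewrite lerD2r.
  rewrite big_add1/=; apply: (avg01 n (fun i => phi (X i.+1 w))) => i; exact: uphi.2.
move=> w _; rewrite /cst/=.
(* The four pieces are the shift of indices by [k], the bias of the mean at time [k], the averaged
   fluctuations, and the ergodic average. *)
have split : (\sum_(1 <= i < n.+1) phi (X i w)) / n%:R - \int[mu]_z phi z =
  (\sum_(1 <= i < n.+1) phi (X i w) - \sum_(0 <= i < n) phi (X (i + k)%N w)) / n%:R +
  (qm - \int[mu]_z phi z) +
  (S n w + ((\sum_(0 <= i < n) frozen k i w) / n%:R - qm)).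
  rewrite /S /partial_sum sumrB; move: n0' (\sum_(0 <= i < n) _) (\sum_(0 <= i < n) _)
    (\sum_(1 <= i < n.+1) _) (Rintegral _ _ _) (qm) => n0' b1 b2 b3 b4 b5.
  by field; rewrite gt_eqF.
rewrite split; apply: le_trans (ler_normD _ _) _; apply: lerD; last exact: ler_normD.
apply: le_trans (ler_normD _ _) _; apply: lerD => //; apply: le_trans h3.
rewrite normrM [X in _ * X]ger0_norm ?invr_ge0// ler_wpM2r ?invr_ge0//.
by apply: (shifted_sum_le (a := fun i => phi (X i w))) => i; exact: uphi.2.
Unshelve. all: by end_near. Qed.

End test_function.
End law_of_large_numbers.

(** * Convergence in [L^q] and conclusion *)

Lemma Lnorm_cvg0 (R : realType) d (T : measurableType d) (P : probability T R)
    (Z : nat -> T -> R) (K q : R) : 1 <= q ->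
  (forall n, measurable_fun setT (Z n)) -> (forall n x, `|Z n x| <= K) ->
  (fun n => \int[P]_x `|Z n x|) @ \oo --> (0 : R) ->
  (fun n => 'N[P]_(q%:E)[EFin \o Z n]%E) @ \oo --> 0%E.
Proof.
move=> q1 mZ bZ cZ; have q0 : 0 < q by exact: lt_le_trans q1.
have mZq n : measurable_fun setT (fun x => `|Z n x| `^ q).
  by apply: (measurableT_comp (measurable_powR q)); exact: measurableT_comp.
have bZq n x : `| `|Z n x| `^ q| <= K `^ q.
  rewrite ger0_norm ?powR_ge0//; apply: ge0_ler_powR; rewrite ?nnegrE ?(ltW q0)//.
  exact: le_trans (bZ n x).
have iZq n : P.-integrable setT (EFin \o (fun x => `|Z n x| `^ q)).
  exact: (@bounded_integrable _ _ _ P _ (K `^ q) (mZq n) (bZq n)).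
pose r n := \int[P]_x (`|Z n x| `^ q).
have NE n : ('N[P]_(q%:E)[EFin \o Z n] = (r n `^ q^-1)%:E)%E.
  rewrite unlock -poweR_EFin; congr (_ `^ _)%E.
  have fin := integrable_fin_num measurableT (iZq n).
  by rewrite /r /Rintegral (fineK fin); apply: eq_integral => x _; rewrite /= -poweR_EFin.
have r0 n : 0 <= r n by apply: Rintegral_ge0 => x _; exact: powR_ge0.
have iZ n : P.-integrable setT (EFin \o (fun x => `|Z n x|)).
  apply: (@bounded_integrable _ _ _ P _ K) => [|x]; first exact: measurableT_comp.
  by rewrite normr_id.
(* For variables bounded by [K], q - 1 of the q factors are bounded by [K], which reduces the claim
   to convergence in L^1. *)
have rle n : r n <= K `^ (q - 1) * \int[P]_x `|Z n x|.
  rewrite -(RintegralZl _ measurableT (iZ n)); apply: le_Rintegral => //.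
  - exact: integrable_scaleR (iZ n).
  - move=> x _; rewrite -mulr_powRB1// mulrC ler_wpM2r//.
    apply: ge0_ler_powR; rewrite ?nnegrE ?subr_ge0//.
    exact: le_trans (bZ n x).
have cr : r @ \oo --> (0 : R).
  apply: (@squeeze_cvgr _ _ _ _ (fun=> 0) (fun n => K `^ (q - 1) * \int[P]_x `|Z n x|)).
  - by near=> n; rewrite r0 rle.
  - exact: cvg_cst.
  - by rewrite -[X in _ --> X](mulr0 (K `^ (q - 1))); apply: cvgM => //; exact: cvg_cst.
rewrite (_ : (fun n => _) = EFin \o (fun n => r n `^ q^-1)); last exact/funext.
apply/cvg_EFin; first by near=> n.
apply/cvgrPdist_le => e e0.
have eq0 : 0 < e `^ q by exact: powR_gt0.
have /cvgrPdist_le /(_ _ eq0) [n0 _ Hn] := cr; exists n0 => // n nn0.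
have := Hn n nn0; rewrite /= !sub0r !normrN !ger0_norm ?powR_ge0// => re.
rewrite -[leRHS](powRr1 (ltW e0)) -(mulfV (lt0r_neq0 q0)) powRrM.
by apply: ge0_ler_powR; rewrite ?nnegrE ?powR_ge0// invr_ge0 ltW.
Unshelve. all: by end_near. Qed.

Lemma averages_Lq (R : realType) (d : nat) disp (Omega : measurableType disp)
    (P : probability Omega R) (X : nat -> Omega -> 'cV[R]_d)
    (mu : probability 'cV[R]_d R) :
  (forall n, measurable_fun setT (X n)) ->
  (forall phi, unit_valued phi -> (fun n => \int[P]_w
     `|(\sum_(1 <= i < n.+1) phi (X i w)) / n%:R - \int[mu]_z phi z|) @ \oo --> (0 : R)) ->
  forall (Phi : 'cV[R]_d -> R) (K q : R), measurable_fun setT Phi ->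
  (forall z, `|Phi z| <= K) -> 1 <= q ->
  (fun N : nat => ('N[P]_(q%:E)[EFin \o (fun w =>
     (\sum_(1 <= k < N.+1) Phi (X k w)) / N%:R - \int[mu]_z Phi z)%R])%E) @ \oo --> 0%E.
Proof.
move=> mX cvg1 Phi K q mPhi bPhi q1.
have K0 : 0 <= K := le_trans (normr_ge0 _) (bPhi 0).
(* The added 1 keeps the scale positive even for [K = 0]; [phi] maps the interval from -k to k onto
   [0, 1]. *)
pose k := K + 1; have k0 : 0 < k by rewrite ltr_wpDl.
pose phi z := (2 * k)^-1 * (Phi z + k).
have k20 : 0 < 2 * k by rewrite mulr_gt0.
have uphi : unit_valued phi.
  split; first by apply: measurable_funM => //; exact: measurable_funD.
  move=> z; have := bPhi z; rewrite ler_norml => /andP[h1 h2].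
  rewrite /phi mulr_ge0 ?invr_ge0 ?(ltW k20)//=; last by rewrite /k; lra.
  by rewrite mulrC ler_pdivrMr// mul1r /k; lra.
have iPhi := bounded_integrable mu mPhi bPhi.
have ik := finite_measure_integrable_cst mu k measurableT.
have muE : \int[mu]_z phi z = (2 * k)^-1 * (\int[mu]_z Phi z + k).
  rewrite /phi (RintegralZl _ measurableT (integrable_addR iPhi ik)).
  by rewrite (RintegralD measurableT iPhi ik) probability_Rintegral_cst.
pose Z (N : nat) w := (\sum_(1 <= i < N.+1) Phi (X i w)) / N%:R - \int[mu]_z Phi z.
have mZ N : measurable_fun setT (Z N).
  apply: measurable_funB => //; apply: measurable_funM => //.
  by apply: measurable_sum => i; exact: (measurableT_comp mPhi).
apply: (@Lnorm_cvg0 _ _ _ P Z (K + `|\int[mu]_z Phi z|)) => //.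
  move=> N w; apply: le_trans (ler_normB _ _) _; rewrite lerD2r.
  rewrite normrM [X in _ * X]ger0_norm ?invr_ge0//.
  case: N => [|N]; first by rewrite invr0 mulr0.
  rewrite ler_pdivrMr//; apply: le_trans (ler_norm_sum _ _ _) _.
  have -> : K * N.+1%:R = \sum_(1 <= i < N.+2) K by rewrite sumr_const_nat subSS subn0 mulr_natr.
  by apply: ler_sum => i _; exact: bPhi.
rewrite -[X in _ --> X](mulr0 (2 * k)).
have h : (fun n => 2 * k * \int[P]_w `|(\sum_(1 <= i < n.+1) phi (X i w)) / n%:R -
    \int[mu]_z phi z|) @ \oo --> 2 * k * 0.
  by apply: cvgM; [exact: cvg_cst|exact: cvg1].
move: h; apply: cvg_trans; apply: near_eq_cvg; near=> n.
have n0 : (0 : R) < n%:R by rewrite ltr0n; near: n; exact: nbhs_infty_gt.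
have ZE w : `|Z n w| = 2 * k * `|(\sum_(1 <= i < n.+1) phi (X i w)) / n%:R -
    \int[mu]_z phi z|.
  rewrite -[X in X * _](ger0_norm (ltW k20)) -normrM; congr `|_|.
  rewrite /Z muE /phi -mulr_sumr big_split/= sumr_const_nat subSS subn0 -[k *+ n]mulr_natr.
  move: (\sum_(1 <= i < n.+1) _) (Rintegral _ _ _) n0 => a b.
  move: (n%:R) => c c0; by field; rewrite !gt_eqF.
rewrite -RintegralZl//; first by apply: eq_Rintegral => w _; rewrite ZE.
apply: (@bounded_integrable _ _ _ P _ (1 + `|\int[mu]_z phi z|)) => [|w].
  apply: measurableT_comp => //; apply: measurable_funB => //; apply: measurable_funM => //.
  by apply: measurable_sum => i; exact: (measurableT_comp uphi.1).
rewrite normr_id; apply: le_trans (ler_normB _ _) _; rewrite lerD2r.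
rewrite normrM [X in _ * X]ger0_norm ?invr_ge0// ler_pdivrMr//.
apply: le_trans (ler_norm_sum _ _ _) _.
have -> : 1 * n%:R = \sum_(1 <= i < n.+1) (1 : R) by rewrite sumr_const_nat subSS subn0 mul1r.
apply: ler_sum => i _; have /andP[p0 p1] := uphi.2 (X i w); by rewrite ger0_norm.
Unshelve. all: by end_near. Qed.
Lemma norm_integrable (R : realType) (d : nat) disp (Omega : measurableType disp)
    (P : probability Omega R) (e : {RV P >-> 'cV[R]_d}) :
  ('E_P[fun w => eucl_norm (e w)] < +oo)%E ->
  (distribution P e : probability _ R).-integrable setT (EFin \o (fun z : 'cV[R]_d => `|z|)).
Proof.
move=> Ee; apply/integrableP; split.
  by apply/measurable_EFinP; exact: measurable_normmx.
have mn : measurable_fun setT (abse \o (EFin \o (fun z : 'cV[R]_d => `|z|))).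
  apply: measurableT_comp => //.
  by apply/measurable_EFinP; exact: measurable_normmx.
rewrite (@ge0_integral_pushforward _ _ _ _ R e (measurable_funP e) P setT
  (abse \o (EFin \o (fun z : 'cV[R]_d => `|z|))))//; last by move=> z _; exact: abse_ge0.
rewrite preimage_setT; apply: le_lt_trans Ee; rewrite unlock; apply: ge0_le_integral => //.
- by move=> w _; exact: abse_ge0.
- exact: (measurableT_comp mn (measurable_funP e)).
- apply/measurable_EFinP.
  exact: (measurableT_comp (@measurable_eucl_norm R d) (measurable_funP e)).
- by move=> w _; rewrite /= lee_fin normr_id norm_le_eucl.
Qed.

Theorem theorem6p3 (R : realType) (m d : nat) (hm : (1 <= m)%N) (hd : (1 <= d)%N)
    (disp : measure_display) (Omega : measurableType disp)
    (P : probability Omega R)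
    (A B : 'cV[R]_m -> 'M[R]_d)
    (mA : measurable_fun setT A) (mB : measurable_fun setT B)
    (Y : int -> {RV P >-> 'cV[R]_m}) (Ystat : strictly_stationary Y)
    (eps : nat -> {RV P >-> 'cV[R]_d})
    (eps_iid : iid [set t | (1 <= t)%N] eps)
    (eps_Y : independent_processes [set t | (1 <= t)%N] setT eps Y)
    (A_bnd : exists K : R, forall y, op_norm (A y) <= K)
    (B_bnd : exists K : R, forall y, op_norm (B y) <= K)
    (AB_unit : forall y, A y \in unitmx /\ B y \in unitmx)
    (AB_inv_bnd : exists K : R, forall y,
       op_norm (invmx (A y)) + op_norm (invmx (B y)) <= K)
    (f : 'cV[R]_d -> R)
    (f_meas : measurable_fun setT f) (f_ge0 : forall x, 0 <= f x)
    (f_density : forall E : set 'cV[R]_d, measurable E ->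
       distribution P (eps 1%N) E =
       (\int[@cv_lebesgue R d]_(x in E) (f x)%:E)%E)
    (f_bnd_away : forall K : set 'cV[R]_d, compact K ->
       exists2 delta : R, 0 < delta &
         {ae @cv_lebesgue R d, forall x, K x -> delta <= f x})
    (eps_mean : ('E_P[fun w => eucl_norm (eps 1%N w)] < +oo)%E)
    (p : nat) (hp : (1 <= p)%N)
    (contr : ('E_P[fun w =>
       ln (op_norm (block_prod A (fun t => Y t w) p 1))] < 0)%E)
    (eta : R) (heta : 0 < eta) (Gamma : R -> R)
    (Gamma_diff : forall a, - eta < a < eta -> derivable Gamma a 1)
    (Gamma_lim : forall a, - eta < a < eta ->
       (fun n : nat => ((n%:R^-1)%:E * lne 'E_P[fun w =>
          (\prod_(1 <= i < n.+1)
             op_norm (block_prod A (fun t => Y t w) p i) `^ a)%R])%E)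
         @ \oo --> (Gamma a)%:E) :
  exists mu : probability 'cV[R]_d R,
    forall (x0 : 'cV[R]_d) (X : nat -> {RV P >-> 'cV[R]_d}),
      (forall w, X 0%N w = x0) ->
      (forall t w,
         X t.+1 w = A (Y t%:Z w) *m X t w + B (Y t%:Z w) *m eps t.+1 w) ->
      (exists c C : R, [/\ 0 < c, 0 < C & forall N : nat,
         (tv_dist (distribution P (X N)) mu <=
          (C * expR (- c * (N%:R `^ 3^-1)))%:E)%E]) /\
      (ergodic_process Y ->
       forall Phi : 'cV[R]_d -> R, measurable_fun setT Phi ->
         (exists K : R, forall z, `|Phi z| <= K) ->
         forall q : R, 1 <= q ->
           (fun N : nat => ('N[P]_(q%:E)[EFin \o (fun w =>
              (\sum_(1 <= k < N.+1) Phi (X k w)) / N%:R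
                - \int[mu]_z Phi z)%R])%E)
             @ \oo --> 0%E).
Proof.
have [KO AK] := A_bnd; have [KP BK] := B_bnd; have [KQ IK] := AB_inv_bnd.
have KO0 : 0 <= KO := le_trans (op_norm_ge0 (A 0)) (AK 0).
have KP0 : 0 <= KP := le_trans (op_norm_ge0 (B 0)) (BK 0).
(* The added 1 makes the bound strictly positive, as [contraction_moment] asks of [Kinv]. *)
have AI y : op_norm (invmx (A y)) <= KQ + 1.
  apply: (le_trans _ (_ : KQ <= _)); last by rewrite lerDl.
  by apply: le_trans (IK y); rewrite lerDl op_norm_ge0.
have BI y : op_norm (invmx (B y)) <= KQ + 1.
  apply: (le_trans _ (_ : KQ <= _)); last by rewrite lerDl.
  by apply: le_trans (IK y); rewrite lerDr op_norm_ge0.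
have KQ0 : 0 < KQ + 1.
  by rewrite ltr_wpDl// (le_trans _ (IK 0))// addr_ge0 ?op_norm_ge0.
have uA y := (AB_unit y).1; have uB y := (AB_unit y).2.
have mul_le (M : 'cV[R]_m -> 'M[R]_d) (K : R) : (forall y, op_norm (M y) <= K) ->
    forall y (x : 'cV[R]_d), `|M y *m x| <= d%:R * K * `|x|.
  move=> MK y x; apply: le_trans (norm_mulmx_le _ _) _.
  by apply: ler_wpM2r => //; apply: ler_wpM2l.
have HKA := mul_le _ _ AK; have HKB := mul_le _ _ BK.
have KA0 : 0 <= d%:R * KO by rewrite mulr_ge0.
have KB0 : 0 <= d%:R * KP by rewrite mulr_ge0.
(* Bounds B^-1 A in the maximum norm, hence the translation [v] of an attempt;
   [density_minorization] is applied with this radius. *)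
pose KI := d%:R * (KQ + 1) * (d%:R * KO).
have KI0 : 0 <= KI by rewrite !mulr_ge0// ltW.
have HKI y (x : 'cV[R]_d) : `|invmx (B y) *m (A y *m x)| <= KI * `|x|.
  apply: le_trans (mul_le (fun y => invmx (B y)) _ BI y _) _.
  rewrite /KI -[leRHS]mulrA; apply: ler_wpM2l (HKA y x).
  by rewrite mulr_ge0// ltW.
have inu := norm_integrable eps_mean.
have [alpha [alpha0 alpha1 minor]] :=
  @density_minorization R d (distribution P (eps 1%N)) f f_meas f_ge0 f_density f_bnd_away KI KI0.
have [a [C [rho [a0 a1 C0 rho01 moment]]]] := contraction_moment hd mA Ystat
  KO0 KQ0 AK uA AI contr heta Gamma_diff Gamma_lim.
have [V [mbV V0 VQ [c [C' [c0 C'0 VR]]]]] := forgetting_rate mA mB a0 a1 HKA HKB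
  HKI uB KA0 KB0 KI0 alpha0 alpha1 minor inu KO0 AK hp C0 rho01 moment.
have [mu [b b0 Hmu]] := limit_law mA mB Ystat eps_iid eps_Y HKA HKB KA0 KB0 inu
  mbV V0 VQ c0 C'0 VR.
exists mu => x0 X X0 XS; have [K K0 HK] := Hmu x0.
have tvX N E : measurable E ->
    `|fine (P (X N @^-1` E)) - fine (mu E)| <= K * expR (- b * N%:R `^ 3^-1).
  move=> mE; apply: le_trans (HK N E mE); rewrite le_eqVlt; apply/orP; left; apply/eqP.
  have uE := unit_valued_indic mE.
  rewrite -(chain_mean mA mB eps_iid eps_Y uE N X0 XS).
  rewrite -(Rintegral_law (measurable_funP (X N)) uE.1) ?Rintegral_indic//.
  apply: (@bounded_integrable _ _ _ P _ 1) => [|w].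
    exact: (measurableT_comp uE.1 (measurable_funP (X N))).
  by rewrite /= ger0_norm; have /andP[] := uE.2 (X N w).
split.
  exists b, (2 * K); split => //; first exact: mulr_gt0.
  move=> N; rewrite -mulrA; apply: tv_dist_le => E mE; exact: tvX.
move=> Yerg Phi mPhi [KPhi bPhi] q q1.
have EV_cvg : (fun N => \int[P]_w V N (fun j => Y j w)) @ \oo --> (0 : R).
  apply: (@squeeze_cvgr _ _ _ _ (fun=> 0) (fun N => C' * expR (- c * N%:R `^ 3^-1))).
  - by near=> N; rewrite (env_mean_ge0 Y V0) VR.
  - exact: cvg_cst.
  - exact: cvg_stretched_exp.
apply: (averages_Lq (X := fun n => X n) _ _ mPhi bPhi q1) => [n|phi uphi].
  exact: measurable_funP.
exact: (law_of_large_numbers_L1 mA mB Ystat eps_iid eps_Y mbV V0 VQ X0 XS EV_cvg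
  (cvg_stretched_exp K b0) tvX uphi Yerg).
Unshelve. all: by end_near. Qed.
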